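(* Let $(M,N)$ be a weighted manifold pair, with an order $r$ weighting. The weighted deformation space $\delta_{\mathcal W}(M,N)=\mathrm{Hom}_{\mathrm{alg}}(\mathrm{Rees}(C^\infty(M)),\mathbb{R})$ has a unique $C^\infty$ structure, as a manifold of dimension $\dim(M)+1$, in such a way that the functions given by evaluation on elements of $\mathrm{Rees}(C^\infty(M))$ are all smooth. In terms of this manifold structure, the map $$\pi:\delta_{\mathcal W}(M,N)\to\mathbb{R}$$ is a surjective submersion, and the identifications of the fibers $$\pi^{-1}(t)=\begin{cases}\nu_{\mathcal W}(M,N)& t=0,\\ M& t\ne0\end{cases}$$ are diffeomorphisms.
   Context: Weightings. A weight sequence of order $r$ is a sequence of integers $0\le w_1\le\dots\le w_n\le r$. For a chart $U$ with coordinates $x_1,\dots,x_n$, let $C^\infty(U)_{(i)}$ be the ideal generated by monomials $x^s=x_1^{s_1}\cdots x_n^{s_n}$ with $\sum_a s_aw_a\ge i$. An order $r$ weighting on an $n$-dimensional manifold $M$ is a filtration $C^\infty_M=C^\infty_{M,(0)}\supseteq C^\infty_{M,(1)}\supseteq\cdots$ of the structure sheaf by ideal sheaves such that every point has an open neighborhood $U$ with coordinates $x_a$ (weighted coordinates) in which the filtration of $C^\infty(U)$ is given by this local model for a weight sequence of order $r$ (which may depend on the connected component of $N$). $C^\infty_{M,(1)}$ is the vanishing ideal of a closed submanifold $N$; $(M,N)$ is then a weighted manifold pair. Global sections are denoted $C^\infty(M)_{(i)}$, with $C^\infty(M)_{(i)}=C^\infty(M)$ for $i\le0$. Weighted normal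 bundle. $\nu_{\mathcal W}(M,N)=\mathrm{Hom}_{\mathrm{alg}}(\mathrm{gr}(C^\infty(M)),\mathbb{R})$ with $\mathrm{gr}(C^\infty(M))=\bigoplus_{i\ge 0}C^\infty(M)_{(i)}/C^\infty(M)_{(i+1)}$. For $f\in C^\infty(M)_{(i)}$, $f^{[i]}$ denotes the class of $f$ in degree $i$, viewed as a function on $\nu_{\mathcal W}(M,N)$. The smooth structure on $\nu_{\mathcal W}(M,N)$ is the one in which, for weighted coordinates $x_1,\dots,x_n$ on $U$, the functions $(x_a)^{[w_a]}$ are coordinates over $U\cap N$. Weighted deformation space. The Rees algebra is $$\mathrm{Rees}(C^\infty(M))=\Big\{\sum_{i\in\mathbb{Z}}z^{-i}f_i:\ f_i\in C^\infty(M)_{(i)}\Big\}\subseteq C^\infty(M)[z,z^{-1}]$$ (finite sums). The map $\pi$ is evaluation of algebra morphisms on $z$. An algebra morphism $\mathrm{Rees}(C^\infty(M))\to\mathbb{R}$ taking $z$ to $t$ is the same as one on $\mathrm{Rees}(C^\infty(M))/(z-t)\mathrm{Rees}(C^\infty(M))$, which is $\mathrm{gr}(C^\infty(M))$ for $t=0$ and $C^\infty(M)$ for $t\ne0$; this gives the identifications of the fibers (the element $z^{-i}f$, $f\in C^\infty(M)_{(i)}$, restricts to $f^{[i]}$ at $t=0$ and to $t^{-i}f$ at $t\ne0$).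
   Formalization: Uniqueness is false as stated (point: y with y^3=z); proved instead: the structure is the coarsest making evaluations smooth, and unique if also π is a submersion and the fiber identifications are diffeomorphisms. Surjectivity of π is claimed only for nonempty N. *)

(* Defs.v *)
From mathcomp Require Import all_boot all_order all_algebra.
From mathcomp Require Import all_classical all_reals all_analysis.

Set Implicit Arguments.
Unset Strict Implicit.
Unset Printing Implicit Defensive.

Import Order.TTheory GRing.Theory Num.Theory numFieldNormedType.Exports.

Local Open Scope classical_set_scope.
Local Open Scope ring_scope.

(** * Smooth functions on open subsets of R^n *)

Fixpoint Ck (R : realType) (n k : nat) (O : set 'rV[R]_n)
    (f : 'rV[R]_n -> R) : Prop :=
  (forall x, O x -> {for x, continuous f}) /\
  (if k is k'.+1 then
     forall i : 'I_n,
       (forall x, O x -> derivable f x (delta_mx ord0 i)) /\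
       Ck k' O (fun x => 'D_(delta_mx ord0 i) f x)
   else True).

Definition smooth_on (R : realType) (n : nat) (O : set 'rV[R]_n)
  (f : 'rV[R]_n -> R) : Prop := forall k, Ck k O f.

(** * Manifolds

   A C^oo structure on a bare type X is a maximal atlas; the topology of X is
   the one it induces.  Functions defined on a subset are represented by total
   functions, whose values outside that subset are irrelevant. *)

Record chart (R : realType) (n : nat) (X : Type) := Chart {
  dom : set X;
  coord : X -> 'rV[R]_n }.

Definition is_chart (R : realType) (n : nat) (X : Type) (c : chart R n X) :=
  set_inj (dom c) (coord c) /\ open (coord c @` dom c).

Definition transition (R : realType) (n : nat) (X : Type)
    (c d : chart R n X) : Prop :=
  let O := coord c @` (dom c `&` dom d) in
  open O /\
  exists g : 'rV[R]_n -> 'rV[R]_n,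
    (forall i, smooth_on O (fun y => g y ord0 i)) /\
    (forall x, dom c x -> dom d x -> coord d x = g (coord c x)).

Definition compatible (R : realType) (n : nat) (X : Type)
  (c d : chart R n X) : Prop := transition c d /\ transition d c.

Definition maximal_atlas (R : realType) (n : nat) (X : Type)
    (C : set (chart R n X)) : set (chart R n X) :=
  [set c | is_chart c /\ forall d, C d -> compatible c d].

Definition mopen (R : realType) (n : nat) (X : Type)
    (A : set (chart R n X)) (O : set X) : Prop :=
  forall c, A c -> open (coord c @` (O `&` dom c)).

Record smooth_structure (R : realType) (n : nat) (X : Type)
    (A : set (chart R n X)) : Prop := SmoothStructure {
  ss_cover : forall x, exists2 c, A c & dom c x;
  ss_maximal : A = maximal_atlas A;
  ss_hausdorff : forall x y, x <> y ->
    exists O O', [/\ mopen A O, mopen A O', O x, O' y & O `&` O' = set0];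
  ss_second_countable : exists B : set (set X),
    [/\ countable B, (forall O, B O -> mopen A O) &
        forall O x, mopen A O -> O x ->
          exists O', [/\ B O', O' x & O' `<=` O]] }.

(* f is smooth on the open subset U of X. *)
Definition msmooth (R : realType) (n : nat) (X : Type)
    (A : set (chart R n X)) (U : set X) (f : X -> R) : Prop :=
  forall c, A c -> exists2 g : 'rV[R]_n -> R,
    smooth_on (coord c @` (U `&` dom c)) g &
    forall x, U x -> dom c x -> f x = g (coord c x).

(* h is smooth, as a map between manifolds, on the open subset O of X;
   continuity is the openness of the preimages of chart domains. *)
Definition smooth_map (R : realType) (n m : nat) (X Y : Type)
    (A : set (chart R n X)) (B : set (chart R m Y))
    (O : set X) (h : X -> Y) : Prop :=
  forall c, B c ->
    mopen A (O `&` h @^-1` dom c) /\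
    forall i, msmooth A (O `&` h @^-1` dom c) (fun x => coord c (h x) ord0 i).

(* j is a diffeomorphism of Y onto the subset S of X, where smoothness of the
   inverse S -> Y means, as usual for a map on a subset of a manifold, that it
   extends smoothly to a neighborhood of every point of S. *)
Definition diffeo_onto (R : realType) (n m : nat) (X Y : Type)
    (A : set (chart R n X)) (B : set (chart R m Y))
    (j : Y -> X) (S : set X) : Prop :=
  [/\ smooth_map B A setT j,
      range j = S &
      forall y, exists (O : set X) (k : X -> Y),
        [/\ mopen A O, O (j y), smooth_map A B O k &
            forall y', O (j y') -> k (j y') = y']].

(* In the submersivity condition, g is f in the chart c; its values outside
   the open set [coord c @` dom c] do not affect the differential. *)
Definition submersion (R : realType) (n : nat) (X : Type)
    (A : set (chart R n X)) (f : X -> R) : Prop :=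
  msmooth A setT f /\
  forall c x (g : 'rV[R]_n -> R), A c -> dom c x ->
    (forall y, dom c y -> f y = g (coord c y)) ->
    forall v : R, exists u : 'rV[R]_n, 'd g (coord c x) u = v.

Definition closed_submanifold (R : realType) (n : nat) (X : Type)
    (A : set (chart R n X)) (N : set X) : Prop :=
  mopen A (~` N) /\
  forall x, N x -> exists2 c, A c /\ dom c x &
    exists I : {set 'I_n}, forall y, dom c y ->
      N y <-> (forall a, a \in I -> coord c y ord0 a = 0).

(** * Weightings

   [F i U] is C^oo(U)_(i), for U open and i >= 0. *)

Definition weight_sequence (n r : nat) (w : 'I_n -> nat) : Prop :=
  (forall a b : 'I_n, (a <= b)%N -> (w a <= w b)%N) /\
  (forall a, (w a <= r)%N).

(* The ideal of C^oo(U), with U the domain of c, generated by the monomials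
   x^s with \sum_a s_a w_a >= i, where x_a are the coordinates of c. *)
Definition model_ideal (R : realType) (n : nat) (X : Type)
    (A : set (chart R n X)) (c : chart R n X) (w : 'I_n -> nat) (i : nat)
    (f : X -> R) : Prop :=
  exists (m : nat) (g : 'I_m -> X -> R) (s : 'I_m -> 'I_n -> nat),
    [/\ forall k, msmooth A (dom c) (g k),
        forall k, (i <= \sum_(a < n) s k a * w a)%N &
        forall x, dom c x ->
          f x = \sum_(k < m) g k x * \prod_(a < n) coord c x ord0 a ^+ s k a].

Definition weighted_chart (R : realType) (n : nat) (X : Type)
    (A : set (chart R n X)) (r : nat) (F : nat -> set X -> set (X -> R))
    (c : chart R n X) (w : 'I_n -> nat) : Prop :=
  [/\ A c, weight_sequence r w &
      forall i f, F i (dom c) f <-> model_ideal A c w i f].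

Record weighting (R : realType) (n : nat) (X : Type)
    (A : set (chart R n X)) (r : nat) (F : nat -> set X -> set (X -> R))
    : Prop := Weighting {
  wt_zero : forall U f, mopen A U -> F 0%N U f <-> msmooth A U f;
  wt_decr : forall i U, mopen A U -> F i.+1 U `<=` F i U;
  wt_ideal0 : forall i U, mopen A U -> F i U 0;
  wt_idealD : forall i U f g, mopen A U -> F i U f -> F i U g -> F i U (f + g);
  wt_idealM : forall i U f g, mopen A U ->
    msmooth A U f -> F i U g -> F i U (f * g);
  (* elements of C^oo(U) are functions on U *)
  wt_ext : forall i U f g, mopen A U ->
    (forall x, U x -> f x = g x) -> F i U f -> F i U g;
  wt_restrict : forall i U V, mopen A U -> mopen A V -> V `<=` U ->
    F i U `<=` F i V;
  wt_local : forall i U f, mopen A U ->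
    (forall x, U x -> exists V, [/\ mopen A V, V x, V `<=` U & F i V f]) ->
    F i U f;
  wt_coordinates : forall x, exists c w,
    dom c x /\ weighted_chart A r F c w }.

Record weighted_pair (R : realType) (n : nat) (X : Type)
    (A : set (chart R n X)) (r : nat) (F : nat -> set X -> set (X -> R))
    (N : set X) : Prop := WeightedPair {
  wp_weighting : weighting A r F;
  wp_submanifold : closed_submanifold A N;
  wp_vanishing : forall U f, mopen A U ->
    F 1%N U f <-> msmooth A U f /\ forall x, U x -> N x -> f x = 0 }.

(* C^oo(X)_(i) for i : int, equal to C^oo(X) for i <= 0. *)
Definition filt (R : realType) (X : Type) (F : nat -> set X -> set (X -> R))
    (i : int) : set (X -> R) :=
  if i is Posz k then F k setT else F 0%N setT.

(** * The Rees algebra and the associated graded algebra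

   A Laurent polynomial \sum_i z^(-i) p_i is represented by its coefficients:
   [p i] is the coefficient of z^(-i). *)

Definition laurent (R : realType) (X : Type) : Type := int -> X -> R.

Definition monomial (R : realType) (X : Type) (i : int) (f : X -> R) :
  laurent R X := fun j => if j == i then f else 0.

(* [\sum_(i \in _)] is the sum over the (finite) support. *)
Definition laurent_mul (R : realType) (X : Type) (p q : laurent R X) :
  laurent R X := fun k => \sum_(i \in [set: int]) p i * q (k - i).

Definition finite_support (R : realType) (X : Type) (p : laurent R X) : Prop :=
  finite_set [set i | p i <> 0].

(* Morphisms of unital R-algebras to R from the subalgebra S; they are
   extended by 0 outside S, so that equal morphisms are equal functions. *)
Record alg_hom (R : realType) (X : Type) (S : set (laurent R X))
    (h : laurent R X -> R) : Prop := AlgHom {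
  ah_one : h (monomial 0 1) = 1;
  ah_add : forall p q : laurent R X, S p -> S q -> h (p + q) = h p + h q;
  ah_scale : forall (a : R) (p : laurent R X), S p -> h (a *: p) = a * h p;
  ah_mul : forall p q, S p -> S q -> h (laurent_mul p q) = h p * h q;
  ah_outside : forall p, ~ S p -> h p = 0 }.

Definition rees (R : realType) (X : Type) (F : nat -> set X -> set (X -> R)) :
    set (laurent R X) :=
  [set p | finite_support p /\ forall i, filt F i (p i)].

(* The algebra \bigoplus_(i >= 0) C^oo(X)_(i) and its ideal
   \bigoplus_(i >= 0) C^oo(X)_(i+1); their quotient is gr(C^oo(X)). *)
Definition gr_num (R : realType) (X : Type) (F : nat -> set X -> set (X -> R)) :
    set (laurent R X) :=
  [set p | rees F p /\ forall k, p (Negz k) = 0].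

Definition gr_den (R : realType) (X : Type) (F : nat -> set X -> set (X -> R)) :
    set (laurent R X) :=
  [set p | gr_num F p /\ forall k : nat, F k.+1 setT (p k)].

(** * The weighted normal bundle *)

Definition nu (R : realType) (X : Type) (F : nat -> set X -> set (X -> R)) :
    Type :=
  {h : laurent R X -> R |
    alg_hom (gr_num F) h /\ forall p, gr_den F p -> h p = 0}.

(* f^[i] for f in C^oo(X)_(i). *)
Definition symb (R : realType) (X : Type) (F : nat -> set X -> set (X -> R))
    (i : nat) (f : X -> R) (h : nu F) : R :=
  sval h (monomial i f).

(* h lies over the point x under the projection nu_W(X, N) -> N. *)
Definition over (R : realType) (X : Type) (F : nat -> set X -> set (X -> R))
    (h : nu F) (x : X) : Prop :=
  forall f, F 0%N setT f -> symb 0 f h = f x.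

(* Over U \cap N, the function (x_a)^[w_a] is computed on a global section in
   C^oo(X)_(w_a) that coincides with x_a near the base point. *)
Definition nu_charts (R : realType) (n : nat) (X : Type)
    (A : set (chart R n X)) (r : nat) (F : nat -> set X -> set (X -> R))
    (N : set X) : set (chart R n (nu F)) :=
  [set e | exists c w,
    [/\ weighted_chart A r F c w,
        dom e = [set h | exists x, [/\ dom c x, N x & over h x]] &
        forall (h : nu F) x a g, dom c x -> N x -> over h x ->
          F (w a) setT g ->
          (exists O, [/\ mopen A O, O x, O `<=` dom c &
             forall y, O y -> g y = coord c y ord0 a]) ->
          coord e h ord0 a = symb (w a) g h]].
Arguments nu_charts {R n X} A r F N.

Definition nu_atlas (R : realType) (n : nat) (X : Type)
    (A : set (chart R n X)) (r : nat) (F : nat -> set X -> set (X -> R))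
    (N : set X) : set (chart R n (nu F)) :=
  maximal_atlas (nu_charts A r F N).
Arguments nu_atlas {R n X} A r F N.

(** * The weighted deformation space *)

Definition delta (R : realType) (X : Type)
    (F : nat -> set X -> set (X -> R)) : Type :=
  {h : laurent R X -> R | alg_hom (rees F) h}.

Definition evaluation (R : realType) (X : Type)
    (F : nat -> set X -> set (X -> R)) (p : laurent R X) (h : delta F) : R :=
  sval h p.

(* Evaluation on z = z^(-(-1)) 1. *)
Definition delta_pi (R : realType) (X : Type)
    (F : nat -> set X -> set (X -> R)) (h : delta F) : R :=
  evaluation (monomial (- 1) 1) h.

(* The element of gr(C^oo(X)) to which p restricts at t = 0; for i < 0,
   C^oo(X)_(i) / C^oo(X)_(i+1) = 0. *)
Definition gr_part (R : realType) (X : Type) (p : laurent R X) : laurent R X :=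
  fun i => if 0 <= i then p i else 0.

Definition fiber0_diffeo (R : realType) (n : nat) (X : Type)
    (A : set (chart R n X)) (r : nat) (F : nat -> set X -> set (X -> R))
    (N : set X) (D : set (chart R n.+1 (delta F))) : Prop :=
  exists j : nu F -> delta F,
    (forall h p, rees F p -> evaluation p (j h) = sval h (gr_part p)) /\
    diffeo_onto D (nu_atlas A r F N) j [set h | delta_pi h = 0].

Definition fiber_diffeo (R : realType) (n : nat) (X : Type)
    (A : set (chart R n X)) (F : nat -> set X -> set (X -> R))
    (D : set (chart R n.+1 (delta F))) (t : R) : Prop :=
  exists j : X -> delta F,
    (forall x p, rees F p ->
       evaluation p (j x) = \sum_(i \in [set: int]) t ^ (- i) * p i x) /\
    diffeo_onto D A j [set h | delta_pi h = t].

(* Main.v *)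
(* A morphism h from the Rees algebra to R has a parameter t = h(z), and its
   restriction to C^oo(M), the degree 0 part, is evaluation at a point of M
   ("Milnor's exercise").  In weighted coordinates x_a on U, h is determined by t
   and the numbers y_a = h(z^(-w_a) x_a), since x_a = t^(w_a) y_a at the base
   point and z^(-i) f is, near it, a combination with smooth coefficients of
   monomials in z and the z^(-w_a) x_a.  All (t, y) with (t^(w_a) y_a)_a in the
   image of U occur: this is clear for t != 0, and the points with t = 0 are
   limits of those.  The numbers (t, y) are thus the coordinates of a chart.

   The y_a are locally evaluations on Rees elements, so a map into the
   deformation space is smooth as soon as the evaluations along it are; this
   gives the compatibility of charts and the smoothness of the fiber inclusions
   and of the identity from any other structure D' making evaluations smooth.  If
   moreover pi is a submersion for D' with the prescribed fibers, the
   differential of that identity is injective, and the inverse function theorem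
   shows that it is a diffeomorphism. *)

Require Import Defs.
From mathcomp Require Import all_boot all_order all_algebra.
From mathcomp Require Import all_classical all_reals all_analysis.
From mathcomp Require Import finmap ring lra zify.
Import Defs.

Set Implicit Arguments.
Unset Strict Implicit.
Unset Printing Implicit Defensive.

Import Order.TTheory GRing.Theory Num.Theory numFieldNormedType.Exports.

Local Open Scope classical_set_scope.
Local Open Scope ring_scope.

(** * Calculus of C^k functions *)

Section SmoothOn.
Context {R : realType}.
Implicit Types n k : nat.

(** Smooth evaluations alone do not determine the structure: transporting it along a smooth
    homeomorphism whose inverse is not smooth leaves every evaluation smooth and gives a different
    structure. Hence the last clause of [theorem5p1] asserts only a smooth identity map until
    [delta_pi] is required to be a submersion with the prescribed fibers. The differential of the
    identity is then injective by linear algebra: a vector that it kills is killed by the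
    differential of [delta_pi], hence tangent to a fiber for [D']. That fiber carries the same
    structure inside [D'] and inside [D], and its inclusion into [D] is an immersion, so the vector
    is zero.

    Elements of the Rees algebra are global functions, whereas weighted coordinates are local. The
    numbers [y_a] are therefore evaluations on coordinates cut off near the base point, and one has
    to know that such values depend only on germs there ([dval_local]).

    Surjectivity of [delta_pi] is asserted for nonempty [N] only: a point of the zero fiber has its
    base point in [N] ([base_N]). *)

Lemma CkS n k (O : set 'rV[R]_n) (f : 'rV[R]_n -> R) : Ck k.+1 O f <->
  (forall x, O x -> {for x, continuous f}) /\
  (forall i : 'I_n, (forall x, O x -> derivable f x (delta_mx ord0 i)) /\
    Ck k O (fun x => 'D_(delta_mx ord0 i) f x)).
Proof. by []. Qed.

Lemma Ck0 n (O : set 'rV[R]_n) (f : 'rV[R]_n -> R) : Ck 0 O f <->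
  (forall x, O x -> {for x, continuous f}).
Proof. by split=> [[]|]. Qed.

#[local] Opaque Ck.

Lemma Ck_continuous n k (O : set 'rV[R]_n) f x :
  Ck k O f -> O x -> {for x, continuous f}.
Proof. by case: k => [/Ck0 cf|k /CkS [cf _]] /cf. Qed.

Lemma CkW n k (O : set 'rV[R]_n) (f : 'rV[R]_n -> R) : Ck k.+1 O f -> Ck k O f.
Proof.
elim: k f => [|k IH] f /CkS[cf df]; first exact/Ck0.
apply/CkS; split=> // i; have [d1 d2] := df i.
by split; [exact: d1|exact: IH].
Qed.

Lemma Ck_sub n k (O O' : set 'rV[R]_n) f : O' `<=` O -> Ck k O f -> Ck k O' f.
Proof.
move=> sO; elim: k f => [|k IH] f; first by move=> /Ck0 cf; apply/Ck0 => x /sO/cf.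
move=> /CkS[cf df]; apply/CkS; split=> [x /sO/cf//|i].
by have [d1 d2] := df i; split=> [x /sO/d1//|]; exact: IH.
Qed.

(** Continuity and derivability at a point already refer to full neighbourhoods in ['rV[R]_n], so
    the sets [V] need not be open. *)
Lemma Ck_local n k (O : set 'rV[R]_n) (f : 'rV[R]_n -> R) :
  (forall x, O x -> exists2 V : set 'rV[R]_n, V x & Ck k V f) -> Ck k O f.
Proof.
elim: k f => [|k IH] f H.
  by apply/Ck0 => x /H [V Vx /Ck_continuous]; apply.
apply/CkS; split.
  by move=> x /H [V Vx /Ck_continuous]; apply.
move=> i; split=> [x /H [V Vx /CkS[_ /(_ i) [dV _]]]|]; first exact: dV.
by apply: IH => x /H [V Vx /CkS[_ /(_ i) [_ ?]]]; exists V.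
Qed.

Lemma continuous_ext n (O : set 'rV[R]_n) (f g : 'rV[R]_n -> R) x : open O ->
  (forall x, O x -> f x = g x) -> O x ->
  {for x, continuous f} -> {for x, continuous g}.
Proof.
move=> oO fg Ox cf; change (g @ x --> g x); rewrite -(fg x Ox).
have H : \forall y \near x, f y = g y.
  by apply: filterS (open_nbhs_nbhs (conj oO Ox)) => y /fg ->.
exact: cvg_trans (near_eq_cvg H) cf.
Qed.

Lemma Ck_ext n k (O : set 'rV[R]_n) (f g : 'rV[R]_n -> R) : open O ->
  (forall x, O x -> f x = g x) -> Ck k O f -> Ck k O g.
Proof.
move=> oO; elim: k f g => [|k IH] f g fg.
  by move=> /Ck0 cf; apply/Ck0 => x Ox; exact: (continuous_ext oO fg Ox (cf x Ox)).
move=> /CkS[cf df]; apply/CkS.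
have nfg x : O x -> \forall y \near x, f y = g y.
  by move=> Ox; apply: filterS (open_nbhs_nbhs (conj oO Ox)) => y /fg ->.
split=> [x Ox|i]; first exact: (continuous_ext oO fg Ox (cf x Ox)).
have [d1 d2] := df i; split=> [x Ox|].
  by apply: near_eq_derivable (d1 _ Ox); exact: nfg.
apply: IH d2 => x Ox; apply: near_eq_derive; exact: nfg.
Qed.

Lemma Ck_cst n k (O : set 'rV[R]_n) (a : R) : Ck k O (fun=> a).
Proof.
elim: k a => [|k IH] a; first by apply/Ck0 => x _; exact: cst_continuous.
apply/CkS; split=> [x _|i]; first exact: cst_continuous.
split=> [x _|]; first exact: derivable_cst.
have -> : (fun x => 'D_(delta_mx ord0 i) (fun=> a : R) x) = (fun _ : 'rV[R]_n => 0).
  by apply/eq_fun => x; exact: derive_cst.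
exact: IH.
Qed.

Lemma CkD n k (O : set 'rV[R]_n) (f g : 'rV[R]_n -> R) : open O ->
  Ck k O f -> Ck k O g -> Ck k O (fun x => f x + g x).
Proof.
move=> oO; elim: k f g => [|k IH] f g.
  by move=> /Ck0 cf /Ck0 cg; apply/Ck0 => x Ox; apply: continuousD; [exact: cf|exact: cg].
move=> /CkS[cf df] /CkS[cg dg]; apply/CkS.
split=> [x Ox|i]; first by apply: continuousD; [exact: cf|exact: cg].
have [f1 f2] := df i; have [g1 g2] := dg i; split=> [x Ox|].
  by apply: derivableD; [exact: f1|exact: g1].
apply: Ck_ext (IH _ _ f2 g2) => // x Ox.
by rewrite [RHS]deriveD//; [exact: f1|exact: g1].
Qed.

Lemma CkM n k (O : set 'rV[R]_n) (f g : 'rV[R]_n -> R) : open O ->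
  Ck k O f -> Ck k O g -> Ck k O (fun x => f x * g x).
Proof.
move=> oO; elim: k f g => [|k IH] f g.
  by move=> /Ck0 cf /Ck0 cg; apply/Ck0 => x Ox; apply: continuousM; [exact: cf|exact: cg].
move=> Cf Cg; have /CkS[cf df] := Cf; have /CkS[cg dg] := Cg; apply/CkS.
split=> [x Ox|i]; first by apply: continuousM; [exact: cf|exact: cg].
have [f1 f2] := df i; have [g1 g2] := dg i; split=> [x Ox|].
  by apply: derivableM; [exact: f1|exact: g1].
apply: (@Ck_ext _ _ _ (fun x => f x * 'D_(delta_mx ord0 i) g x
                              + g x * 'D_(delta_mx ord0 i) f x)) => //.
  by move=> x Ox; rewrite [RHS]deriveM//; [exact: f1|exact: g1].
by apply: CkD => //; apply: IH => //; exact: CkW.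
Qed.

Lemma CkV n k (O : set 'rV[R]_n) (f : 'rV[R]_n -> R) : open O -> (forall x, O x -> f x != 0) ->
  Ck k O f -> Ck k O (fun x => (f x)^-1).
Proof.
move=> oO f0; elim: k => [|k IH].
  by move=> /Ck0 cf; apply/Ck0 => x Ox; apply: continuousV; [exact: f0|exact: cf].
move=> Cf; have /CkS[cf df] := Cf; apply/CkS.
split=> [x Ox|i]; first by apply: continuousV; [exact: f0|exact: cf].
have [f1 f2] := df i; split=> [x Ox|].
  by apply: derivableV; [exact: f0|exact: f1].
apply: (@Ck_ext _ _ _ (fun x => (-1 * ((f x)^-1 * (f x)^-1))
                              * 'D_(delta_mx ord0 i) f x)) => //.
  move=> x Ox; rewrite [RHS]deriveV//; [|exact: f0|exact: f1].
  by rewrite -invfM mulN1r expr2.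
have CV := IH (CkW Cf).
by apply: CkM => //; apply: CkM => //; [exact: Ck_cst|exact: CkM].
Qed.

Lemma coord_is_derive n (i j : 'I_n) (x : 'rV[R]_n) :
  is_derive x (delta_mx ord0 i) (fun y : 'rV[R]_n => y ord0 j) (i == j)%:R.
Proof.
have dc := @differentiable_coord R 1 n x ord0 j.
apply: DeriveDef; first exact: diff_derivable.
rewrite /derive; apply: cvg_lim => //.
apply: cvg_near_cst; near=> h.
rewrite /= !mxE eqxx /= eq_sym addrK /GRing.scale /=; case: eqVneq => _; last by rewrite !mulr0.
by rewrite mulr1 mulVf//; near: h; exact: nbhs_dnbhs_neq.
Unshelve. all: by end_near. Qed.

Lemma Ck_coord n k (O : set 'rV[R]_n) (j : 'I_n) : Ck k O (fun x => x ord0 j).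
Proof.
have cc x : O x -> {for x, continuous (fun x : 'rV[R]_n => x ord0 j)}.
  by move=> _; apply: coord_continuous.
case: k => [|k]; first exact/Ck0.
apply/CkS; split=> // i; split=> [x _|].
  by have [] := coord_is_derive i j x.
rewrite (_ : (fun _ => _) = fun=> (i == j)%:R); first exact: Ck_cst.
by apply/funext => x; have [_ ->] := coord_is_derive i j x.
Qed.

Lemma Ck_sum n k (O : set 'rV[R]_n) I (r : seq I) (P : pred I) (F : I -> 'rV[R]_n -> R) :
  open O -> (forall i, P i -> Ck k O (F i)) ->
  Ck k O (fun x => \sum_(i <- r | P i) F i x).
Proof.
move=> oO CF; elim: r => [|i r IH].
  by under [X in Ck _ _ X]eq_fun do rewrite big_nil; exact: Ck_cst.
under [X in Ck _ _ X]eq_fun do rewrite big_cons.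
by case: (boolP (P i)) => // /CF Ci; apply: CkD.
Qed.

(** The symmetric range of [s] covers both signs of [h], so that no segment has to be oriented where
    the lemma is used. *)
Lemma mvt_between (phi dphi : R -> R) (h : R) :
  (forall s : R, `|s| <= `|h| -> is_derive s 1 phi (dphi s)) ->
  exists2 c, `|c| <= `|h| & phi h - phi 0 = dphi c * h.
Proof.
move=> H.
have cont a b : `|a| <= `|h| -> `|b| <= `|h| -> {within `[a, b], continuous phi}.
  move=> Ha Hb; apply: derivable_within_continuous => s.
  rewrite in_itv /= => /andP[as_ sb]; have [] // := H s.
  by move: Ha Hb; rewrite !ler_norml => /andP[? ?] /andP[? ?];
    rewrite (le_trans _ as_)// (le_trans sb).
have bnd a b s : `|a| <= `|h| -> `|b| <= `|h| -> s \in `[a, b] -> `|s| <= `|h|.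
  rewrite in_itv /= => + + /andP[as_ sb].
  by rewrite !ler_norml => /andP[? ?] /andP[? ?];
    rewrite (le_trans _ as_)// (le_trans sb).
have h0 : `|0 : R| <= `|h| by rewrite normr0.
have [hp|hn] := leP 0 h.
  have [|c cab ->] := @MVT_segment R phi dphi 0 h hp _ (cont _ _ h0 (lexx _)).
    by move=> s /subset_itv_oo_cc sab; apply: H; apply: bnd sab.
  by exists c; [exact: bnd cab|rewrite subr0].
have [|c cab E] := @MVT_segment R phi dphi h 0 (ltW hn) _ (cont _ _ (lexx _) h0).
  by move=> s /subset_itv_oo_cc sab; apply: H; apply: bnd sab.
exists c; first exact: bnd cab.
by rewrite -opprB E sub0r mulrN opprK.
Qed.

Lemma derivable_line n (f : 'rV[R]_n -> R) (x v : 'rV[R]_n) (s : R) :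
  derivable f (x + s *: v) v ->
  is_derive s 1 (fun s => f (x + s *: v)) ('D_v f (x + s *: v)).
Proof.
move=> df; have E : (fun h : R => h^-1 *: (((fun s => f (x + s *: v)) \o shift s) (h *: (1:R)) - f (x + s *: v))) =
   (fun h => h^-1 *: ((f \o shift (x + s *: v)) (h *: v) - f (x + s *: v))).
  apply/eq_fun => h /=; congr (_ *: (f _ - _)).
  by rewrite [_ *: 1]mulr1 scalerDl addrCA.
by apply: DeriveDef; rewrite /derivable /derive E.
Qed.

Lemma ball_rV n (x y : 'rV[R]_n) (e : R) : 0 < e ->
  (forall i, `|x ord0 i - y ord0 i| < e) -> ball x e y.
Proof. by move=> e0 H; split=> // i j; rewrite ord1; exact: H. Qed.

Lemma ball_rVP n (x y : 'rV[R]_n) (e : R) i :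
  ball x e y -> `|x ord0 i - y ord0 i| < e.
Proof. by case=> _ /(_ ord0 i). Qed.

Lemma rV_norm_le n (x : 'rV[R]_n) i : `|x ord0 i| <= `|x|.
Proof.
by rewrite [leRHS]/Num.Def.normr/= mx_normrE; exact: (le_bigmax _ _ (ord0, i)).
Qed.

Lemma open_ball n (O : set 'rV[R]_n) x : open O -> O x ->
  exists2 e : R, 0 < e & ball x e `<=` O.
Proof.
move=> oO Ox; have := open_nbhs_nbhs (conj oO Ox).
by move=> /nbhs_ballP [e /= e0 He]; exists e.
Qed.

(* The zero-gradient case: the difference along a broken line parallel to the
   axes is estimated by the mean value theorem on each piece. *)
Lemma Ck_diff0 n (O : set 'rV[R]_n) (f : 'rV[R]_n -> R) x : open O -> O x ->
  Ck 1 O f -> (forall i, 'D_(delta_mx ord0 i) f x = 0) -> differentiable f x.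
Proof.
move=> oO Ox /CkS[cf df] d0.
suff H : f \o shift x = cst (f x) + (\0 : {linear 'rV[R]_n -> R}) +o_ (0 : 'rV[R]_n) id.
  have c0 : continuous (\0 : {linear 'rV[R]_n -> R}) by move=> ?; apply: cst_continuous.
  by apply/diff_locallyP; rewrite (diff_unique c0 H).
apply: eqaddoE; apply/eqaddoP => e e0.
(* Each of the [n] pieces of the broken line contributes at most [e / n.+1] times the norm of [h];
   the denominator [n.+1] also covers dimension 0. *)
have e1 : 0 < e / n.+1%:R by rewrite divr_gt0.
have [d dp dO] : exists2 d : R, 0 < d & forall y, ball x d y ->
    O y /\ forall i, `|'D_(delta_mx ord0 i) f y| < e / n.+1%:R.
  suff /nbhs_ballP[d d0' H] : \forall y \near x, O y /\ forall i, `|'D_(delta_mx ord0 i) f y| < e / n.+1%:R.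
    by exists d => // y /H.
  have nO := open_nbhs_nbhs (conj oO Ox).
  suff nD : \forall y \near x, forall i : 'I_n, `|'D_(delta_mx ord0 i) f y| < e / n.+1%:R.
    exact: filterI nO nD.
  pose P (i : 'I_n) y := `|'D_(delta_mx ord0 i) f y| < e / n.+1%:R.
  apply: (@filter_forall _ _ P (nbhs x) (nbhs_filter x)) => i.
  have [_ Ci] := df i.
  have := Ck_continuous Ci Ox => /cvgrPdist_lt /(_ _ e1).
  by apply: filterS => y; rewrite d0 sub0r normrN.
near=> h.
have hd : `|h| < d.
  near: h; apply/nbhs_ballP; exists d => //= y; by rewrite -ball_normE /= sub0r normrN.
(* The points [x + hh k] are the vertices of the broken line from [x] to [x + h]. *)
pose hh (k : nat) : 'rV[R]_n := \row_i (if (i < k)%N then h ord0 i else 0).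
have hhn : hh n = h by apply/rowP => i; rewrite mxE ltn_ord.
have hh0 : hh 0%N = 0 by apply/rowP => i; rewrite !mxE.
have E : f (h + x) - f x = \sum_(0 <= k < n) (f (x + hh k.+1) - f (x + hh k)).
  by rewrite [h + x]addrC (telescope_sumr (fun k => f (x + hh k)))// hhn hh0 addr0.
have step (i : 'I_n) : `|f (x + hh i.+1) - f (x + hh i)| <= e / n.+1%:R * `|h|.
  pose v : 'rV[R]_n := delta_mx ord0 i.
  have hS : hh i.+1 = hh i + h ord0 i *: v.
    apply/rowP => j; rewrite !mxE eqxx /= ltnS leq_eqVlt.
    case: eqVneq => [/= /val_inj ->|ji /=].
      by rewrite ltnn eqxx add0r mulr1.
    by rewrite (_ : (j == i) = false) ?mulr0 ?addr0//; apply/negbTE.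
  have inb s : `|s| <= `|h ord0 i| -> ball x d ((x + hh i) + s *: v).
    move=> sh; apply: ball_rV => // j; rewrite !mxE eqxx /= -addrA opprD addNKr.
    rewrite normrN; case: (eqVneq j i) => [->|ji].
      by rewrite ltnn add0r mulr1 (le_lt_trans sh)// (le_lt_trans (rV_norm_le _ _)).
    rewrite mulr0 addr0; case: ifP => _; last by rewrite normr0.
    by rewrite (le_lt_trans (rV_norm_le _ _)).
  have [|c cb] := @mvt_between (fun s => f ((x + hh i) + s *: v))
     (fun s => 'D_v f ((x + hh i) + s *: v)) (h ord0 i).
    move=> s /inb /dO [Os _]; apply: derivable_line.
    by have [dd _] := df i; apply: dd.
  rewrite scale0r addr0 -addrA -hS => ->.
  have [_ /(_ i) Dc] := dO _ (inb _ cb).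
  rewrite normrM; apply: ler_pM => //; [exact: ltW|exact: rV_norm_le].
have -> : (f \o shift x - (cst (f x) + (\0 : {linear 'rV[R]_n -> R}))) h = f (h + x) - f x.
  by rewrite /= !fctE /= addr0.
rewrite E big_mkord; apply: le_trans (ler_norm_sum _ _ _) _.
apply: le_trans (ler_sum _ (fun i _ => step i)) _.
rewrite sumr_const card_ord -mulrnAl -[X in _ <= _ * X]/(`|h|).
apply: ler_wpM2r => //.
by rewrite -mulr_natr mulrAC ler_pdivrMr// ler_pM2l// ler_nat leqnSn.
Unshelve. all: by end_near. Qed.

(** Subtracting the linear function [L] that has the same partial derivatives at [x] reduces to
    [Ck_diff0]. *)
Lemma Ck_diff n (O : set 'rV[R]_n) (f : 'rV[R]_n -> R) x : open O -> O x ->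
  Ck 1 O f -> differentiable f x.
Proof.
move=> oO Ox Cf.
pose a i := 'D_(delta_mx ord0 i) f x.
pose L (y : 'rV[R]_n) : R := \sum_(i < n) (a i * y ord0 i).
have CL : Ck 1 O (fun y => -1 * L y).
  apply: (CkM oO (Ck_cst _ _ (-1))); apply: (Ck_sum _ oO) => i _.
  exact: (CkM oO (Ck_cst _ _ (a i)) (Ck_coord _ _ i)).
have dLi i : differentiable (fun y : 'rV[R]_n => a i * y ord0 i) x.
  by apply: (@differentiableZ _ _ _ (fun y : 'rV[R]_n => y ord0 i : R)); apply: differentiable_coord.
have dL : differentiable L x.
  rewrite (_ : L = \sum_(i < n) (fun y : 'rV[R]_n => a i * y ord0 i)); last first.
    by apply/funext => y; rewrite fct_sumE.
  exact: differentiable_sum.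
have aL i : 'D_(delta_mx ord0 i) L x = a i.
  rewrite (_ : L = \sum_(j < n) (fun y : 'rV[R]_n => a j * y ord0 j)); last first.
    by apply/funext => y; rewrite fct_sumE.
  rewrite derive_sum; last by move=> j; exact: diff_derivable.
  rewrite (bigD1 i)//= big1 ?addr0.
    have [d1 d2] := coord_is_derive i i x.
    by rewrite (@deriveZ _ _ _ (fun y : 'rV[R]_n => y ord0 i : R))// d2 eqxx [_ *: _]mulr1.
  move=> j ji; have [d1 d2] := coord_is_derive i j x.
  by rewrite (@deriveZ _ _ _ (fun y : 'rV[R]_n => y ord0 j : R))// d2 eq_sym (negbTE ji) scaler0.
have /CkS[_ df] := Cf.
have fd i : derivable f x (delta_mx ord0 i) by have [dd _] := df i; exact: dd.
rewrite (_ : f = (fun y => f y + -1 * L y) + L); last first.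
  by apply/funext => y; rewrite !fctE /= mulN1r subrK.
apply: differentiableD => //; apply: (Ck_diff0 oO Ox); first exact: CkD.
move=> i; rewrite (_ : (fun y => _) = f - L); last first.
  by apply/funext => y; rewrite !fctE mulN1r.
by rewrite deriveB ?aL ?subrr//; exact: diff_derivable.
Qed.

Lemma continuous_rV (T : topologicalType) n (G : T -> 'rV[R]_n) x :
  (forall j, {for x, continuous (fun y => G y ord0 j)}) -> {for x, continuous G}.
Proof.
move=> H; apply/cvg_ballP => e e0.
pose P (j : 'I_n) y := `|G x ord0 j - G y ord0 j| < e.
have : \forall y \near x, forall j, P j y.
  apply: (@filter_forall _ _ P (nbhs x) (nbhs_filter x)) => j.
  by have /cvgrPdist_lt /(_ _ e0) := H j.
by apply: filterS => y Py; exact: ball_rV.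
Qed.

Lemma Ck_rV_differentiable m n (O : set 'rV[R]_m) (G : 'rV[R]_m -> 'rV[R]_n) x :
  open O -> O x -> (forall j, Ck 1 O (fun y => G y ord0 j)) -> differentiable G x.
Proof.
move=> oO Ox CG.
rewrite (_ : G = \sum_(j < n) (fun y => G y ord0 j *: delta_mx ord0 j)); last first.
  by apply/funext => y; rewrite fct_sumE [LHS]row_sum_delta.
apply: differentiable_sum => j; apply: differentiableZl.
exact: Ck_diff oO Ox (CG j).
Qed.

Lemma diff_rV n (f : 'rV[R]_n -> R) x u : differentiable f x ->
  'd f x u = \sum_(j < n) u ord0 j * 'D_(delta_mx ord0 j) f x.
Proof.
move=> df; rewrite {1}[u]row_sum_delta linear_sum; apply: eq_bigr => j _.
by rewrite linearZ /= -deriveE.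
Qed.

Lemma diff_chain m n (O : set 'rV[R]_m) (O' : set 'rV[R]_n)
    (f : 'rV[R]_n -> R) (G : 'rV[R]_m -> 'rV[R]_n) x v :
  open O -> open O' -> O x -> O' (G x) ->
  Ck 1 O' f -> (forall j, Ck 1 O (fun y => G y ord0 j)) ->
  derivable (f \o G) x v /\
  'D_v (f \o G) x =
    \sum_(j < n) 'D_(delta_mx ord0 j) f (G x) * 'D_v (fun y => G y ord0 j) x.
Proof.
move=> oO oO' Ox O'x Cf CG.
have dG := Ck_rV_differentiable oO Ox CG.
have df := Ck_diff oO' O'x Cf.
split; first by apply: diff_derivable; exact: differentiable_comp.
rewrite deriveE; last exact: differentiable_comp.
rewrite diff_comp//= diff_rV//; apply: eq_bigr => j _; rewrite mulrC; congr (_ * _).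
by rewrite -deriveE// derive_mx ?mxE//; exact: diff_derivable.
Qed.

(** By the chain rule a partial derivative of the composite is a sum of products of a partial
    derivative of [f], composed with [G], and one of [G]; the induction hypothesis applies to the
    former. *)
Lemma Ck_comp m n k (O : set 'rV[R]_m) (O' : set 'rV[R]_n)
    (f : 'rV[R]_n -> R) (G : 'rV[R]_m -> 'rV[R]_n) :
  open O -> open O' -> (forall x, O x -> O' (G x)) ->
  Ck k O' f -> (forall j, Ck k O (fun y => G y ord0 j)) ->
  Ck k O (fun x => f (G x)).
Proof.
move=> oO oO' sO; elim: k f => [|k IH] f Cf CG.
  apply/Ck0 => x Ox; apply: (@continuous_comp _ _ _ G f).
    by apply: continuous_rV => j; exact: Ck_continuous (CG j) Ox.
  by apply: Ck_continuous Cf _; exact: sO.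
have cont x : O x -> {for x, continuous (fun x => f (G x))}.
  move=> Ox; apply: (@continuous_comp _ _ _ G f).
    by apply: continuous_rV => j; exact: Ck_continuous (CG j) Ox.
  by apply: Ck_continuous Cf _; exact: sO.
have Cf1 : Ck 1 O' f by elim: (k) Cf => // l IHl /CkW/IHl.
have CG1 j : Ck 1 O (fun y => G y ord0 j) by elim: (k) (CG j) => // l IHl /CkW/IHl.
have /CkS[_ df] := Cf.
apply/CkS; split=> // i.
split=> [x Ox|]; first by have [] := diff_chain (delta_mx ord0 i) oO oO' Ox (sO x Ox) Cf1 CG1.
apply: (@Ck_ext _ _ _ (fun x => \sum_(j < n) 'D_(delta_mx ord0 j) f (G x) *
  'D_(delta_mx ord0 i) (fun y => G y ord0 j) x)) => //.
  by move=> x Ox; have [_ <-] := diff_chain (delta_mx ord0 i) oO oO' Ox (sO x Ox) Cf1 CG1.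
apply: (Ck_sum _ oO) => j _; apply: (CkM oO).
  by have [_ d2] := df j; apply: (IH _ d2) => l; exact: CkW.
by have /CkS[_ dG] := CG j; have [] := dG i.
Qed.

End SmoothOn.

(** * A smooth step function *)

Section Flat.
Context {R : realType}.

(* [flat k s = s^-k exp (-1/s)] for [s > 0]: the derivatives of the flat
   function [flat 0] are combinations of these. *)
Definition flat (k : nat) (s : R) : R :=
  if 0 < s then s ^- k * expR (- s^-1) else 0.

Lemma flat_ge0 k s : 0 <= flat k s.
Proof.
rewrite /flat; case: ifP => // s0.
by rewrite mulr_ge0 ?expR_ge0// invr_ge0 exprn_ge0// ltW.
Qed.

Lemma flat_gt0 k s : 0 < s -> 0 < flat k s.
Proof. by move=> s0; rewrite /flat s0 mulr_gt0 ?expR_gt0// invr_gt0 exprn_gt0. Qed.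

Lemma flat_le0 k s : s <= 0 -> flat k s = 0.
Proof. by rewrite /flat leNgt => /negbTE ->. Qed.

(** This is [y^(k+1) / (k+1)! <= expR y] at [y = s^-1]. On the positive side the difference quotient
    of [flat k] at 0 is [flat k.+1], so a linear bound for every index gives derivative 0 there. *)
Lemma flat_bound k s : 0 < s -> flat k s <= k.+1`!%:R * s.
Proof.
move=> s0; rewrite /flat s0.
have si0 : 0 <= s^-1 by rewrite invr_ge0 ltW.
have E : s ^- k.+1 / k.+1`!%:R <= expR s^-1.
  by have := expR_ge1Dxn k si0; rewrite exprVn => /(le_trans _); apply; rewrite lerDr.
rewrite expRN ler_pdivrMr ?expR_gt0//.
have f0 : 0 < k.+1`!%:R :> R by rewrite ltr0n fact_gt0.
have := E; rewrite ler_pdivrMr// => /(ler_wpM2r (ltW s0)).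
rewrite exprSr invfM -mulrA mulVf ?gt_eqF// mulr1.
by rewrite -mulrA [expR _ * _]mulrC.
Qed.

Lemma is_derive_comp1 (V : normedModType R) (f : V -> R) (phi : R -> R) x v df dphi :
  differentiable f x -> is_derive x v f df -> is_derive (f x) 1 phi dphi ->
  is_derive x v (phi \o f) (dphi * df).
Proof.
move=> dif [_ <-] [dp <-].
have dip : differentiable phi (f x) by apply/derivable1_diffP.
have dc : differentiable (phi \o f) x by exact: differentiable_comp.
apply: DeriveDef; first exact: diff_derivable.
rewrite !deriveE// diff_comp//= -[X in 'd phi _ X]mulr1.
by rewrite [X in 'd phi _ X](_ : _ = 'd f x v *: 1)// linearZ [LHS]mulrC.
Qed.

Lemma flat_is_derive k (s : R) :
  is_derive s 1 (flat k) (flat k.+2 s - k%:R * flat k.+1 s).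
Proof.
have [s0|s0|->] := ltgtP s 0.
- rewrite !flat_le0 ?(ltW s0)// mulr0 subr0.
  have H : \forall y \near s, cst 0 y = flat k y.
    have := @lt_nbhsl R s 0 s0; apply: filterS => y y0.
    by rewrite /cst flat_le0// ltW.
  exact: (near_eq_is_derive H (is_derive_cst (0 : R) s 1)).
- have H : \forall y \near s, ((fun y : R => y^-1) ^+ k * (expR \o (fun y => - y^-1))) y = flat k y.
    have := @lt_nbhsr R 0 s s0; apply: filterS => y y0.
    by rewrite /flat y0 -exprVn [LHS]/GRing.mul /= exprfctE.
  have s1 : s != 0 by rewrite gt_eqF.
  have d1 : is_derive s 1 (fun y : R => y^-1) (- s ^- 2).
    apply: DeriveDef; first exact: (@derivableV _ _ id).
    by rewrite (@deriveV _ _ id)// derive_id [_ *: _]mulr1.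
  have d1N : is_derive s 1 (fun y : R => - y^-1) (s ^- 2).
    by rewrite -[s ^- 2]opprK; exact: is_deriveN.
  have d2 : is_derive s 1 (expR \o (fun y => - y^-1)) (expR (- s^-1) * s ^- 2).
    apply: (is_derive_comp1 _ d1N (is_derive_expR (- s^-1))).
    by apply/derivable1_diffP; have [] := d1N.
  have d3 := is_deriveX k d1.
  have := near_eq_is_derive H (is_deriveM d3 d2).
  suff -> : ((fun y : R => y^-1) ^+ k) s *: (expR (- s^-1) * s ^- 2) +
     (expR \o (fun y => - y^-1)) s *: (k%:R * s^-1 ^+ k.-1 *: - s ^- 2) = flat k.+2 s - k%:R * flat k.+1 s by [].
  rewrite /flat s0 exprfctE /= /GRing.scale /= mulrN mulrN; congr (_ - _).
    by rewrite mulrCA mulrC -!exprVn -exprD addn2.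
  rewrite mulrC -!mulrA; case: (k) => [|l]; first by rewrite !mul0r.
  congr (_ * _); rewrite mulrA; congr (_ * _).
  by rewrite -!exprVn -exprD addn2.
- rewrite !flat_le0// mulr0 subr0.
  have E : (fun h : R => h^-1 *: ((flat k \o shift 0) (h *: (1:R)) - flat k 0)) @ 0^' --> (0 : R).
    apply/cvgrPdist_le => e e0.
    have c0 : 0 < k.+2`!%:R :> R by rewrite ltr0n fact_gt0.
    near=> h; rewrite /= addr0 [_ *: 1]mulr1 (flat_le0 _ (lexx 0)) subr0 sub0r normrN.
    have h0 : h != 0 by near: h; exact: nbhs_dnbhs_neq.
    have [hp|hn] := ltP 0 h; last by rewrite flat_le0// scaler0 normr0 ltW.
    have -> : h^-1 *: flat k h = flat k.+1 h.
      by rewrite /flat hp exprS invfM -mulrA.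
    rewrite ger0_norm ?flat_ge0//; apply: le_trans (flat_bound _ hp) _.
    rewrite mulrC -ler_pdivlMr//; apply: le_trans (ler_norm _) _; apply: ltW.
    by near: h; apply: dnbhs0_lt; exact: divr_gt0.
  apply: DeriveDef; first by apply/cvg_ex; exists 0.
  by apply: cvg_lim E.
Unshelve. all: by end_near. Qed.

(** The induction on [k] keeps [m] general because a derivative of [flat m] involves the indices
    [m.+1] and [m.+2]. *)
Lemma Ck_flat n m k (O : set 'rV[R]_n) (f : 'rV[R]_n -> R) : open O ->
  Ck k O f -> Ck k O (fun x => flat m (f x)).
Proof.
move=> oO; elim: k m => [|k IH] m Cf.
  apply/Ck0 => x Ox; apply: (@continuous_comp _ _ _ f (flat m)).
    exact: Ck_continuous Cf Ox.
  by apply: differentiable_continuous; apply/derivable1_diffP; have [] := flat_is_derive m (f x).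
have /CkS [cf df] := Cf.
have Cf1 : Ck 1 O f by elim: (k) Cf => // l IHl /CkW/IHl.
have dfl x i : O x -> is_derive x (delta_mx ord0 i) (fun x => flat m (f x))
    ((flat m.+2 (f x) - m%:R * flat m.+1 (f x)) * 'D_(delta_mx ord0 i) f x).
  move=> Ox; apply: (@is_derive_comp1 _ f (flat m)).
  - exact: Ck_diff oO Ox Cf1.
  - by have [dfi _] := df i; apply: derivableP; exact: dfi.
  - exact: flat_is_derive.
apply/CkS; split.
  by move=> x Ox; apply: (Ck_continuous (IH m (CkW Cf)) Ox).
move=> i; split=> [x Ox|]; first by have [] := dfl x i Ox.
apply: (Ck_ext oO (f := fun x => (flat m.+2 (f x) + (- m%:R) * flat m.+1 (f x)) * 'D_(delta_mx ord0 i) f x)).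
  by move=> x Ox; have [_ ->] := dfl x i Ox; rewrite mulNr.
apply: (CkM oO); last by have [_] := df i.
apply: (CkD oO); first exact: IH (CkW Cf).
apply: (CkM oO (Ck_cst _ _ _)); exact: IH (CkW Cf).
Qed.

Definition smooth_step (s : R) : R := flat 0 s / (flat 0 s + flat 0 (1 - s)).

Lemma smooth_step_den s : 0 < flat 0 s + flat 0 (1 - s).
Proof.
have [s0|s0] := ltP 0 s.
  by rewrite ltr_wpDr ?flat_ge0// flat_gt0.
by rewrite ltr_wpDl ?flat_ge0// flat_gt0// subr_gt0 (le_lt_trans s0).
Qed.

Lemma smooth_step1 s : 1 <= s -> smooth_step s = 1.
Proof.
move=> s1; rewrite /smooth_step [flat 0 (1 - s)]flat_le0 ?subr_le0// addr0.
by rewrite divff// gt_eqF// flat_gt0// (lt_le_trans _ s1).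
Qed.

Lemma smooth_step0 s : s <= 0 -> smooth_step s = 0.
Proof. by move=> s0; rewrite /smooth_step flat_le0// mul0r. Qed.

End Flat.

Section SmoothOnTheory.
Context {R : realType}.
Implicit Types n k : nat.

Lemma smooth_sub n (O O' : set 'rV[R]_n) f :
  O' `<=` O -> smooth_on O f -> smooth_on O' f.
Proof. by move=> sO Sf k; exact: Ck_sub sO (Sf k). Qed.

Lemma smooth_local n (O : set 'rV[R]_n) f :
  (forall x, O x -> exists2 V : set 'rV[R]_n, V x & smooth_on V f) ->
  smooth_on O f.
Proof. by move=> H k; apply: Ck_local => x /H [V Vx Sf]; exists V. Qed.

Lemma smooth_ext n (O : set 'rV[R]_n) (f g : 'rV[R]_n -> R) : open O ->
  (forall x, O x -> f x = g x) -> smooth_on O f -> smooth_on O g.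
Proof. by move=> oO fg Sf k; exact: Ck_ext oO fg (Sf k). Qed.

Lemma smooth_cst n (O : set 'rV[R]_n) (a : R) : smooth_on O (fun=> a).
Proof. by move=> k; exact: Ck_cst. Qed.

Lemma smooth_coord n (O : set 'rV[R]_n) (j : 'I_n) :
  smooth_on O (fun x => x ord0 j).
Proof. by move=> k; exact: Ck_coord. Qed.

Lemma smoothD n (O : set 'rV[R]_n) (f g : 'rV[R]_n -> R) : open O ->
  smooth_on O f -> smooth_on O g -> smooth_on O (fun x => f x + g x).
Proof. by move=> oO Sf Sg k; exact: CkD (Sf k) (Sg k). Qed.

Lemma smoothM n (O : set 'rV[R]_n) (f g : 'rV[R]_n -> R) : open O ->
  smooth_on O f -> smooth_on O g -> smooth_on O (fun x => f x * g x).
Proof. by move=> oO Sf Sg k; exact: CkM (Sf k) (Sg k). Qed.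

Lemma smoothV n (O : set 'rV[R]_n) (f : 'rV[R]_n -> R) : open O ->
  (forall x, O x -> f x != 0) ->
  smooth_on O f -> smooth_on O (fun x => (f x)^-1).
Proof. by move=> oO f0 Sf k; exact: CkV (Sf k). Qed.

Lemma smooth_sum n (O : set 'rV[R]_n) I (r : seq I) (P : pred I)
    (F : I -> 'rV[R]_n -> R) : open O -> (forall i, P i -> smooth_on O (F i)) ->
  smooth_on O (fun x => \sum_(i <- r | P i) F i x).
Proof. by move=> oO SF k; apply: (Ck_sum _ oO) => i /SF; exact. Qed.

Lemma smooth_prod n (O : set 'rV[R]_n) I (r : seq I) (P : pred I)
    (F : I -> 'rV[R]_n -> R) : open O -> (forall i, P i -> smooth_on O (F i)) ->
  smooth_on O (fun x => \prod_(i <- r | P i) F i x).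
Proof.
move=> oO SF; elim: r => [|i r IH].
  by under [X in smooth_on _ X]eq_fun do rewrite big_nil; exact: smooth_cst.
under [X in smooth_on _ X]eq_fun do rewrite big_cons.
by case: (boolP (P i)) => // /SF Si; apply: smoothM.
Qed.

Lemma smoothX n (O : set 'rV[R]_n) (f : 'rV[R]_n -> R) m : open O ->
  smooth_on O f -> smooth_on O (fun x => f x ^+ m).
Proof.
move=> oO Sf; elim: m => [|m IH].
  by under [X in smooth_on _ X]eq_fun do rewrite expr0; exact: smooth_cst.
by under [X in smooth_on _ X]eq_fun do rewrite exprS; exact: smoothM.
Qed.

Lemma smooth_comp m n (O : set 'rV[R]_m) (O' : set 'rV[R]_n)
    (f : 'rV[R]_n -> R) (G : 'rV[R]_m -> 'rV[R]_n) :
  open O -> open O' -> (forall x, O x -> O' (G x)) ->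
  smooth_on O' f -> (forall j, smooth_on O (fun y => G y ord0 j)) ->
  smooth_on O (fun x => f (G x)).
Proof.
by move=> oO oO' sO Sf SG k; apply: Ck_comp oO oO' sO (Sf k) _ => j; exact: SG.
Qed.

Lemma smooth_smooth_step n (O : set 'rV[R]_n) (f : 'rV[R]_n -> R) : open O ->
  smooth_on O f -> smooth_on O (fun x => smooth_step (f x)).
Proof.
move=> oO Sf; rewrite /smooth_step; apply: smoothM => //.
  by move=> k; exact: Ck_flat.
apply: smoothV => //; first by move=> x _; rewrite gt_eqF// smooth_step_den.
apply: smoothD => //; first by move=> k; exact: Ck_flat.
move=> k; apply: (Ck_flat 0 oO (f := fun x => 1 - f x)).
apply: (Ck_ext (f := fun x => 1 + (-1) * f x) oO) => [x _|]; first by rewrite mulN1r.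
apply: (CkD oO (Ck_cst _ _ 1)); apply: (CkM oO (Ck_cst _ _ (-1))); exact: Sf.
Qed.

Lemma smooth_continuous n (O : set 'rV[R]_n) (f : 'rV[R]_n -> R) x :
  smooth_on O f -> O x -> {for x, continuous f}.
Proof. by move=> Sf; exact: Ck_continuous (Sf 0%N). Qed.

Lemma smooth_rV_continuous m n (O : set 'rV[R]_m) (G : 'rV[R]_m -> 'rV[R]_n) x :
  (forall j, smooth_on O (fun y => G y ord0 j)) -> O x -> {for x, continuous G}.
Proof. by move=> SG Ox; apply: continuous_rV => j; exact: smooth_continuous (SG j) Ox. Qed.

Lemma open_preimage (T U : topologicalType) (O : set T) (V : set U) (G : T -> U) :
  open O -> (forall x, O x -> {for x, continuous G}) -> open V ->
  open (O `&` G @^-1` V).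
Proof.
move=> oO cG oV; rewrite openE => x [Ox Vx]; apply: filterI.
  exact: open_nbhs_nbhs.
by apply: (cG x Ox); exact: open_nbhs_nbhs.
Qed.

Lemma open_smooth_preimage m n (O : set 'rV[R]_m) (V : set 'rV[R]_n)
    (G : 'rV[R]_m -> 'rV[R]_n) :
  open O -> (forall j, smooth_on O (fun y => G y ord0 j)) -> open V ->
  open (O `&` G @^-1` V).
Proof.
by move=> oO SG; apply: open_preimage => // x Ox; exact: smooth_rV_continuous SG Ox.
Qed.

Lemma open_local (T : topologicalType) (O : set T) :
  (forall x, O x -> exists V, [/\ open V, V x & V `<=` O]) -> open O.
Proof.
move=> H; rewrite openE => x /H [V [oV Vx VO]].
exact: filterS VO (open_nbhs_nbhs (conj oV Vx)).
Qed.

End SmoothOnTheory.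

(** * Smooth functions and maps on manifolds *)

Section Manifold.
Context {R : realType} {n : nat} {X : Type}.
Implicit Types (c d : chart R n X) (A C : set (chart R n X)) (U W : set X)
  (f g : X -> R).

Lemma chart_inj c x y : is_chart c -> dom c x -> dom c y ->
  coord c x = coord c y -> x = y.
Proof. by case=> + _ dx dy E => /(_ x y); rewrite !in_setE; apply. Qed.

Lemma chart_imageP c U x : is_chart c -> dom c x ->
  (coord c @` (U `&` dom c)) (coord c x) -> U x.
Proof.
by move=> cc dx [y [Uy dy] /(chart_inj cc dy dx) <-].
Qed.

(* [f] read in the chart [c] (junk value 0 outside the image of [c]). *)
Definition in_chart c f (y : 'rV[R]_n) : R :=
  if pselect (exists2 x, dom c x & coord c x = y) is left h
  then f (projT1 (cid2 h)) else 0.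

Lemma in_chartE c f x : is_chart c -> dom c x -> in_chart c f (coord c x) = f x.
Proof.
move=> cc dx; rewrite /in_chart; case: pselect => [h|[]]; last by exists x.
by case: cid2 => y dy /= /(chart_inj cc dy dx) ->.
Qed.

Definition atlas A :=
  [/\ forall c, A c -> is_chart c,
      forall c d, A c -> A d -> compatible c d &
      forall x, exists2 c, A c & dom c x].

Lemma smooth_structure_atlas A : smooth_structure A -> atlas A.
Proof.
move=> [cov mx _ _]; split=> //; first by move=> c; rewrite mx => -[].
by move=> c d; rewrite {1}mx => -[_ H] /H.
Qed.

Definition smooth_at c f x := exists V : set 'rV[R]_n,
  [/\ open V, V (coord c x), V `<=` coord c @` dom c & smooth_on V (in_chart c f)].

Lemma smooth_at_transition c d f x : is_chart c -> is_chart d -> transition d c ->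
  dom c x -> dom d x -> smooth_at c f x -> smooth_at d f x.
Proof.
move=> cc cd [oO [g [Sg gE]]] cx dx [V [oV Vx Vc Sf]].
set O := _ @` _ in oO Sg.
exists (O `&` g @^-1` V); split.
- exact: open_smooth_preimage.
- by split; [exists x|rewrite /= -gE].
- by move=> _ [[y [dy _] <-] _]; exists y.
- have oW : open (O `&` g @^-1` V) by exact: open_smooth_preimage.
  apply: (smooth_ext oW (f := fun y => in_chart c f (g y))).
    by move=> _ [[y [dy cy] <-] _]; rewrite -gE// !in_chartE.
  apply: (smooth_comp oW oV _ Sf) => [y []//|j].
  by apply: smooth_sub (Sg j) => y [].
Qed.

Definition msmooth_at A f x := exists c, [/\ A c, dom c x & smooth_at c f x].

Lemma msmooth_at_chart A c f x : atlas A -> A c -> dom c x ->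
  msmooth_at A f x -> smooth_at c f x.
Proof.
move=> [ch co _] Ac dx [d [Ad ddx Sd]].
by apply: smooth_at_transition Sd; [exact: ch|exact: ch|have [] := co c d Ac Ad|..].
Qed.

Lemma msmooth_chart A U f c : atlas A -> mopen A U -> A c -> msmooth A U f ->
  smooth_on (coord c @` (U `&` dom c)) (in_chart c f).
Proof.
move=> [ch _ _] oU Ac /(_ c Ac) [g Sg gE].
apply: smooth_ext Sg; first exact: oU.
by move=> _ [x [Ux dx] <-]; rewrite in_chartE -?gE//; exact: ch.
Qed.

(** [msmooth] speaks of every chart of [A], and a maximal atlas contains charts about which nothing
    explicit is known; the right-hand side asks for one convenient chart around each point. *)
Lemma msmoothP A U f : atlas A -> mopen A U ->
  msmooth A U f <-> (forall x, U x -> msmooth_at A f x).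
Proof.
move=> atA oU; have [ch co cov] := atA; split=> [Sf x Ux|Sf c Ac].
  have [c Ac dx] := cov x; exists c; split=> //.
  exists (coord c @` (U `&` dom c)); split; first exact: oU.
  - by exists x.
  - by move=> _ [y [_ dy] <-]; exists y.
  - exact: msmooth_chart Sf.
exists (in_chart c f); last by move=> x Ux dx; rewrite in_chartE//; exact: ch.
apply: smooth_local => _ [x [Ux dx] <-].
by have [V [oV Vx Vc SV]] := msmooth_at_chart atA Ac dx (Sf x Ux); exists V.
Qed.

Lemma mopenP A U : atlas A -> (forall x, U x -> exists c, [/\ A c, dom c x &
    exists V : set 'rV[R]_n, [/\ open V, V (coord c x) & V `<=` coord c @` (U `&` dom c)]]) ->
  mopen A U.
Proof.
move=> [ch co cov] H d Ad; apply: open_local => _ [x [Ux ddx] <-].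
have [c [Ac cx [V [oV Vx VU]]]] := H x Ux.
have [_ [oO [g [Sg gE]]]] := co c d Ac Ad.
set O := _ @` _ in oO Sg.
exists (O `&` g @^-1` V); split; first exact: open_smooth_preimage.
  by split; [exists x|rewrite /= -gE].
move=> _ [[y [dy cy] <-]]; rewrite /= -gE// => /VU; move=> /(chart_imageP (ch _ Ac) cy) Uy.
by exists y.
Qed.

Lemma mopenT A : atlas A -> mopen A setT.
Proof. by move=> [ch _ _] c Ac; rewrite setTI; have [] := ch c Ac. Qed.

Lemma mopenI A U W : atlas A -> mopen A U -> mopen A W -> mopen A (U `&` W).
Proof.
move=> [ch _ _] oU oW c Ac.
rewrite (_ : _ @` _ = (coord c @` (U `&` dom c)) `&` (coord c @` (W `&` dom c))).
  by apply: openI; [exact: oU|exact: oW].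
apply/seteqP; split=> [_ [x [[Ux Wx] dx] <-]|_ [[x [Ux dx] <-]]].
  by split; exists x.
by move=> /(chart_imageP (ch _ Ac) dx) Wx; exists x.
Qed.

Lemma mopen_local A U :
  (forall x, U x -> exists W, [/\ mopen A W, W x & W `<=` U]) -> mopen A U.
Proof.
move=> H c Ac; apply: open_local => _ [x [Ux dx] <-].
have [W [oW Wx WU]] := H x Ux; exists (coord c @` (W `&` dom c)); split.
- exact: oW.
- by exists x.
- by move=> _ [y [Wy dy] <-]; exists y => //; split=> //; exact: WU.
Qed.

Lemma mopen_dom A c : atlas A -> A c -> mopen A (dom c).
Proof. by move=> [_ co _] Ac d Ad; rewrite setIC; have [_ []] := co c d Ac Ad. Qed.

Lemma msmooth_sub A U W f : W `<=` U -> mopen A W -> msmooth A U f -> msmooth A W f.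
Proof.
move=> WU oW Sf c Ac; have [g Sg gE] := Sf c Ac; exists g.
  by apply: smooth_sub Sg => _ [x [Wx dx] <-]; exists x => //; split=> //; exact: WU.
by move=> x /WU; exact: gE.
Qed.

Lemma msmooth_ext A U f g : (forall x, U x -> f x = g x) ->
  msmooth A U f -> msmooth A U g.
Proof.
move=> fg Sf c Ac; have [h Sh hE] := Sf c Ac; exists h => // x Ux dx.
by rewrite -fg// hE.
Qed.

Lemma msmooth_local A U f : atlas A -> mopen A U ->
  (forall x, U x -> exists W, [/\ mopen A W, W x & msmooth A W f]) ->
  msmooth A U f.
Proof.
move=> atA oU H; apply/msmoothP => // x /H [W [oW Wx /(msmoothP _ atA oW)]]; exact.
Qed.

Lemma msmooth_cst A U a : msmooth A U (fun=> a).
Proof. by move=> c Ac; exists (fun=> a) => //; exact: smooth_cst. Qed.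

Lemma msmooth_chart_coord A c i : atlas A -> A c ->
  msmooth A (dom c) (fun x => coord c x ord0 i).
Proof.
move=> [_ co _] Ac d Ad; have [_ [_ [g [Sg gE]]]] := co c d Ac Ad.
exists (fun y => g y ord0 i); first by rewrite setIC.
by move=> x cx dx; rewrite gE.
Qed.

Lemma msmooth_comp m A U (O : set 'rV[R]_m) (f : 'rV[R]_m -> R) (G : X -> 'rV[R]_m) :
  atlas A -> mopen A U -> open O -> (forall x, U x -> O (G x)) -> smooth_on O f ->
  (forall j, msmooth A U (fun x => G x ord0 j)) -> msmooth A U (fun x => f (G x)).
Proof.
move=> atA oU oO UO Sf SG c Ac; have [ch _ _] := atA.
pose H (y : 'rV[R]_n) : 'rV[R]_m := \row_j in_chart c (fun x => G x ord0 j) y.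
have HE x : dom c x -> H (coord c x) = G x.
  by move=> dx; apply/rowP => j; rewrite mxE in_chartE//; exact: ch.
exists (fun y => f (H y)); last by move=> x Ux dx; rewrite HE.
apply: (smooth_comp (oU c Ac) oO _ Sf).
  by move=> _ [x [Ux dx] <-]; rewrite HE//; exact: UO.
move=> j; under [X in smooth_on _ X]eq_fun do rewrite mxE.
exact: msmooth_chart (SG j).
Qed.

Lemma msmoothD A U f g : mopen A U ->
  msmooth A U f -> msmooth A U g -> msmooth A U (fun x => f x + g x).
Proof.
move=> oU Sf Sg c Ac; have [F SF FE] := Sf c Ac; have [G SG GE] := Sg c Ac.
exists (fun y => F y + G y); first exact: smoothD (oU c Ac) SF SG.
by move=> x Ux dx; rewrite FE// GE.
Qed.

Lemma msmoothM A U f g : mopen A U ->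
  msmooth A U f -> msmooth A U g -> msmooth A U (fun x => f x * g x).
Proof.
move=> oU Sf Sg c Ac; have [F SF FE] := Sf c Ac; have [G SG GE] := Sg c Ac.
exists (fun y => F y * G y); first exact: smoothM (oU c Ac) SF SG.
by move=> x Ux dx; rewrite FE// GE.
Qed.

Lemma msmoothV A U f : mopen A U -> (forall x, U x -> f x != 0) ->
  msmooth A U f -> msmooth A U (fun x => (f x)^-1).
Proof.
move=> oU f0 Sf c Ac; have [F SF FE] := Sf c Ac.
exists (fun y => (F y)^-1); last by move=> x Ux dx; rewrite FE.
by apply: smoothV (oU c Ac) _ SF => _ [x [Ux dx] <-]; rewrite -FE// f0.
Qed.

Lemma msmooth_smooth_step A U f : mopen A U ->
  msmooth A U f -> msmooth A U (fun x => smooth_step (f x)).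
Proof.
move=> oU Sf c Ac; have [F SF FE] := Sf c Ac.
exists (fun y => smooth_step (F y)); last by move=> x Ux dx; rewrite FE.
exact: smooth_smooth_step (oU c Ac) SF.
Qed.

Lemma msmooth_sum A U I (r : seq I) (P : pred I) (F : I -> X -> R) : mopen A U ->
  (forall i, P i -> msmooth A U (F i)) ->
  msmooth A U (fun x => \sum_(i <- r | P i) F i x).
Proof.
move=> oU SF; elim: r => [|i r IH].
  by under [X in msmooth _ _ X]eq_fun do rewrite big_nil; exact: msmooth_cst.
under [X in msmooth _ _ X]eq_fun do rewrite big_cons.
by case: (boolP (P i)) => // /SF Si; apply: msmoothD.
Qed.

Lemma mopen_preimage_rV m A U (V : set 'rV[R]_m) (G : X -> 'rV[R]_m) :
  atlas A -> mopen A U -> open V -> (forall j, msmooth A U (fun x => G x ord0 j)) ->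
  mopen A (U `&` G @^-1` V).
Proof.
move=> atA oU oV SG c Ac; have [ch _ _] := atA.
pose H (y : 'rV[R]_n) : 'rV[R]_m := \row_j in_chart c (fun x => G x ord0 j) y.
have HE x : dom c x -> H (coord c x) = G x.
  by move=> dx; apply/rowP => j; rewrite mxE in_chartE//; exact: ch.
rewrite (_ : _ @` _ = (coord c @` (U `&` dom c)) `&` H @^-1` V).
  apply: open_smooth_preimage => //; first exact: oU.
  move=> j; rewrite /H; under [X in smooth_on _ X]eq_fun do rewrite mxE.
  exact: msmooth_chart (SG j).
apply/seteqP; split=> [_ [x [[Ux Vx] dx] <-]|_ [[x [Ux dx] <-]]].
  by split; [exists x|rewrite /= HE].
by rewrite /= HE// => Vx; exists x.
Qed.

Lemma mopen_chart_preimage A c (V : set 'rV[R]_n) : atlas A -> A c -> open V ->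
  mopen A (dom c `&` coord c @^-1` V).
Proof.
move=> atA Ac oV; apply: (mopen_preimage_rV (G := coord c)) => //.
  exact: mopen_dom.
by move=> j; exact: msmooth_chart_coord.
Qed.

Lemma mopen_preimage A U (V : set R) f : atlas A -> mopen A U -> open V ->
  msmooth A U f -> mopen A (U `&` f @^-1` V).
Proof.
move=> atA oU oV Sf.
have oV' : open ((fun v : 'rV[R]_1 => v ord0 ord0) @^-1` V).
  by apply: open_comp oV => v _; exact: coord_continuous.
have := mopen_preimage_rV (G := fun x => \row__ f x : 'rV[R]_1) atA oU oV'.
rewrite (_ : _ `&` _ = U `&` f @^-1` V); last first.
  by apply/seteqP; split=> x [Ux] /=; rewrite mxE.
by apply=> j; under [X in msmooth _ _ X]eq_fun do rewrite mxE.
Qed.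

End Manifold.

Section SmoothMaps.
Context {R : realType}.

(** [smooth_map] tests all charts of the target. One target chart around each image point suffices,
    since any other is obtained from it by a smooth transition. *)
Lemma smooth_mapP n m (X Y : Type) (A : set (chart R n X)) (B : set (chart R m Y))
    (O : set X) (h : X -> Y) : atlas A -> atlas B ->
  (forall x, O x -> exists (W : set X) c, [/\ mopen A W, W x, W `<=` O, B c &
    (forall y, W y -> dom c (h y)) /\
    (forall i, msmooth A W (fun y => coord c (h y) ord0 i))]) ->
  smooth_map A B O h.
Proof.
move=> atA atB H d Bd; have [ch co cov] := atB.
have loc x : O x -> dom d (h x) -> exists W, [/\ mopen A W, W x,
    W `<=` O `&` h @^-1` dom d &
    forall i, msmooth A W (fun y => coord d (h y) ord0 i)].
  move=> Ox dx; have [W [c [oW Wx WO Bc [Wc Sc]]]] := H x Ox.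
  have [[oO1 [g [Sg gE]]] _] := co c d Bc Bd; set O1 := _ @` _ in oO1 Sg.
  have oW' := mopen_preimage_rV (G := fun y => coord c (h y)) atA oW oO1 Sc.
  have W'd y : W y -> O1 (coord c (h y)) -> dom d (h y).
    by move=> Wy; rewrite /O1 setIC; apply: chart_imageP; [exact: ch|exact: Wc].
  exists (W `&` (fun y => coord c (h y)) @^-1` O1); split=> //.
  - by split=> //; exists (h x) => //; split=> //; exact: Wc.
  - by move=> y [Wy O1y]; split; [exact: WO|exact: W'd].
  move=> i; apply: (msmooth_ext (f := fun y => g (coord c (h y)) ord0 i)).
    by move=> y [Wy O1y]; rewrite gE//; [exact: Wc|exact: W'd].
  apply: (msmooth_comp (O := O1) (f := fun v => g v ord0 i) (G := fun y => coord c (h y)) atA oW' oO1) => //.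
    by move=> y [].
  by move=> j; apply: msmooth_sub (Sc j) => // y [].
have oOd : mopen A (O `&` h @^-1` dom d).
  apply: mopen_local => x [Ox dx]; have [W [oW Wx WO _]] := loc x Ox dx.
  by exists W.
split=> // i; apply: msmooth_local => // x [Ox dx].
by have [W [oW Wx WO SW]] := loc x Ox dx; exists W.
Qed.

Lemma mopen_super n (X : Type) (A B : set (chart R n X)) U :
  atlas A -> atlas B -> A `<=` B -> mopen A U -> mopen B U.
Proof.
move=> atA atB AB oU; have [_ _ cov] := atA.
apply: mopenP => // x Ux; have [c Ac dx] := cov x.
exists c; split=> //; first exact: AB.
exists (coord c @` (U `&` dom c)); split => //; first exact: oU.
by exists x.
Qed.

Lemma msmooth_super n (X : Type) (A B : set (chart R n X)) U f :
  atlas A -> atlas B -> A `<=` B -> mopen A U -> msmooth A U f -> msmooth B U f.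
Proof.
move=> atA atB AB oU /(msmoothP _ atA oU) Sf.
apply/(msmoothP _ atB (mopen_super atA atB AB oU)) => x /Sf [c [Ac dx Sx]].
by exists c; split=> //; exact: AB.
Qed.

(** * Maximal atlases *)

Section MaximalAtlas.
Variables (n : nat) (X : Type) (C : set (chart R n X)).
Hypothesis atC : atlas C.

Lemma sub_maximal_atlas : C `<=` maximal_atlas C.
Proof.
move=> c Cc; have [ch co _] := atC; split; first exact: ch.
by move=> d Cd; exact: co.
Qed.

(** Near each point the transition factors through a chart [e] of [C]. The map required on the whole
    overlap is the coordinate of [d] read in [c], which is defined globally; the local
    factorizations only have to show that it is smooth, and nothing is glued. *)
Lemma maximal_transition c d : maximal_atlas C c -> maximal_atlas C d ->
  transition c d.
Proof.
move=> [cc Hc] [cd Hd]; have [ch co cov] := atC.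
have loc x : dom c x -> dom d x -> exists V : set 'rV[R]_n, [/\ open V, V (coord c x),
    V `<=` coord c @` (dom c `&` dom d) &
    forall j, smooth_on V (in_chart c (fun x => coord d x ord0 j))].
  move=> cx dx; have [e Ce ex] := cov x.
  have [[oO1 [g1 [Sg1 g1E]]] _] := Hc e Ce.
  have [_ [oO2 [g2 [Sg2 g2E]]]] := Hd e Ce.
  set O1 := _ @` _ in oO1 Sg1; set O2 := _ @` _ in oO2 Sg2.
  have oV : open (O1 `&` g1 @^-1` O2) by exact: open_smooth_preimage.
  have VP y : dom c y -> dom e y -> O2 (g1 (coord c y)) -> dom d y.
    move=> cy ey; rewrite -g1E// => H.
    by apply: (chart_imageP (ch _ Ce) ey); rewrite setIC.
  exists (O1 `&` g1 @^-1` O2); split=> //.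
  - by split; [exists x|rewrite /= -g1E//; exists x].
  - by move=> _ [[y [cy ey] <-] /= H]; exists y => //; split=> //; exact: VP H.
  move=> j; apply: (smooth_ext (f := fun v => g2 (g1 v) ord0 j)) => //.
    move=> _ [[y [cy ey] <-] H]; rewrite in_chartE// -g1E// -g2E//.
    exact: VP H.
  apply: (smooth_comp (O' := O2) (f := fun v => g2 v ord0 j)) => //.
    by move=> v [].
  by move=> i; apply: smooth_sub (Sg1 i) => v [].
split.
  apply: open_local => _ [x [cx dx] <-].
  by have [V [? ? ? _]] := loc x cx dx; exists V.
exists (fun v => \row_j in_chart c (fun x => coord d x ord0 j) v); split.
  move=> j; apply: smooth_local => _ [x [cx dx] <-].
  have [V [oV Vx _ SV]] := loc x cx dx; exists V => //.
  by under [X in smooth_on _ X]eq_fun do rewrite mxE; exact: SV.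
by move=> x cx dx; apply/rowP => j; rewrite mxE in_chartE.
Qed.

Lemma maximal_atlas_atlas : atlas (maximal_atlas C).
Proof.
split; first by move=> c [].
  by move=> c d Mc Md; split; exact: maximal_transition.
have [_ _ cov] := atC.
by move=> x; have [c Cc cx] := cov x; exists c => //; exact: sub_maximal_atlas.
Qed.

Lemma maximal_atlas_idem : maximal_atlas C = maximal_atlas (maximal_atlas C).
Proof.
apply/seteqP; split=> c [cc Hc]; split=> //.
  by move=> d Md; have [_ co _] := maximal_atlas_atlas; apply: co => //.
by move=> d Cd; apply: Hc; exact: sub_maximal_atlas.
Qed.

End MaximalAtlas.

Definition second_countable_for n (X : Type) (A : set (chart R n X)) :=
  exists B : set (set X),
    [/\ countable B, (forall O, B O -> mopen A O) &
        forall O x, mopen A O -> O x ->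
          exists O', [/\ B O', O' x & O' `<=` O]].

Lemma rat_near n (x : 'rV[R]_n) (e : R) : 0 < e ->
  exists q : 'rV[rat]_n, ball (map_mx ratr q : 'rV[R]_n) e x.
Proof.
move=> e0.
have H i : exists q : rat, `|ratr q - x ord0 i| < e.
  have /rat_in_itvoo[q] : x ord0 i - e < x ord0 i + e by rewrite ltrD2l gtrN.
  rewrite in_itv /= => /andP[q1 q2]; exists q.
  by rewrite ltr_norml; apply/andP; split; lra.
have [f fH] := choice H.
by exists (\row_i f i); apply: ball_rV => // i; rewrite !mxE.
Qed.

(** The basis consists of the preimages, under countably many charts, of the balls with rational
    centre and radius [1 / (m+1)]. *)
Lemma countable_charts_second_countable n (X : Type) (A : set (chart R n X))
    (s : nat -> option (chart R n X)) : atlas A ->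
  (forall k c, s k = Some c -> A c) ->
  (forall x, exists k c, s k = Some c /\ dom c x) -> second_countable_for A.
Proof.
move=> atA sA scov; have [ch _ _] := atA.
pose T := (nat * 'rV[rat]_n * nat)%type.
pose U (t : T) : set X :=
  if s t.1.1 is Some c then dom c `&` coord c @^-1` (ball (map_mx ratr t.1.2 : 'rV[R]_n) t.2.+1%:R^-1)
  else set0.
exists (range U); split.
- by apply: (sub_countable (B := [set: T])); [exact: card_image_le|exact: countableP].
- move=> _ [t _ <-]; rewrite /U; case E: (s t.1.1) => [c|].
    apply: mopen_chart_preimage => //; first exact: sA E.
    exact: ball_open.
  move=> c _; rewrite set0I image_set0; exact: open0.
move=> O x oO Ox; have [k [c [E cx]]] := scov x.
have [e e0 eO] := open_ball (oO c (sA _ _ E)) (ex_intro2 _ _ x (conj Ox cx) erefl).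
(* With a radius below [e / 2], a rational ball that contains [coord c x] lies in the ball of radius
   [e] around that point. *)
have [m me] : exists m : nat, m.+1%:R^-1 < e / 2.
  have e2 : 0 < e / 2 by rewrite divr_gt0.
  by have [m mE] := ltr_add_invr e2; exists m; rewrite add0r in mE.
have m0 : 0 < m.+1%:R^-1 :> R by rewrite invr_gt0.
have [q qb] := rat_near (coord c x) m0.
exists (U (k, q, m)); split; first by exists (k, q, m).
  by rewrite /U /= E.
rewrite /U /= E => y [cy qy].
apply: (chart_imageP (ch _ (sA _ _ E)) cy); apply: eO.
have := ball_triangle (ball_sym qb) qy; apply: le_ball.
by rewrite [leRHS](splitr e) lerD// ltW.
Qed.

End SmoothMaps.

(** * Bump functions and morphisms from C^oo(X) to R *)

Section Bump.
Context {R : realType} {n : nat} {X : Type} {A : set (chart R n X)}.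
Hypothesis ssA : smooth_structure A.
Let atA : atlas A := smooth_structure_atlas ssA.

(** For each basic open set contained in some [W x], one such [x] is chosen, indexed by the code of
    the basic set. The value [None] is left to the natural numbers that code no such set. *)
Lemma lindelof (W : X -> set X) : (forall x, mopen A (W x) /\ W x x) ->
  exists s : nat -> option X, forall y, exists k x, s k = Some x /\ W x y.
Proof.
move=> HW; have [_ _ _ [B [cB oB basB]]] := ssA.
have /countable_injP [f finj] := cB.
pose P k x := exists b, [/\ B b, f b = k & b `<=` W x].
exists (fun k => if pselect (exists x, P k x) is left h then Some (projT1 (cid h)) else None).
move=> y; have [oW Wy] := HW y.
have [b [Bb yb bW]] := basB _ _ oW Wy.
exists (f b); case: pselect => [h|[]]; last by exists y, b.
exists (projT1 (cid h)); split=> //.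
case: cid => x /= [b' [Bb' fb b'W]]; apply: b'W.
by rewrite (finj b' b (mem_set Bb') (mem_set Bb) fb).
Qed.

Lemma mopen_bigI (I : eqType) (s : seq I) (F : I -> set X) :
  (forall i, i \in s -> mopen A (F i)) ->
  mopen A [set x | forall i, i \in s -> F i x].
Proof.
elim: s => [_|i s IH H].
  rewrite (_ : mkset _ = setT); first exact: mopenT.
  by apply/seteqP; split.
rewrite (_ : mkset _ = F i `&` [set x | forall i, i \in s -> F i x]).
  by apply: mopenI => //; [apply: H; rewrite mem_head|apply: IH => j js; apply: H; rewrite in_cons js orbT].
apply/seteqP; split=> x /= Hx.
  by split=> [|j js]; apply: Hx; rewrite ?mem_head// in_cons js orbT.
by case: Hx => Fi Fs j; rewrite in_cons => /orP[/eqP->//|]; exact: Fs.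
Qed.

(** In a Hausdorff space compact sets are closed; this is what makes the extension by zero of a bump
    function from a chart smooth. The finite subcover is extracted in ['rV[R]_n], from the images of
    the separating neighbourhoods, because [X] is a bare type. *)
Lemma compact_chart_closed c (K : set 'rV[R]_n) : A c -> compact K ->
  K `<=` coord c @` dom c -> mopen A [set x | ~ (dom c x /\ K (coord c x))].
Proof.
move=> Ac cK Kc; have [ch _ _] := atA; have [_ _ haus _] := ssA.
apply: mopen_local => y Hy.
have sep (v : 'rV[R]_n) : exists OO : set X * set X, K v -> [/\ mopen A OO.1, mopen A OO.2,
    (coord c @` (OO.1 `&` dom c)) v, OO.2 y & OO.1 `&` OO.2 = set0].
  have [Kv|nK] := pselect (K v); last by exists (setT, setT).
  have [x cx xv] := Kc _ Kv.
  have xy : x <> y by move=> E; apply: Hy; rewrite -E xv.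
  have [U1 [U2 [oU1 oU2 U1x U2y UU]]] := haus _ _ xy.
  by exists (U1, U2) => _; split=> //; exists x.
have [OO OOP] := choice sep.
have := cK; rewrite compact_cover => /(_ 'rV[R]_n K (fun v => coord c @` ((OO v).1 `&` dom c))).
case.
- by move=> v /OOP [oO _ _ _ _]; exact: oO.
- by move=> v Kv; exists v => //; have [] := OOP v Kv.
move=> D DK Dcov.
have DK' v : v \in D -> K v by move=> /DK /set_mem.
exists [set x | forall v, v \in (D : seq _) -> (OO v).2 x]; split.
- by apply: mopen_bigI => v /DK' /OOP [].
- by move=> v /DK' /OOP [].
move=> x Hx [cx Kx]; have [v Dv [x1 [U1x1 cx1] E]] := Dcov _ Kx.
have xx := chart_inj (ch _ Ac) cx1 cx E.
have [_ _ _ _ D0] := OOP v (DK' v Dv).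
have : ((OO v).1 `&` (OO v).2) x by split; [rewrite -xx|exact: Hx].
by rewrite D0.
Qed.

(** Vanishing on an open [Z] that covers the space together with [W] is stronger than vanishing off
    [W]: it lets the product of [chi] with a function on [W] be extended by zero, smoothness being
    checked on [Z] and on [W]. *)
Lemma bump_function (W : set X) x : mopen A W -> W x -> exists chi : X -> R,
  [/\ msmooth A setT chi,
      (exists V, [/\ mopen A V, V x, V `<=` W & forall y, V y -> chi y = 1]) &
      exists Z, [/\ mopen A Z, Z `|` W = setT & forall y, Z y -> chi y = 0]].
Proof.
move=> oW Wx; have [ch _ cov] := atA; have [c Ac cx] := cov x.
have [r r0 rW] := open_ball (oW c Ac) (ex_intro2 _ _ x (conj Wx cx) erefl).
set x0 := coord c x in rW.
pose K := [set v : 'rV[R]_n | forall i, `[x0 ord0 i - r / 2, x0 ord0 i + r / 2]%classic (v ord0 i)].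
have cK : compact K.
  apply: (@rV_compact _ _ (fun i => `[x0 ord0 i - r / 2, x0 ord0 i + r / 2]%classic)) => i.
  exact: segment_compact.
have KW : K `<=` coord c @` (W `&` dom c).
  move=> v Kv; apply: rW; apply: ball_rV => // i; have := Kv i.
  rewrite /= in_itv /= => /andP[v1 v2]; rewrite distrC.
  apply: (@le_lt_trans _ _ (r / 2)); last by rewrite ltr_pdivrMr// ltr_pMr// ltr1n.
  by rewrite ler_norml; apply/andP; split; lra.
have Kc : K `<=` coord c @` dom c by move=> v /KW [y [_ cy] <-]; exists y.
(* With [s] the distance of the [i]-th entries of [v] and [x0], this is [2 - (4 s / r)^2]: at least
   1 for [s <= r / 4] and negative for [s >= r / 2]. The step function of it is thus 1 near [x0] and
   0 once the [i]-th entry leaves the cube [K]; the square keeps it smooth at [s = 0]. *)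
pose q (v : 'rV[R]_n) i : R := 2 - ((v ord0 i + - x0 ord0 i) * (4 / r)) ^+ 2.
have n4r : `|4 / r| = 4 / r by rewrite ger0_norm// divr_ge0// ltW.
pose b (v : 'rV[R]_n) : R := \prod_(i < n) smooth_step (q v i).
have Sq O i : open O -> smooth_on O (fun v => q v i).
  move=> oO; apply: (smooth_ext (f := fun v => 2 + -1 * ((v ord0 i + - x0 ord0 i) * (4 / r)) ^+ 2) oO).
    by move=> v _; rewrite mulN1r.
  apply: smoothD => //; first exact: smooth_cst.
  apply: smoothM => //; first exact: smooth_cst.
  apply: smoothX => //; apply: smoothM => //; last exact: smooth_cst.
  by apply: smoothD => //; [exact: smooth_coord|exact: smooth_cst].
have Sb O : open O -> smooth_on O b.
  by move=> oO; apply: smooth_prod => // i _; apply: smooth_smooth_step => //; exact: Sq.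
pose chi y := if pselect (dom c y) is left _ then b (coord c y) else 0.
have chiE y : dom c y -> chi y = b (coord c y) by rewrite /chi; case: pselect.
pose Z := [set y | ~ (dom c y /\ K (coord c y))].
have oZ : mopen A Z by exact: compact_chart_closed.
have chiZ y : Z y -> chi y = 0.
  rewrite /chi; case: pselect => // cy Zy.
  have /existsNP[i /negP Hi] : ~ K (coord c y) by move=> Ky; apply: Zy.
  rewrite /b (bigD1 i)//= smooth_step0 ?mul0r//.
  rewrite /q subr_le0; set t := _ + _.
  have : r / 2 <= `|t|.
    rewrite leNgt; apply/negP; rewrite ltr_norml /t => /andP[t1 t2].
    by move: Hi; rewrite in_itv /= => /negP; apply; apply/andP; split; lra.
  rewrite ler_pdivrMr// => rt.
  have h2 : 2 <= `|t * (4 / r)|.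
    rewrite normrM n4r mulrA ler_pdivlMr//.
    lra.
  rewrite -real_normK ?num_real//; rewrite (le_trans h2)//.
  by rewrite expr2 ler_peMr// (le_trans _ h2)// ler1n.
exists chi; split.
- apply: msmooth_local => //; first exact: mopenT.
  move=> y _; have [cy|ncy] := pselect (dom c y).
    exists (dom c); split=> //; first exact: mopen_dom.
    apply: (msmooth_ext (f := fun y => b (coord c y))); first by move=> z /chiE ->.
    apply: (msmooth_comp (O := setT)) => //; first exact: mopen_dom.
    + exact: openT.
    + by apply: Sb; exact: openT.
    + by move=> j; exact: msmooth_chart_coord.
  exists Z; split=> //; first by move=> [].
  by apply: (msmooth_ext (f := fun=> 0)); [move=> z /chiZ ->|exact: msmooth_cst].
- exists (dom c `&` coord c @^-1` (ball x0 (r / 4))); split.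
  + by apply: mopen_chart_preimage => //; exact: ball_open.
  + by split=> //; apply: ballxx; rewrite divr_gt0.
  + move=> y [cy yb]; apply: (chart_imageP (ch _ Ac) cy); apply: rW.
    by apply: le_ball yb; lra.
  + move=> y [cy yb]; rewrite chiE// /b big1// => i _; apply: smooth_step1.
    have /ltW tr := ball_rVP i yb.
    suff : ((coord c y ord0 i + - x0 ord0 i) * (4 / r)) ^+ 2 <= 1 by rewrite /q => H; lra.
    rewrite -real_normK ?num_real// expr_le1// normrM distrC.
    rewrite n4r mulrA ler_pdivrMr// mul1r.
    by move: tr; rewrite ler_pdivlMr.
- exists Z; split=> //; apply/seteqP; split=> // y _.
  have [Wy|nWy] := pselect (W y); [by right|left=> -[cy /KW Ky]; apply: nWy].
  exact: (chart_imageP (ch _ Ac) cy).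
Qed.

Lemma separate_points x y : x <> y -> exists2 f, msmooth A setT f & f x <> f y.
Proof.
move=> xy; have [_ _ haus _] := ssA.
have [U1 [U2 [oU1 oU2 U1x U2y UU]]] := haus _ _ xy.
have [f [Sf [V [_ Vx _ f1]] [Z [_ ZO f0]]]] := bump_function oU1 U1x.
exists f => //; rewrite f1// f0; first by apply/eqP; rewrite oner_eq0.
have : (Z `|` U1) y by rewrite ZO.
by case=> // U1y; have : (U1 `&` U2) y by []; rewrite UU.
Qed.

End Bump.

(** * Locally finite sums *)

Section LocallyFinite.
Context {R : realType} {n : nat} {X : Type} {A : set (chart R n X)}.
Hypothesis atA : atlas A.
Variable N : X -> nat.

(** The bound [N x] is valid on a whole neighbourhood of [x]. It is a parameter of the section so
    that several families built from the same functions can share it. *)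
Definition locally_finite (phi : nat -> X -> R) := forall x, exists W,
  [/\ mopen A W, W x & forall y i, W y -> (N x <= i)%N -> phi i y = 0].

Definition lfsum (phi : nat -> X -> R) x := \sum_(i < N x) phi i x.

Lemma lfsumE phi x m : locally_finite phi -> (N x <= m)%N ->
  lfsum phi x = \sum_(i < m) phi i x.
Proof.
move=> lf Nm; have [W [_ Wx W0]] := lf x.
rewrite /lfsum (big_ord_widen _ (fun i => phi i x) Nm) [LHS]big_mkcond /=.
by apply: eq_bigr => i _; case: ltnP => // /(W0 _ _ Wx).
Qed.

Lemma lfsum_smooth phi : locally_finite phi ->
  (forall i, msmooth A setT (phi i)) -> msmooth A setT (lfsum phi).
Proof.
move=> lf Sphi; apply: msmooth_local => //; first exact: mopenT.
move=> x _; have [W [oW Wx W0]] := lf x; exists W; split=> //.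
apply: (msmooth_ext (f := fun y => \sum_(i < N x) phi i y)).
  move=> y Wy; rewrite (lfsumE lf (leq_maxl (N y) (N x))).
  rewrite (big_ord_widen _ (fun i => phi i y) (leq_maxr (N y) (N x))) [LHS]big_mkcond /=.
  by apply: eq_bigr => i _; case: ltnP => // /(W0 _ _ Wy).
by apply: msmooth_sum => // i _; apply: msmooth_sub (Sphi i).
Qed.

End LocallyFinite.

(** * Algebra morphisms from smooth functions to the reals *)

Section Milnor.
Context {R : realType} {n : nat} {X : Type} {A : set (chart R n X)}.
Hypothesis ssA : smooth_structure A.
Let atA : atlas A := smooth_structure_atlas ssA.
Let S : set (X -> R) := msmooth A setT.
Variable h : (X -> R) -> R.
Hypothesis hC : forall a, h (fun=> a) = a.
Hypothesis hD : forall f g, S f -> S g -> h (fun x => f x + g x) = h f + h g.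
Hypothesis hM : forall f g, S f -> S g -> h (fun x => f x * g x) = h f * h g.

Let oT := mopenT atA.

(** Otherwise [g - h g] is positive everywhere, hence invertible among smooth functions, although
    [h] sends it to 0. *)
Lemma hom_ge g a : S g -> (forall x, a <= g x) -> a <= h g.
Proof.
move=> Sg ga; rewrite leNgt; apply/negP => hga.
have Sc : S (fun=> - h g) by exact: msmooth_cst.
have Sd : S (fun x => g x + - h g) by exact: msmoothD.
have Sv : S (fun x => (g x + - h g)^-1).
  apply: msmoothV => // x _; rewrite subr_eq0 gt_eqF//.
  exact: lt_le_trans hga (ga x).
have := hM Sd Sv; rewrite hD// hC subrr mul0r.
rewrite (_ : (fun x => _) = fun=> 1) ?hC; first by move/eqP; rewrite oner_eq0.
apply/funext => x; rewrite divff// subr_eq0 gt_eqF//.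
exact: lt_le_trans hga (ga x).
Qed.

Lemma hom_sum0 m (F : nat -> X -> R) : (forall i, S (F i)) ->
  (forall i, h (F i) = 0) -> h (fun x => \sum_(i < m) F i x) = 0.
Proof.
move=> SF F0; elim: m => [|m IH].
  by under eq_fun do rewrite big_ord0; rewrite hC.
under eq_fun do rewrite big_ord_recr /=.
by rewrite hD ?IH ?F0 ?addr0//; apply: msmooth_sum => // i _; exact: SF.
Qed.

(* Otherwise the zero sets of the functions in the kernel have empty
   intersection; the partition of unity [rho] below lies in the kernel, and the
   value of [h] at [phi = \sum_i i rho_i] would exceed every natural number. *)
Lemma smooth_hom_is_evaluation : exists x, forall f, S f -> h f = f x.
Proof.
apply: contrapT => noX.
have ex x : exists f, [/\ S f, h f = 0 & f x != 0].
  apply: contrapT => H; apply: noX; exists x => f Sf; apply: contrapT => hf; apply: H.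
  exists (fun y => f y + - h f).
  have Sc : S (fun=> - h f) by exact: msmooth_cst.
  split; [exact: msmoothD|by rewrite hD// hC subrr|].
  by rewrite subr_eq0; apply/eqP => E; apply: hf.
have [f fP] := choice ex.
pose W x := setT `&` f x @^-1` [set t | t != 0].
have HW x : mopen A (W x) /\ W x x.
  have [Sf _ fx] := fP x; split; last by split.
  by apply: mopen_preimage => //; exact: open_neq.
have [s scov] := lindelof ssA HW.
pose F k : X -> R := if s k is Some x then f x else fun=> 0.
have SF k : S (F k).
  by rewrite /F; case: (s k) => [x|]; [have [] := fP x|exact: msmooth_cst].
have F0 k : h (F k) = 0.
  by rewrite /F; case: (s k) => [x|]; [have [] := fP x|exact: hC].
have Fcov y : exists k, F k y != 0.
  by have [k [x [E [_ Wy]]]] := scov y; exists k; rewrite /F E.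
pose u k x : R := F k x * F k x.
have u0 k x : 0 <= u k x by rewrite /u -expr2 sqr_ge0.
have Su k : S (u k) by exact: (msmoothM oT (SF k) (SF k)).
(* Where some [u k] exceeds [1 / (m+1)], [q i] is nonpositive for all [i > max k m], so that [psi i]
   vanishes: this gives local finiteness. At the first index [k] with [F k x != 0] the partial sum
   is 0, the step equals 1, and [psi k x = u k x] is positive. The factor [u k] of [psi k] keeps it
   in the kernel of [h]. *)
pose q k x : R := 1 + - (k%:R * \sum_(j < k) u j x).
have Sq k : S (q k).
  apply: msmoothD => //; first exact: msmooth_cst.
  apply: (msmooth_ext (f := fun x => - k%:R * \sum_(j < k) u j x)).
    by move=> x _; rewrite mulNr.
  apply: msmoothM => //; first exact: msmooth_cst.
  by apply: msmooth_sum => // i _; exact: Su.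
pose psi k x : R := smooth_step (q k x) * u k x.
have Ss k : S (fun x => smooth_step (q k x)) by exact: (msmooth_smooth_step oT (Sq k)).
have Spsi k : S (psi k) by exact: (msmoothM oT (Ss k) (Su k)).
have step0 t : 0 <= smooth_step t :> R.
  by rewrite /smooth_step divr_ge0 ?flat_ge0// ltW// smooth_step_den.
have psi0 k x : 0 <= psi k x by exact: mulr_ge0.
have hpsi k : h (psi k) = 0.
  by rewrite /psi hM// [h (u k)]hM// F0 !mulr0.
have Nex x : exists N : nat, exists W, [/\ mopen A W, W x &
    forall y i, W y -> (N <= i)%N -> psi i y = 0].
  have [k Fk] := Fcov x.
  have uk : 0 < u k x by rewrite lt_neqAle u0 eq_sym mulf_neq0.
  have [m mE] := ltr_add_invr uk; rewrite add0r in mE.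
  exists (maxn k.+1 m.+1); exists (setT `&` u k @^-1` [set t | m.+1%:R^-1 < t]).
  split=> //; first by exact: (mopen_preimage atA oT (@open_gt _ _) (Su k)).
  move=> y i [_ /= uy]; rewrite geq_max => /andP[ki mi].
  rewrite /psi smooth_step0 ?mul0r// /q subr_le0.
  have i0 : 0 < i%:R :> R by rewrite ltr0n (leq_ltn_trans _ ki).
  rewrite -ler_pdivrMl// mulr1; apply: (@le_trans _ _ m.+1%:R^-1).
    by rewrite lef_pV2 ?posrE// ?ler_nat// ltr0n.
  apply: le_trans (ltW uy) _.
  by rewrite (bigD1 (Ordinal ki))//= lerDl sumr_ge0.
have [N NP] := choice Nex.
have lfpsi : locally_finite (A := A) N psi by exact: NP.
pose sg := lfsum N psi.
have sg_gt0 x : 0 < sg x.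
  pose k := ex_minn (Fcov x).
  have [kF kmin] : F k x != 0 /\ forall j, (j < k)%N -> F j x = 0.
    rewrite /k; case: ex_minnP => m Fm mmin; split=> // j jm; apply/eqP.
    by apply: contraTT jm => /mmin; rewrite -leqNgt.
  have kp : 0 < psi k x.
    rewrite /psi /q big1 ?mulr0 ?subr0; last first.
      by move=> j _; rewrite /u kmin ?mulr0.
    by rewrite smooth_step1// mul1r lt_neqAle u0 eq_sym mulf_neq0.
  have kM : (k < maxn (N x) k.+1)%N by rewrite leq_max leqnn orbT.
  rewrite /sg (lfsumE lfpsi (leq_maxl (N x) k.+1)).
  by rewrite (bigD1 (Ordinal kM))//= ltr_wpDr// sumr_ge0.
have Ssg : S sg by exact: (lfsum_smooth atA lfpsi Spsi).
have Sisg : S (fun x => (sg x)^-1) by apply: msmoothV => // x _; rewrite gt_eqF.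
pose rho i x : R := psi i x * (sg x)^-1.
have Srho i : S (rho i) by exact: (msmoothM oT (Spsi i) Sisg).
have hrho i : h (rho i) = 0 by rewrite /rho hM// hpsi mul0r.
pose irho i x : R := i%:R * rho i x.
have lfi : locally_finite (A := A) N irho.
  move=> x; have [W' [oW' Wx W0]] := NP x; exists W'; split=> // y i Wy Ni.
  by rewrite /irho /rho W0// mul0r mulr0.
have lfr : locally_finite (A := A) N rho.
  move=> x; have [W' [oW' Wx W0]] := NP x; exists W'; split=> // y i Wy Ni.
  by rewrite /rho W0// mul0r.
have Sphi : S (lfsum N irho).
  apply: (lfsum_smooth atA lfi) => i.
  exact: (msmoothM oT (@msmooth_cst _ _ _ A setT (i%:R : R)) (Srho i)).
have rho1 x : lfsum N rho x = 1.
  have := sg_gt0 x; rewrite /sg /lfsum => sx.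
  by rewrite -mulr_suml divff// gt_eqF.
suff bnd m : m%:R <= h (lfsum N irho).
  have := bnd (Num.trunc (h (lfsum N irho))).+1.
  by rewrite leNgt truncnS_gt.
(* Adding the kernel elements [(m - i) * rho i] for [i < m] raises the coefficients of
   [lfsum N irho] below [m] to [m]. The result is at least [m] everywhere, and [hom_ge] applies to
   it. *)
pose c i : R := if (i < m)%N then m%:R - i%:R else 0.
have Sc i : S (fun x => c i * rho i x) by exact: (msmoothM oT (@msmooth_cst _ _ _ A setT (c i)) (Srho i)).
have := @hom_ge (fun x => lfsum N irho x + \sum_(i < m) (c i * rho i x)) m%:R.
rewrite hD//; last by apply: msmooth_sum => // i _; exact: Sc.
rewrite (hom_sum0 m (F := fun i x => c i * rho i x))//; last first.
  by move=> i; rewrite hM// ?hrho ?mulr0//; exact: msmooth_cst.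
rewrite addr0; apply; first by apply: msmoothD => //; apply: msmooth_sum => // i _; exact: Sc.
move=> x; have E : m%:R = m%:R * lfsum N rho x by rewrite rho1 mulr1.
rewrite [leLHS]E.
rewrite (lfsumE lfi (leq_maxl (N x) m)) (lfsumE lfr (leq_maxl (N x) m)).
rewrite (big_ord_widen _ (fun i => c i * rho i x) (leq_maxr (N x) m)).
rewrite [X in _ <= _ + X]big_mkcond -big_split /= mulr_sumr; apply: ler_sum => i _.
have r0 : 0 <= rho i x by rewrite mulr_ge0// invr_ge0 ltW.
rewrite /irho /c; case: ltnP => im; first by rewrite -mulrDl addrC subrK.
by rewrite addr0 ler_wpM2r// ler_nat.
Qed.

End Milnor.

(** * The Rees algebra *)

Section Laurent.
Context {R : realType} {X : Type}.
Implicit Types (p q : laurent R X) (i j k : int) (f g : X -> R).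

Lemma finite_support_enum p : finite_support p ->
  exists s : seq int, [/\ uniq s, forall i, i \in s -> p i <> 0 &
    forall i, i \notin s -> p i = 0].
Proof.
move=> /finite_seqP [s sE]; exists (undup s).
have sP i : i \in s <-> p i <> 0.
  by split=> [si|pi]; [have : [set` s] i by []; rewrite -sE|have : [set i | p i <> 0] i by []; rewrite sE].
split; [exact: undup_uniq|by move=> i; rewrite mem_undup => /sP|].
by move=> i; rewrite mem_undup => /negP si; apply: contrapT => /sP.
Qed.

Lemma finite_support_seq p (s : seq int) :
  (forall i, i \notin s -> p i = 0) -> finite_support p.
Proof.
move=> ps; have fs : finite_set [set` s] by apply/finite_seqP; exists s.
apply: sub_finite_set fs => i /= pi.
by apply: contrapT => /negP /ps.
Qed.

Lemma fsum_seq (V : nmodType) (F : int -> V) (s : seq int) : uniq s ->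
  (forall i, i \notin s -> F i = 0) ->
  \sum_(i \in [set: int]) F i = \sum_(i <- s) F i.
Proof.
move=> us Fs; rewrite (@fsbigE _ _ _ _ _ s)//; last by move=> i _; exact: Fs.
by apply: eq_bigl => i; apply/mem_set.
Qed.

Lemma laurent_sumE (I : Type) (s : seq I) (G : I -> laurent R X) k :
  (\sum_(l <- s) G l) k = \sum_(l <- s) G l k.
Proof. by elim: s => [|l s IH]; rewrite ?big_nil// !big_cons -IH. Qed.

Lemma laurent_decomp p (s : seq int) : uniq s -> (forall i, i \notin s -> p i = 0) ->
  p = \sum_(i <- s) monomial i (p i).
Proof.
move=> us ps; apply/funext => k; rewrite laurent_sumE.
have [ks|ks] := boolP (k \in s).
  rewrite (bigD1_seq k)//= big1 ?addr0; first by rewrite /monomial eqxx.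
  by move=> i ik; rewrite /monomial eq_sym (negbTE ik).
rewrite big_seq big1 ?ps// => i si; rewrite /monomial; case: eqP => // ki.
by move: ks; rewrite ki si.
Qed.

Lemma laurent_mul_decomp p q (s t : seq int) : uniq s -> uniq t ->
  (forall i, i \notin s -> p i = 0) -> (forall i, i \notin t -> q i = 0) ->
  laurent_mul p q = \sum_(i <- s) \sum_(j <- t) monomial (i + j) (p i * q j).
Proof.
move=> us ut ps qt; apply/funext => k; rewrite /laurent_mul.
rewrite (fsum_seq us); last by move=> i /ps ->; rewrite mul0r.
rewrite laurent_sumE; apply: eq_bigr => i _; rewrite laurent_sumE.
have [kt|kt] := boolP (k - i \in t).
  rewrite (bigD1_seq (k - i))//= big1 ?addr0; first by rewrite /monomial [i + _]addrC subrK eqxx.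
  move=> j jk; rewrite /monomial; case: eqP => // E; case/eqP: jk; rewrite E.
  by rewrite addrC addKr.
rewrite big_seq big1 ?qt ?mulr0// => j tj; rewrite /monomial; case: eqP => // E.
by move: kt; rewrite E addrC addKr tj.
Qed.

Lemma monomial_mul i j f g :
  laurent_mul (monomial i f) (monomial j g) = monomial (i + j) (f * g).
Proof.
rewrite (laurent_mul_decomp (s := [:: i]) (t := [:: j]))//.
- by rewrite !big_seq1 /monomial !eqxx.
- by move=> k; rewrite inE /monomial => /negbTE ->.
- by move=> k; rewrite inE /monomial => /negbTE ->.
Qed.

Lemma monomialD i f g : monomial i (f + g) = monomial i f + monomial i g.
Proof.
apply/funext => k; rewrite -[RHS]/(monomial i f k + monomial i g k) /monomial.
by case: eqP => // _; rewrite addr0.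
Qed.

Lemma monomialZ i (a : R) f : monomial i (a *: f) = a *: monomial i f.
Proof.
apply/funext => k; rewrite -[RHS]/(a *: monomial i f k) /monomial.
by case: eqP => // _; rewrite scaler0.
Qed.

Lemma monomial0 i : monomial i 0 = 0 :> laurent R X.
Proof. by apply/funext => k; rewrite /monomial; case: eqP. Qed.

Lemma finite_support_monomial i f : finite_support (monomial i f).
Proof.
by apply: (finite_support_seq (s := [:: i])) => k; rewrite inE /monomial => /negbTE ->.
Qed.

Lemma finite_supportD p q : finite_support p -> finite_support q ->
  finite_support (p + q).
Proof.
move=> /finite_support_enum [s [_ _ ps]] /finite_support_enum [t [_ _ qt]].
apply: (finite_support_seq (s := s ++ t)) => i; rewrite mem_cat negb_or => /andP[si ti].
by rewrite fctE ps// qt// addr0.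
Qed.

Lemma finite_supportZ (a : R) p : finite_support p -> finite_support (a *: p).
Proof.
move=> /finite_support_enum [s [_ _ ps]]; apply: (finite_support_seq (s := s)) => i /ps pi.
by rewrite fctE pi scaler0.
Qed.

(** By additivity, multiplicativity has to be checked on homogeneous components only. [S] and [h]
    are kept general so that [h] need not yet be known to be a morphism. *)
Lemma laurent_mul_morph (S : set (laurent R X)) (h : laurent R X -> R) p q :
  S 0 -> h 0 = 0 -> (forall p q, S p -> S q -> S (p + q)) ->
  (forall p q, S p -> S q -> h (p + q) = h p + h q) ->
  finite_support p -> finite_support q ->
  (forall i, S (monomial i (p i))) -> (forall j, S (monomial j (q j))) ->
  (forall i j, S (monomial (i + j) (p i * q j))) ->
  (forall i j, h (monomial (i + j) (p i * q j)) =
               h (monomial i (p i)) * h (monomial j (q j))) ->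
  h (laurent_mul p q) = h p * h q.
Proof.
move=> S0 h0 SD hD fp fq Sp Sq Spq H.
have Ssum (I : Type) (r : seq I) (G : I -> laurent R X) : (forall l, S (G l)) -> S (\sum_(i <- r) G i).
  by move=> SG; elim/big_ind: _.
have hsum (I : Type) (r : seq I) (G : I -> laurent R X) : (forall l, S (G l)) ->
    h (\sum_(i <- r) G i) = \sum_(i <- r) h (G i).
  move=> SG; elim: r => [|i r IH]; first by rewrite !big_nil.
  by rewrite !big_cons hD ?IH//; exact: Ssum.
have [s [us _ ps]] := finite_support_enum fp; have [t [ut _ qt]] := finite_support_enum fq.
rewrite (laurent_mul_decomp us ut ps qt).
rewrite {2}(laurent_decomp us ps) {2}(laurent_decomp ut qt) !hsum//; last first.
  by move=> i; exact: Ssum.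
rewrite mulr_suml; apply: eq_bigr => i _; rewrite hsum// mulr_sumr.
by apply: eq_bigr => j _; rewrite H.
Qed.

End Laurent.

(** * The filtration by weights *)

Section Filtration.
Context {R : realType} {n r : nat} {X : Type} {A : set (chart R n X)}.
Context {F : nat -> set X -> set (X -> R)} {N : set X}.
Hypothesis ssA : smooth_structure A.
Hypothesis hF : weighted_pair A r F N.
Let atA : atlas A := smooth_structure_atlas ssA.
Let wF : weighting A r F := wp_weighting hF.
Let oT := mopenT atA.

Lemma filtration_mono i j U : mopen A U -> (i <= j)%N -> F j U `<=` F i U.
Proof.
move=> oU /subnK <-; elim: (j - i)%N => [|k IH] //; rewrite addSn.
by apply: subset_trans IH; exact: wt_decr wF _ _ oU.
Qed.

Lemma filtration_smooth i U f : mopen A U -> F i U f -> msmooth A U f.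
Proof.
by move=> oU Ff; apply/(wt_zero wF) => //; exact: filtration_mono (leq0n i) _ Ff.
Qed.

Lemma filtration0 f : F 0%N setT f <-> msmooth A setT f.
Proof. exact: wt_zero wF _ _ oT. Qed.

Lemma filtration_sum i U I (s : seq I) (G : I -> X -> R) : mopen A U ->
  (forall k, F i U (G k)) -> F i U (fun x => \sum_(k <- s) G k x).
Proof.
move=> oU FG; rewrite (_ : (fun x => _) = \sum_(k <- s) G k); last first.
  by apply/funext => x; rewrite fct_sumE.
elim: s => [|k s IH]; first by rewrite big_nil; exact: wt_ideal0 wF _ _ oU.
by rewrite big_cons; exact: wt_idealD wF _ _ _ _ oU (FG k) IH.
Qed.

Lemma weighted_chart_in c w : weighted_chart A r F c w -> A c.
Proof. by case. Qed.

Lemma chart_monomial_in c w i (s : 'I_n -> nat) g : weighted_chart A r F c w ->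
  msmooth A (dom c) g -> (i <= \sum_(a < n) s a * w a)%N ->
  F i (dom c) (fun x => g x * \prod_(a < n) coord c x ord0 a ^+ s a).
Proof.
move=> [Ac _ FE] Sg le; apply/FE; exists 1%N, (fun=> g), (fun=> s); split=> // x _.
by rewrite big_ord1.
Qed.

Lemma chart_coord_in c w a : weighted_chart A r F c w ->
  F (w a) (dom c) (fun x => coord c x ord0 a).
Proof.
move=> wc; have oc := mopen_dom atA (weighted_chart_in wc).
have H := @chart_monomial_in c w (w a) (fun b => (b == a)%N : nat) (fun=> 1) wc (@msmooth_cst _ _ _ A _ 1).
apply: (wt_ext wF oc) (H _).
  move=> x _; rewrite mul1r (bigD1 a)//= eqxx expr1 big1 ?mulr1// => b /negbTE ba.
  by rewrite ba expr0.
rewrite (bigD1 a)//= eqxx mul1n big1 ?addn0// => b /negbTE ba.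
by rewrite ba mul0n.
Qed.

(** This is not among the axioms of [weighting]. In a weighted chart it is the additivity of weights
    under products of monomials, and [wt_local] makes it global. *)
Lemma filtrationM i j f g : F i setT f -> F j setT g -> F (i + j)%N setT (f * g).
Proof.
move=> Ff Fg; apply: (wt_local wF oT) => x _.
have [c [w [cx wc]]] := wt_coordinates wF x; have [Ac _ FE] := wc.
have oc := mopen_dom atA Ac.
exists (dom c); split=> //.
have /FE [m [gf [sf [Sgf lef fE]]]] := wt_restrict wF oT oc (@subsetT _ _) Ff.
have /FE [l [gg [sg [Sgg leg gE]]]] := wt_restrict wF oT oc (@subsetT _ _) Fg.
pose T k k' x := (gf k x * gg k' x) * \prod_(a < n) coord c x ord0 a ^+ (sf k a + sg k' a).
apply: (wt_ext wF oc (f := fun x => \sum_(k < m) \sum_(k' < l) T k k' x)).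
  move=> y cy; rewrite [RHS]/GRing.mul /= fE// gE// mulr_suml; apply: eq_bigr => k _.
  rewrite mulr_sumr; apply: eq_bigr => k' _; rewrite /T mulrACA -big_split /=.
  by congr (_ * _); apply: eq_bigr => a _; rewrite exprD.
apply: (filtration_sum _ oc) => k; apply: (filtration_sum _ oc) => k'.
apply: (chart_monomial_in wc); first exact: (msmoothM oc (Sgf k) (Sgg k')).
apply: leq_trans (leq_add (lef k) (leg k')) _.
by rewrite -big_split /=; apply/eq_leq/eq_bigr => a _; rewrite mulnDl.
Qed.

(** All degrees [i <= 0] carry the whole algebra, that is, filtration index 0. *)
Definition posz (i : int) : nat := if i is Posz k then k else 0%N.

Lemma filtE i : filt F i = F (posz i) setT.
Proof. by case: i. Qed.

(** Truncating degrees at 0 is subadditive, so the filtration index of [i + j] is at most the sum of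
    those of [i] and [j]. *)
Lemma filtM i j f g : filt F i f -> filt F j g -> filt F (i + j) (f * g).
Proof.
rewrite !filtE => Ff Fg; apply: filtration_mono (filtrationM Ff Fg) => //.
have P k : (posz k)%:Z = if (0 <= k)%R then k else 0 by case: k.
by move: (P (i + j)) (P i) (P j); do 3 case: ifP; lia.
Qed.

Lemma rees_monomial i f : filt F i f -> rees F (monomial i f).
Proof.
move=> Ff; split; first exact: finite_support_monomial.
move=> j; rewrite /monomial; case: eqP => [->//|_].
by rewrite filtE; exact: wt_ideal0 wF _ _ oT.
Qed.

Lemma reesD p q : rees F p -> rees F q -> rees F (p + q).
Proof.
move=> [fp Fp] [fq Fq]; split; first exact: finite_supportD.
move=> i; have := Fp i; have := Fq i; rewrite !filtE => H1 H2.
exact: wt_idealD wF _ _ _ _ oT H2 H1.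
Qed.

Lemma filtrationZ i (a : R) f : F i setT f -> F i setT (a *: f).
Proof.
move=> Ff; exact: wt_idealM wF _ _ _ _ oT (@msmooth_cst _ _ _ A setT a) Ff.
Qed.

Lemma reesZ (a : R) p : rees F p -> rees F (a *: p).
Proof.
move=> [fp Fp]; split; first exact: finite_supportZ.
by move=> i; have := Fp i; rewrite !filtE; exact: filtrationZ.
Qed.

Lemma rees0 : rees F 0.
Proof.
rewrite -(monomial0 0); apply: rees_monomial; rewrite filtE.
exact: wt_ideal0 wF _ _ oT.
Qed.

Lemma rees_sum I (s : seq I) (G : I -> laurent R X) :
  (forall i, rees F (G i)) -> rees F (\sum_(i <- s) G i).
Proof. by move=> RG; elim/big_ind: _ => //; [exact: rees0|exact: reesD]. Qed.

Lemma reesM p q : rees F p -> rees F q -> rees F (laurent_mul p q).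
Proof.
move=> [fp Fp] [fq Fq].
have [s [us _ ps]] := finite_support_enum fp; have [t [ut _ qt]] := finite_support_enum fq.
rewrite (laurent_mul_decomp us ut ps qt).
by apply: rees_sum => i; apply: rees_sum => j; apply: rees_monomial; exact: filtM.
Qed.

Lemma rees_decomp p : rees F p -> exists2 s : seq int, p = \sum_(i <- s) monomial i (p i) &
  forall i, rees F (monomial i (p i)).
Proof.
move=> [fp Fp]; have [s [us _ ps]] := finite_support_enum fp.
by exists s; [exact: laurent_decomp|move=> i; exact: rees_monomial].
Qed.

Definition cut_section (c : chart R n X) (chi f : X -> R) (y : X) : R :=
  if pselect (dom c y) is left _ then chi y * f y else 0.

Lemma cutE c chi f y : dom c y -> cut_section c chi f y = chi y * f y.
Proof. by rewrite /cut_section; case: pselect. Qed.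

(** Multiplication by [chi] turns a function on the chart domain into a global one of the same
    filtration degree with the same germ at [x]; it is the passage from local coordinates to
    elements of the Rees algebra. *)
Definition cutoff (c : chart R n X) (x : X) (chi : X -> R) :=
  (exists V, [/\ mopen A V, V x, V `<=` dom c & forall y, V y -> chi y = 1]) /\
  (forall i f, F i (dom c) f -> F i setT (cut_section c chi f)).

Lemma cutoff_ex c x : A c -> dom c x -> exists chi, cutoff c x chi.
Proof.
move=> Ac cx; have oc := mopen_dom atA Ac.
have [chi [Schi HV [Z [oZ ZT chi0]]]] := bump_function ssA oc cx.
exists chi; split=> // i f Ff; apply: (wt_local wF oT) => y _.
have : (Z `|` dom c) y by rewrite ZT.
case=> [Zy|cy].
  exists Z; split=> //; apply: (wt_ext wF oZ) (wt_ideal0 wF i oZ) => z Zz.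
  by rewrite /cut_section; case: pselect => // ?; rewrite chi0// mul0r.
exists (dom c); split=> //.
apply: (wt_ext wF oc (f := chi * f)); first by move=> z cz; rewrite cutE.
by apply: (wt_idealM wF) => //; apply: msmooth_sub Schi.
Qed.

(** For the converse, a bump function equal to 1 at a point off [N] and vanishing on [N] has
    filtration degree 1. In the chart it is a combination of monomials of positive weight, each
    containing a coordinate of positive weight; if all these vanished at the point, so would the
    bump function. *)
Lemma weighted_chart_N c w x : weighted_chart A r F c w -> dom c x ->
  N x <-> (forall a, (0 < w a)%N -> coord c x ord0 a = 0).
Proof.
move=> wc cx; have [Ac _ FE] := wc; have oc := mopen_dom atA Ac; split=> [Nx a wa|H].
  have := filtration_mono oc wa (chart_coord_in a wc).
  by move=> /(wp_vanishing hF _ oc) [_ /(_ x cx Nx)].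
apply: contrapT => nNx; have [oN _] := wp_submanifold hF.
have [chi [Schi [V [_ Vx _ chi1]] [Z [_ ZT chi0]]]] := bump_function ssA oN nNx.
have : F 1%N (dom c) chi.
  apply/(wp_vanishing hF) => //; split; first exact: msmooth_sub Schi.
  move=> y _ Ny; apply: chi0; have : (Z `|` ~` N) y by rewrite ZT.
  by case.
move=> /FE [m [g [s [_ les /(_ x cx)]]]]; rewrite chi1//.
rewrite big1 => [/eqP|k _]; first by rewrite oner_eq0.
have [a /andP[wa sa]] : exists a, (0 < w a)%N && (0 < s k a)%N.
  apply/existsP; apply: contraTT (les k) => /existsPn H'; rewrite -leqNgt leqn0 big1// => a _.
  by have := H' a; rewrite negb_and -!leqNgt !leqn0 => /orP[] /eqP ->; rewrite ?muln0.
by rewrite (bigD1 a)//= H// expr0n gtn_eqF// mul0r mulr0.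
Qed.

End Filtration.

(** * Values of a morphism on homogeneous elements *)

Section DeltaCalculus.
Context {R : realType} {n r : nat} {X : Type} {A : set (chart R n X)}.
Context {F : nat -> set X -> set (X -> R)} {N : set X}.
Hypothesis ssA : smooth_structure A.
Hypothesis hF : weighted_pair A r F N.
Let atA : atlas A := smooth_structure_atlas ssA.
Let wF : weighting A r F := wp_weighting hF.
Let oT := mopenT atA.

Definition dval (h : delta F) (i : nat) (f : X -> R) : R :=
  evaluation (monomial i%:Z f) h.

Lemma F01 : F 0%N setT 1.
Proof. by apply/(filtration0 ssA hF); exact: msmooth_cst. Qed.

Lemma dvalD h i f g : F i setT f -> F i setT g ->
  dval h i (fun x => f x + g x) = dval h i f + dval h i g.
Proof.
move=> Ff Fg; rewrite /dval /evaluation -(ah_add (svalP h)); try exact: (rees_monomial ssA hF).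
by rewrite -monomialD.
Qed.

Lemma dval0 h i : dval h i (fun=> 0) = 0.
Proof.
have F0 : F i setT 0 by exact: wt_ideal0 wF _ _ oT.
by apply: (addrI (dval h i 0)); rewrite -dvalD// addr0; congr dval; apply/funext => x; exact: addr0.
Qed.

Lemma dval_sum h i m (G : 'I_m -> X -> R) : (forall k, F i setT (G k)) ->
  dval h i (fun x => \sum_(k < m) G k x) = \sum_(k < m) dval h i (G k).
Proof.
move=> FG; elim: (index_enum _) => [|k s IH].
  by under eq_fun do rewrite big_nil; rewrite big_nil dval0.
under eq_fun do rewrite big_cons; rewrite big_cons dvalD ?IH//.
exact: (filtration_sum hF _ oT).
Qed.

Lemma dvalM h i j f g : F i setT f -> F j setT g ->
  dval h (i + j) (fun x => f x * g x) = dval h i f * dval h j g.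
Proof.
move=> Ff Fg; rewrite /dval /evaluation -(ah_mul (svalP h)); try exact: (rees_monomial ssA hF).
by rewrite monomial_mul.
Qed.

Lemma dval_cst h a : dval h 0 (fun=> a) = a.
Proof.
rewrite /dval /evaluation.
have -> : (fun _ : X => a) = a *: (1 : X -> R) by apply/funext => x; rewrite !fctE [RHS]mulr1.
rewrite monomialZ (ah_scale (svalP h)); last exact/(rees_monomial ssA hF)/F01.
by rewrite (ah_one (svalP h)) mulr1.
Qed.

Lemma evaluation_zX h m f : F 0%N setT f ->
  evaluation (monomial (- m%:Z) f) h = delta_pi h ^+ m * dval h 0 f.
Proof.
move=> Ff; elim: m => [|m IH]; first by rewrite oppr0 expr0 mul1r.
have Fm : filt F (- m%:Z) f by case: m {IH}.
rewrite exprS -mulrA -IH /delta_pi /evaluation -(ah_mul (svalP h)).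
- rewrite monomial_mul (_ : 1 * f = f) ?mul1r//; congr (sval h (monomial _ _)).
  by lia.
- by apply: (rees_monomial ssA hF); exact: F01.
- exact: (rees_monomial ssA hF).
Qed.

(** In the Rees algebra, [z^(-i) f] is the product of [z^m] and [z^(-(i+m)) f]. For [t = 0] and
    [m > 0] both sides vanish, which is how the quotient defining the graded algebra appears. *)
Lemma dval_shift h i m f : F (i + m)%N setT f ->
  dval h i f = delta_pi h ^+ m * dval h (i + m) f.
Proof.
move=> Ff; have := evaluation_zX h m F01; rewrite dval_cst mulr1 => <-.
rewrite /dval /evaluation -(ah_mul (svalP h)).
- rewrite monomial_mul mul1r; congr (sval h (monomial _ _)); by lia.
- by apply: (rees_monomial ssA hF); case: m {Ff} => [|m]; exact: F01.
- exact: (rees_monomial ssA hF).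
Qed.

Lemma dval_prod h (w : 'I_n -> nat) (s : 'I_n -> nat) (G : 'I_n -> X -> R) :
  (forall a, F (w a) setT (G a)) ->
  F (\sum_(a < n) s a * w a)%N setT (fun x => \prod_(a < n) G a x ^+ s a) /\
  dval h (\sum_(a < n) s a * w a)%N (fun x => \prod_(a < n) G a x ^+ s a) =
    \prod_(a < n) dval h (w a) (G a) ^+ s a.
Proof.
move=> FG; elim: (index_enum _) => [|a l [IHF IH]].
  rewrite !big_nil; under eq_fun do rewrite big_nil; split; first exact: F01.
  exact: dval_cst.
have Ef : (fun x => \prod_(b <- a :: l) G b x ^+ s b) =
    (fun x => G a x ^+ s a * \prod_(b <- l) G b x ^+ s b).
  by apply/funext => x; rewrite big_cons.
rewrite Ef !big_cons.
have [FX EX] : F (s a * w a)%N setT (fun x => G a x ^+ s a) /\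
    dval h (s a * w a) (fun x => G a x ^+ s a) = dval h (w a) (G a) ^+ s a.
  elim: (s a) => [|k [IHk Ek]].
    rewrite mul0n expr0; under eq_fun do rewrite expr0; split; [exact: F01|exact: dval_cst].
  rewrite mulSn exprS; under eq_fun do rewrite exprS; split.
    exact: (filtrationM ssA hF (FG a) IHk).
  by rewrite dvalM// Ek.
split; first exact: (filtrationM ssA hF FX IHF).
by rewrite dvalM// EX IH.
Qed.

(* The restriction of [h] to the degree 0 part is an algebra morphism from
   C^oo(X), hence the evaluation at a point, which will be [base h]. *)
Lemma base_ex h : exists x, forall f, msmooth A setT f -> dval h 0 f = f x.
Proof.
apply: (smooth_hom_is_evaluation ssA (h := dval h 0)).
- exact: dval_cst.
- by move=> f g /(filtration0 ssA hF) Ff /(filtration0 ssA hF) Fg; exact: dvalD.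
- by move=> f g /(filtration0 ssA hF) Ff /(filtration0 ssA hF) Fg; exact: (@dvalM h 0%N 0%N).
Qed.

Definition base h : X := projT1 (cid (base_ex h)).

Lemma baseE h f : F 0%N setT f -> dval h 0 f = f (base h).
Proof. by move=> /(filtration0 ssA hF); rewrite /base; case: cid => x /=; exact. Qed.

Lemma base_unique h x : (forall f, msmooth A setT f -> dval h 0 f = f x) -> base h = x.
Proof.
move=> H; apply: contrapT => /(separate_points ssA) [f Sf]; apply.
by rewrite -H// baseE//; exact/(filtration0 ssA hF).
Qed.

(** Multiplying by a bump function that is 1 at [base h] and supported in [V] does not change the
    value, because its own value under [h] is 1. *)
Lemma dval_local h i f g V : F i setT f -> F i setT g -> mopen A V -> V (base h) ->
  (forall x, V x -> f x = g x) -> dval h i f = dval h i g.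
Proof.
move=> Ff Fg oV Vh fg.
have [chi [Schi [V' [_ V'h _ chi1]] [Z [_ ZV chi0]]]] := bump_function ssA oV Vh.
have Fchi : F 0%N setT chi by exact/(filtration0 ssA hF).
have E k : F i setT k -> dval h i k = dval h i (fun x => chi x * k x).
  by move=> Fk; rewrite -[i in RHS]add0n dvalM// baseE// chi1// mul1r.
rewrite E// [RHS]E//; congr dval; apply/funext => x.
have : (Z `|` V) x by rewrite ZV.
by case=> [Zx|Vx]; [rewrite chi0// !mul0r|rewrite fg].
Qed.

(** Off [N] there is a bump function of filtration degree 1 with value 1 at the base point. That
    value is also [delta_pi h] times its value in degree 1, hence 0. *)
Lemma base_N h : delta_pi h = 0 -> N (base h).
Proof.
move=> h0; apply: contrapT => nN; have [oN _] := wp_submanifold hF.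
have [chi [Schi [V' [_ V'h _ chi1]] [Z [_ ZV chi0]]]] := bump_function ssA oN nN.
have F1 : F 1%N setT chi.
  apply/(wp_vanishing hF) => //; split=> // y _ Ny; apply: chi0.
  have : (Z `|` ~` N) y by rewrite ZV.
  by case.
have := baseE h (wt_decr wF oT F1); rewrite chi1// (dval_shift h (i := 0) (m := 1))//.
by rewrite h0 mul0r => /eqP; rewrite eq_sym oner_eq0.
Qed.

(** One cutoff is fixed for each pair [c], [x], so that coordinates become functions; the default 0
    is never met for [x] in the domain of a chart of [A]. *)
Definition cutoff_fun c x : X -> R :=
  if pselect (exists chi, cutoff (A := A) (F := F) c x chi) is left e then projT1 (cid e) else 0.

Lemma cutoff_funP c x : A c -> dom c x -> cutoff (A := A) (F := F) c x (cutoff_fun c x).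
Proof.
move=> Ac cx; rewrite /cutoff_fun; case: pselect => [e|[]]; last exact: (cutoff_ex ssA hF).
by case: cid.
Qed.

Definition global_coord c x a : X -> R :=
  cut_section c (cutoff_fun c x) (fun x => coord c x ord0 a).

Lemma cut_near c x : A c -> dom c x -> exists V, [/\ mopen A V, V x, V `<=` dom c &
  forall f y, V y -> cut_section c (cutoff_fun c x) f y = f y].
Proof.
move=> Ac cx; have [[V [oV Vx Vc chi1]] _] := cutoff_funP Ac cx.
by exists V; split=> // f y Vy; rewrite cutE ?chi1 ?mul1r//; exact: Vc.
Qed.

Lemma global_coord_in c w x a : weighted_chart A r F c w -> dom c x ->
  F (w a) setT (global_coord c x a).
Proof.
move=> wc cx; have [_] := cutoff_funP (weighted_chart_in wc) cx; apply.
exact: (chart_coord_in ssA hF).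
Qed.

(** The number [y_a] of the overview. The cutoff is centred at the base point of [h] and moves with
    it; by [wcoordE] any global function of degree [w a] with the germ of the coordinate gives the
    same value. *)
Definition wcoord c (w : 'I_n -> nat) h a : R :=
  dval h (w a) (global_coord c (base h) a).

Lemma wcoordE c w h a G V : weighted_chart A r F c w -> dom c (base h) ->
  F (w a) setT G -> mopen A V -> V (base h) -> V `<=` dom c ->
  (forall x, V x -> G x = coord c x ord0 a) -> wcoord c w h a = dval h (w a) G.
Proof.
move=> wc ch FG oV Vh Vc GE; have Ac := weighted_chart_in wc.
have [V' [oV' V'h V'c cutV]] := cut_near Ac ch.
apply: (dval_local (V := V `&` V')) => //.
- exact: (global_coord_in a wc).
- exact: mopenI.
- by move=> x [Vx V'x]; rewrite /global_coord cutV// GE.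
Qed.

Lemma coord_base c w h a : weighted_chart A r F c w -> dom c (base h) ->
  coord c (base h) ord0 a = delta_pi h ^+ w a * wcoord c w h a.
Proof.
move=> wc ch; have Ac := weighted_chart_in wc.
have FG := global_coord_in a wc ch.
rewrite /wcoord -[w a in RHS]add0n -dval_shift ?add0n// baseE; last first.
  exact: (filtration_mono hF oT (leq0n _) FG).
by have [V' [oV' V'h V'c cutV]] := cut_near Ac ch; rewrite /global_coord cutV.
Qed.

(* With [d = \sum_a s_a w_a], the element [z^(-i) x^s] of the Rees algebra is
   [z^(d - i) \prod_a (z^(- w_a) x_a)^(s_a)]. *)
Lemma dval_formula c w h i f m (g : 'I_m -> X -> R) (s : 'I_m -> 'I_n -> nat) :
  weighted_chart A r F c w -> dom c (base h) -> F i setT f ->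
  (forall k, msmooth A (dom c) (g k)) ->
  (forall k, (i <= \sum_(a < n) s k a * w a)%N) ->
  (forall x, dom c x -> f x = \sum_(k < m) g k x * \prod_(a < n) coord c x ord0 a ^+ s k a) ->
  dval h i f = \sum_(k < m) g k (base h) *
    (delta_pi h ^+ (\sum_(a < n) s k a * w a - i)%N * \prod_(a < n) wcoord c w h a ^+ s k a).
Proof.
move=> wc ch Ff Sg les fE; have Ac := weighted_chart_in wc.
have oc := mopen_dom atA Ac; set x0 := base h in ch *.
have [V [oV Vx0 Vc cutV]] := cut_near Ac ch.
have [_ cutF] := cutoff_funP Ac ch.
pose G k := cut_section c (cutoff_fun c x0) (g k).
have FG k : F 0%N setT (G k).
  by apply: cutF; apply/(wt_zero wF) => //; exact: Sg.
pose P k x := \prod_(a < n) global_coord c x0 a x ^+ s k a.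
have FX a : F (w a) setT (global_coord c x0 a) by exact: (global_coord_in a wc ch).
have FGP k : F (\sum_(a < n) s k a * w a)%N setT (fun x => G k x * P k x).
  rewrite -[X in F X]add0n; apply: (filtrationM ssA hF (FG k)).
  by have [] := dval_prod h (s k) FX.
have FGPi k : F i setT (fun x => G k x * P k x).
  exact: (filtration_mono hF oT (les k) (FGP k)).
rewrite (dval_local (g := fun x => \sum_(k < m) G k x * P k x) Ff _ oV Vx0).
- rewrite dval_sum//; apply: eq_bigr => k _.
  rewrite (dval_shift h (m := (\sum_(a < n) s k a * w a - i)%N)); last by rewrite subnKC.
  have [FP EP] := dval_prod h (s k) FX; rewrite subnKC//.
  have -> : dval h (\sum_(a < n) s k a * w a)%N (fun x => G k x * P k x) =
      dval h 0 (G k) * dval h (\sum_(a < n) s k a * w a)%N (P k) by rewrite -dvalM.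
  by rewrite EP baseE// /G cutV// mulrCA.
- exact: (filtration_sum hF _ oT).
- move=> x Vx; rewrite fE; last exact: Vc.
  apply: eq_bigr => k _; rewrite /G cutV//; congr (_ * _); apply: eq_bigr => a _.
  by rewrite /global_coord cutV.
Qed.

End DeltaCalculus.

(** * The manifold structure of the deformation space *)

Section Dilation.
Context {R : realType} {n : nat}.
Implicit Types (w : 'I_n -> nat) (v : 'rV[R]_n.+1).

(** For [v = (t, y)], with [t] in position [ord0], these are the coordinates of the base point. *)
Definition dilate w v : 'rV[R]_n :=
  \row_a (v ord0 ord0 ^+ w a * v ord0 (lift ord0 a)).

Lemma smooth_dilate w (O : set 'rV[R]_n.+1) a : open O ->
  smooth_on O (fun v => dilate w v ord0 a).
Proof.
move=> oO; under [X in smooth_on _ X]eq_fun do rewrite mxE.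
apply: smoothM => //; last exact: smooth_coord.
by apply: smoothX => //; exact: smooth_coord.
Qed.

Lemma open_dilate_preimage w (O : set 'rV[R]_n) : open O -> open (dilate w @^-1` O).
Proof.
move=> oO; rewrite -[X in open X]setTI.
by apply: open_smooth_preimage => //; [exact: openT|move=> a; apply: smooth_dilate; exact: openT].
Qed.

(** A small shift of the entry [t] leads from [v0] to points with [t != 0], so an equality at those
    passes to [v0] by continuity. *)
Lemma eq_at_t0 (O : set 'rV[R]_n.+1) v0 (f g : 'rV[R]_n.+1 -> R) : open O -> O v0 ->
  {for v0, continuous f} -> {for v0, continuous g} ->
  (forall v, O v -> v ord0 ord0 != 0 -> f v = g v) -> f v0 = g v0.
Proof.
move=> oO Ov0 cf cg fg; have [t0|t0] := eqVneq (v0 ord0 ord0) 0; last exact: fg.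
apply: contrapT => /eqP; rewrite -subr_eq0 => fg0.
have cfg : {for v0, continuous (fun v => f v - g v)} by exact: continuousB.
have nb : \forall v \near v0, f v - g v != 0.
  apply: (cfg [set t | t != 0]); apply: open_nbhs_nbhs.
  by split; [exact: open_neq|].
have : nbhs v0 (O `&` [set v | f v - g v != 0]).
  exact: filterI (open_nbhs_nbhs (conj oO Ov0)) nb.
move=> /nbhs_ballP [e /= e0 He].
pose v := v0 + (e / 2) *: delta_mx ord0 ord0.
have [] : O v /\ f v - g v != 0.
  apply: He; apply: ball_rV => // i; rewrite !mxE eqxx /= opprD addNKr normrN.
  case: (i == ord0); last by rewrite mulr0 normr0.
  by rewrite mulr1 gtr0_norm ?divr_gt0// ltr_pdivrMr// ltr_pMr// ltr1n.
move=> /fg ->; first by rewrite subrr eqxx.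
by rewrite !mxE eqxx /= mulr1 t0 add0r gt_eqF// divr_gt0.
Qed.

End Dilation.

Section DeltaCharts.
Context {R : realType} {n r : nat} {X : Type} {A : set (chart R n X)}.
Context {F : nat -> set X -> set (X -> R)} {N : set X}.
Hypothesis ssA : smooth_structure A.
Hypothesis hF : weighted_pair A r F N.
Let atA : atlas A := smooth_structure_atlas ssA.
Let wF : weighting A r F := wp_weighting hF.
Let oT := mopenT atA.
Local Notation base := (base ssA hF).
Local Notation wcoord := (wcoord ssA hF).

Definition dcoord c w (h : delta F) : 'rV[R]_n.+1 :=
  \row_i if unlift ord0 i is Some a then wcoord c w h a else delta_pi h.

Definition dchart c w : chart R n.+1 (delta F) :=
  Chart [set h | dom c (base h)] (dcoord c w).

Lemma dcoord0 c w h : dcoord c w h ord0 ord0 = delta_pi h.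
Proof. by rewrite mxE unlift_none. Qed.

Lemma dcoordS c w h a : dcoord c w h ord0 (lift ord0 a) = wcoord c w h a.
Proof. by rewrite mxE liftK. Qed.

Lemma dilate_dcoord c w h : weighted_chart A r F c w -> dom c (base h) ->
  dilate w (dcoord c w h) = coord c (base h).
Proof.
move=> wc ch; apply/rowP => a; rewrite mxE dcoord0 dcoordS.
by rewrite (coord_base a wc ch).
Qed.

Definition dset c w (W : set X) : set 'rV[R]_n.+1 :=
  dilate w @^-1` (coord c @` (W `&` dom c)).

Lemma open_dset c w W : A c -> mopen A W -> open (dset c w W).
Proof. by move=> Ac oW; apply: open_dilate_preimage; exact: oW. Qed.

Lemma dset_dcoord c w W h : weighted_chart A r F c w -> dom c (base h) ->
  dset c w W (dcoord c w h) <-> W (base h).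
Proof.
move=> wc ch; rewrite /dset /= dilate_dcoord//; have [cc _ _] := atA.
split; first exact: (chart_imageP (cc _ (weighted_chart_in wc)) ch).
by move=> Wh; exists (base h).
Qed.

Lemma smooth_in_chart_dilate c w f : weighted_chart A r F c w ->
  msmooth A (dom c) f ->
  smooth_on (dset c w setT) (fun v => in_chart c f (dilate w v)).
Proof.
move=> wc Sf; have Ac := weighted_chart_in wc; have oc := mopen_dom atA Ac.
have oD : open (dset c w setT) := open_dset Ac oT.
apply: (smooth_comp (O' := coord c @` dom c)) => //.
- by have [cc _ _] := atA; have [] := cc c Ac.
- by move=> v [x [_ cx] <-]; exists x.
- by have := msmooth_chart atA oc Ac Sf; rewrite setIid.
- by move=> j; exact: smooth_dilate.
Qed.

(** By additivity [p] may be taken homogeneous. In degree [i >= 0] the weighted chart expresses the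
    function through monomials, and [dval_formula] becomes an expression in [(t, y)] whose exponents
    and coefficient functions do not depend on [h]. *)
Lemma evaluation_local p c w : weighted_chart A r F c w -> rees F p ->
  exists2 g : 'rV[R]_n.+1 -> R, smooth_on (dset c w setT) g &
    forall h, dom c (base h) -> evaluation p h = g (dcoord c w h).
Proof.
move=> wc; have Ac := weighted_chart_in wc; have oc := mopen_dom atA Ac.
have oD : open (dset c w setT) := open_dset Ac oT; have [cc _ _] := atA.
move=> /(rees_decomp ssA hF) [s pE Rs].
pose P q := rees F q /\ exists2 g : 'rV[R]_n.+1 -> R, smooth_on (dset c w setT) g &
    forall h, dom c (base h) -> evaluation q h = g (dcoord c w h).
suff [] : P p by [].
rewrite pE.
elim/big_ind: _ => [|q q' [Rq [g Sg gE]] [Rq' [g' Sg' gE']]|i _].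
- split; first exact: (rees0 ssA hF).
  exists (fun=> 0); first exact: smooth_cst.
  by move=> h _; rewrite -(monomial0 0); exact: (dval0 ssA hF h 0).
- split; first exact: (reesD ssA hF).
  exists (fun v => g v + g' v); first exact: smoothD.
  by move=> h ch; rewrite -gE// -gE'// /evaluation (ah_add (svalP h)).
split => //; have [_ /(_ i)] := Rs i; rewrite {1}/monomial eqxx => Fp {Rs}.
move: (p i) Fp => f; case: i => [i|i] Ff; last first.
  have Sf : msmooth A (dom c) f.
    by apply: (msmooth_sub (@subsetT _ _) oc); exact/(filtration0 ssA hF).
  (* [Negz i] is the degree [-(i+1)], so the element is [z^(i+1) f]. *)
  exists (fun v : 'rV[R]_n.+1 => v ord0 ord0 ^+ i.+1 * in_chart c f (dilate w v)).
    apply: smoothM => //; last exact: smooth_in_chart_dilate.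
    by apply: smoothX => //; exact: smooth_coord.
  move=> h ch; rewrite dcoord0 dilate_dcoord// in_chartE; [|exact: cc|by []].
  by rewrite -(baseE ssA hF)// -(evaluation_zX ssA hF).
have [_ _ FE] := wc.
have /FE [m [g [sx [Sg les fE]]]] := wt_restrict wF oT oc (@subsetT _ _) Ff.
exists (fun v : 'rV[R]_n.+1 => \sum_(k < m) in_chart c (g k) (dilate w v) *
  (v ord0 ord0 ^+ (\sum_(a < n) sx k a * w a - i)%N *
   \prod_(a < n) v ord0 (lift ord0 a) ^+ sx k a)).
  apply: smooth_sum => // k _; apply: smoothM => //; first exact: smooth_in_chart_dilate.
  apply: smoothM => //; first by apply: smoothX => //; exact: smooth_coord.
  by apply: smooth_prod => // a _; apply: smoothX => //; exact: smooth_coord.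
move=> h ch; rewrite -[evaluation _ h]/(dval h i f).
rewrite (dval_formula wc ch Ff Sg les fE); apply: eq_bigr => k _.
rewrite dcoord0 dilate_dcoord// in_chartE; [|exact: cc|by []].
by congr (_ * (_ * _)); apply: eq_bigr => a _; rewrite dcoordS.
Qed.

Lemma delta_ext (h h' : delta F) :
  (forall p, rees F p -> evaluation p h = evaluation p h') -> h = h'.
Proof.
case: h h' => [h hh] [h' hh'] /= E.
have Eh : h = h'.
  apply/funext => p; have [Rp|nRp] := pselect (rees F p); first exact: E.
  by rewrite (ah_outside hh nRp) (ah_outside hh' nRp).
by subst h'; congr exist; exact: Prop_irrelevance.
Qed.

(** By [evaluation_local] every evaluation factors through the coordinates, and the evaluations
    determine a morphism. *)
Lemma dcoord_inj c w h h' : weighted_chart A r F c w ->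
  dom c (base h) -> dom c (base h') -> dcoord c w h = dcoord c w h' -> h = h'.
Proof.
move=> wc ch ch' E; apply: delta_ext => p Rp.
by have [g _ gE] := evaluation_local wc Rp; rewrite !gE// E.
Qed.

(** Imposes the value 0 outside the subalgebra, as [alg_hom] demands. *)
Definition restrict_rees (h0 : laurent R X -> R) (p : laurent R X) : R :=
  if pselect (rees F p) is left _ then h0 p else 0.

Lemma restrict_reesE h0 p : rees F p -> restrict_rees h0 p = h0 p.
Proof. by rewrite /restrict_rees; case: pselect. Qed.

Lemma alg_hom_restrict h0 : h0 (monomial 0 1) = 1 ->
  (forall p q, rees F p -> rees F q -> h0 (p + q) = h0 p + h0 q) ->
  (forall a p, rees F p -> h0 (a *: p) = a * h0 p) ->
  (forall p q, rees F p -> rees F q -> h0 (laurent_mul p q) = h0 p * h0 q) ->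
  alg_hom (rees F) (restrict_rees h0).
Proof.
move=> h1 hD hZ hM; split.
- by rewrite restrict_reesE//; apply: (rees_monomial ssA hF); exact: (F01 ssA hF).
- by move=> p q Rp Rq; rewrite !restrict_reesE ?hD//; exact: (reesD ssA hF).
- by move=> a p Rp; rewrite !restrict_reesE ?hZ//; exact: (reesZ ssA hF).
- by move=> p q Rp Rq; rewrite !restrict_reesE ?hM//; exact: (reesM ssA hF).
- by move=> p nR; rewrite /restrict_rees; case: pselect.
Qed.

(** * Points with nonzero parameter *)

Section Points.
Variable t : R.
Hypothesis t0 : t != 0.

Definition ev_laurent (x : X) (p : laurent R X) : R :=
  \sum_(i \in [set: int]) t ^ (- i) * p i x.

Lemma ev_laurentE x p (s : seq int) : uniq s -> (forall i, i \notin s -> p i = 0) ->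
  ev_laurent x p = \sum_(i <- s) t ^ (- i) * p i x.
Proof. by move=> us ps; apply: fsum_seq => // i /ps ->; rewrite mulr0. Qed.

Lemma ev_laurent_monomial x i f : ev_laurent x (monomial i f) = t ^ (- i) * f x.
Proof.
rewrite (@ev_laurentE x _ [:: i]) ?big_seq1//= /monomial ?eqxx//.
by move=> k; rewrite inE => /negbTE ->.
Qed.

Lemma ev_laurentD x p q : finite_support p -> finite_support q ->
  ev_laurent x (p + q) = ev_laurent x p + ev_laurent x q.
Proof.
move=> /finite_support_enum [s [us _ ps]] /finite_support_enum [s' [us' _ qs]].
have uu := undup_uniq (s ++ s').
have pu i : i \notin undup (s ++ s') -> p i = 0.
  by rewrite mem_undup mem_cat negb_or => /andP[/ps].
have qu i : i \notin undup (s ++ s') -> q i = 0.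
  by rewrite mem_undup mem_cat negb_or => /andP[_ /qs].
rewrite !(ev_laurentE _ uu)//; last by move=> i iu; rewrite fctE pu// qu// addr0.
by rewrite -big_split /=; apply: eq_bigr => i _; rewrite -mulrDr.
Qed.

Lemma ev_laurent_hom x : alg_hom (rees F) (restrict_rees (ev_laurent x)).
Proof.
apply: alg_hom_restrict.
- by rewrite ev_laurent_monomial oppr0 expr0z mul1r.
- by move=> p q [fp _] [fq _]; exact: ev_laurentD.
- move=> a p [/finite_support_enum [s [us _ ps]] _].
  rewrite !(ev_laurentE _ us)//; last by move=> i /ps pi; rewrite fctE pi scaler0.
  by rewrite mulr_sumr; apply: eq_bigr => i _; rewrite mulrCA.
move=> p q Rp Rq; have [fp Fp] := Rp; have [fq Fq] := Rq.
apply: (laurent_mul_morph (S := rees F)) => //.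
- exact: (rees0 ssA hF).
- by rewrite -(monomial0 0) ev_laurent_monomial mulr0.
- by move=> *; exact: (reesD ssA hF).
- by move=> p' q' [fp' _] [fq' _]; exact: ev_laurentD.
- by move=> i; exact: (rees_monomial ssA hF).
- by move=> i; exact: (rees_monomial ssA hF).
- by move=> i j; apply: (rees_monomial ssA hF); exact: (filtM ssA hF).
- by move=> i j; rewrite !ev_laurent_monomial opprD expfzDr// mulrACA.
Qed.

Definition dpoint x : delta F := exist _ _ (ev_laurent_hom x).

Lemma evaluation_dpoint x p : rees F p -> evaluation p (dpoint x) = ev_laurent x p.
Proof. by move=> Rp; rewrite /evaluation /= restrict_reesE. Qed.

Lemma dval_dpoint x i f : F i setT f -> dval (dpoint x) i f = t ^ (- i%:Z) * f x.
Proof.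
move=> Ff; rewrite /dval evaluation_dpoint ?ev_laurent_monomial//.
exact: (rees_monomial ssA hF).
Qed.

Lemma delta_pi_dpoint x : delta_pi (dpoint x) = t.
Proof.
rewrite /delta_pi evaluation_dpoint ?ev_laurent_monomial ?opprK ?expr1z ?mulr1//.
by apply: (rees_monomial ssA hF); exact: (F01 ssA hF).
Qed.

Lemma base_dpoint x : base (dpoint x) = x.
Proof.
apply: base_unique => f /(filtration0 ssA hF) Ff.
by rewrite dval_dpoint// oppr0 expr0z mul1r.
Qed.

End Points.

(** As [t ^+ w a] is invertible, the relation between the coordinates of the base point and the
    [y_a] leaves no choice for the latter. *)
Lemma dcoord_dpoint c w x (v : 'rV[R]_n.+1) t (t0 : t != 0) : weighted_chart A r F c w ->
  dom c x -> v ord0 ord0 = t -> coord c x = dilate w v -> dcoord c w (dpoint t0 x) = v.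
Proof.
move=> wc cx vt E; apply/rowP => i; case: (unliftP ord0 i) => [a|] ->.
  rewrite dcoordS; apply: (mulfI (expf_neq0 (w a) t0)).
  have cb : dom c (base (dpoint t0 x)) by rewrite base_dpoint.
  have := coord_base a wc cb; rewrite delta_pi_dpoint base_dpoint => <-.
  by rewrite E mxE vt.
by rewrite dcoord0 delta_pi_dpoint.
Qed.

(* The points with [t != 0] come from [dpoint]; the algebra identities needed
   for a point [v0] with [t = 0] follow from those by continuity. *)
Lemma dchart_image c w : weighted_chart A r F c w ->
  coord (dchart c w) @` dom (dchart c w) = dset c w setT.
Proof.
move=> wc; have Ac := weighted_chart_in wc; have [cc _ _] := atA.
have oD : open (dset c w setT) := open_dset Ac oT; have oc := mopen_dom atA Ac.
apply/seteqP; split=> [_ [h ch <-]|v0 v0D]; first exact/dset_dcoord.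
have key (O : set 'rV[R]_n.+1) (f g : 'rV[R]_n.+1 -> R) : open O -> O v0 ->
    {for v0, continuous f} -> {for v0, continuous g} ->
    (forall h, dom c (base h) -> O (dcoord c w h) -> f (dcoord c w h) = g (dcoord c w h)) ->
    f v0 = g v0.
  move=> oO Ov0 cf cg H; apply: (eq_at_t0 (openI oO oD) (conj Ov0 v0D)) => //.
  move=> v [Ov [x [_ cx] cE]] t0; have E := dcoord_dpoint t0 wc cx erefl cE.
  by rewrite -E; apply: H; rewrite ?base_dpoint// E.
have ex p : exists g : 'rV[R]_n.+1 -> R, rees F p -> smooth_on (dset c w setT) g /\
    forall h, dom c (base h) -> evaluation p h = g (dcoord c w h).
  have [Rp|nRp] := pselect (rees F p); last by exists (fun=> 0).
  by have [g Sg gE] := evaluation_local wc Rp; exists g.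
(* [G p] is a smooth representative of the evaluation on [p]; its values at [v0] will define the
   morphism [h0]. *)
have [G GP] := choice ex.
have GC p : rees F p -> {for v0, continuous (G p)}.
  by move=> /GP [SG _]; exact: smooth_continuous SG v0D.
have GE p h : rees F p -> dom c (base h) -> G p (dcoord c w h) = evaluation p h.
  by move=> Rp ch; have [_ ->] := GP p Rp.
have R1 : rees F (monomial 0 1).
  by apply: (rees_monomial ssA hF); exact: (F01 ssA hF).
have Rz : rees F (monomial (- 1) 1).
  by apply: (rees_monomial ssA hF); exact: (F01 ssA hF).
have hom : alg_hom (rees F) (restrict_rees (fun p => G p v0)).
  apply: alg_hom_restrict => [|p q Rp Rq|a p Rp|p q Rp Rq].
  - apply: (key _ _ (fun=> 1) oD v0D (GC _ R1)); first exact: cst_continuous.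
    by move=> h ch _; rewrite GE// /evaluation (ah_one (svalP h)).
  - have Rpq := reesD ssA hF Rp Rq.
    apply: (key _ _ (fun v => G p v + G q v) oD v0D (GC _ Rpq)).
      by apply: continuousD; exact: GC.
    by move=> h ch _; rewrite !GE// /evaluation (ah_add (svalP h)).
  - have Rap := reesZ ssA hF a Rp.
    apply: (key _ _ (fun v => a * G p v) oD v0D (GC _ Rap)).
      by apply: continuousM; [exact: cst_continuous|exact: GC].
    by move=> h ch _; rewrite !GE// /evaluation (ah_scale (svalP h)).
  - have Rpq := reesM ssA hF Rp Rq.
    apply: (key _ _ (fun v => G p v * G q v) oD v0D (GC _ Rpq)).
      by apply: continuousM; exact: GC.
    by move=> h ch _; rewrite !GE// /evaluation (ah_mul (svalP h)).
pose h0 : delta F := exist _ _ hom.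
have h0E p : rees F p -> evaluation p h0 = G p v0.
  by move=> Rp; rewrite /evaluation /= restrict_reesE.
have [x0 [_ cx0] x0E] := v0D.
have bh0 : base h0 = x0.
  apply: base_unique => f Sf.
  have Ff : F 0%N setT f by exact/(filtration0 ssA hF).
  have Rf : rees F (monomial 0 f) by exact: (rees_monomial ssA hF).
  have Sfc : msmooth A (dom c) f by apply: (msmooth_sub (@subsetT _ _) oc).
  rewrite /dval h0E// -(in_chartE f (cc _ Ac) cx0) x0E.
  apply: (key _ _ (fun v => in_chart c f (dilate w v)) oD v0D (GC _ Rf)).
    exact: smooth_continuous (smooth_in_chart_dilate wc Sfc) v0D.
  move=> h ch _; rewrite GE// dilate_dcoord// (in_chartE _ (cc _ Ac))//.
  exact: (baseE ssA hF h Ff).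
exists h0; first by rewrite /= bh0.
have cvc j : {for v0, continuous (fun v : 'rV[R]_n.+1 => v ord0 j)}.
  exact: coord_continuous.
rewrite /= -[RHS]/v0; apply/rowP => i; case: (unliftP ord0 i) => [a|] ->; last first.
  rewrite dcoord0 /delta_pi h0E//.
  apply: (key _ _ (fun v => v ord0 ord0) oD v0D (GC _ Rz) (cvc _)).
  by move=> h ch _; rewrite GE// dcoord0.
rewrite dcoordS.
have [V [oV Vx0 Vc cutV]] := cut_near ssA hF Ac cx0.
have FG := global_coord_in ssA hF a wc cx0.
have RG : rees F (monomial (w a)%:Z (global_coord (A := A) (F := F) c x0 a)).
  exact: (rees_monomial ssA hF).
rewrite /wcoord bh0 /dval h0E//.
(* The global function agrees with the [a]-th coordinate only on [V], so the comparison is made on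
   this smaller neighbourhood of [v0]. *)
have oDV : open (dset c w V) := open_dset Ac oV.
have DV0 : dset c w V v0 by exists x0.
apply: (key _ _ (fun v => v ord0 (lift ord0 a)) oDV DV0 (GC _ RG) (cvc _)).
move=> h ch /(dset_dcoord _ wc ch) Vh; rewrite GE// dcoordS.
rewrite (wcoordE (V := V) wc ch FG oV Vh Vc)// => x Vx.
by rewrite /global_coord cutV.
Qed.

End DeltaCharts.

Section DifferentialOfInverse.
Context {R : realType}.

(** For the submersion property: [G] will be the transition from a [dchart] and [g] a representative
    of [delta_pi], which is coordinate 0 of the [dchart]; the image under ['d G] of the unit vector
    in direction [t] is then sent to 1 by ['d g]. *)
Lemma diff_comp_coord m n (O : set 'rV[R]_m) (O' : set 'rV[R]_n)
    (G : 'rV[R]_m -> 'rV[R]_n) (g : 'rV[R]_n -> R) v i u : open O -> open O' ->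
  O v -> O' (G v) -> (forall j, smooth_on O (fun z => G z ord0 j)) -> smooth_on O' g ->
  (forall z, O z -> g (G z) = z ord0 i) -> 'd g (G v) ('d G v u) = u ord0 i.
Proof.
move=> oO oO' Ov O'v SG Sg gG.
have dG := Ck_rV_differentiable oO Ov (fun j => SG j 1%N).
have dg := Ck_diff oO' O'v (Sg 1%N).
have dc : differentiable (fun z : 'rV[R]_m => z ord0 i) v by exact: differentiable_coord.
rewrite -[LHS]/(('d g (G v) \o 'd G v) u) -diff_comp// -deriveE; last exact: differentiable_comp.
rewrite (near_eq_derive (g := fun z : 'rV[R]_m => z ord0 i)); last first.
  by apply: filterS (open_nbhs_nbhs (conj oO Ov)) => z /gG.
rewrite deriveE// diff_rV// (bigD1 i)//= big1 ?addr0.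
  by have [_ ->] := coord_is_derive i i v; rewrite eqxx mulr1.
by move=> j /negbTE ji; have [_ ->] := coord_is_derive j i v; rewrite ji mulr0.
Qed.

End DifferentialOfInverse.

(** * The atlas of the deformation space *)

Section DeltaManifold.
Context {R : realType} {n r : nat} {X : Type} {A : set (chart R n X)}.
Context {F : nat -> set X -> set (X -> R)} {N : set X}.
Hypothesis ssA : smooth_structure A.
Hypothesis hF : weighted_pair A r F N.
Let atA : atlas A := smooth_structure_atlas ssA.
Let wF : weighting A r F := wp_weighting hF.
Let oT := mopenT atA.
Local Notation base := (base ssA hF).
Local Notation wcoord := (wcoord ssA hF).
Local Notation dchart := (dchart ssA hF).
Local Notation dcoord := (dcoord ssA hF).

Definition delta_charts : set (chart R n.+1 (delta F)) :=
  [set e | exists c w, weighted_chart A r F c w /\ e = dchart c w].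

Definition delta_atlas := maximal_atlas delta_charts.

Lemma dchart_imageI c w (W : set X) : weighted_chart A r F c w ->
  coord (dchart c w) @` ([set h | W (base h)] `&` dom (dchart c w)) = dset c w W.
Proof.
move=> wc; apply/seteqP; split=> [_ [h [Wh ch] <-]|v vD]; first exact/dset_dcoord.
have : dset c w setT v by have [x [_ cx] xE] := vD; exists x.
rewrite -(dchart_image ssA hF wc) => -[h ch hv]; exists h => //; split=> //.
by have := proj1 (dset_dcoord W wc ch); rewrite (_ : dcoord c w h = v)//; exact.
Qed.

Lemma dchart_is_chart c w : weighted_chart A r F c w -> is_chart (dchart c w).
Proof.
move=> wc; split.
  move=> h h' /set_mem ch /set_mem ch'; exact: (dcoord_inj wc ch ch').
by rewrite dchart_image//; exact: open_dset (weighted_chart_in wc) oT.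
Qed.

Lemma in_dchart_smooth c w W f p : weighted_chart A r F c w -> mopen A W -> rees F p ->
  (forall h, dom c (base h) -> W (base h) -> f h = evaluation p h) ->
  smooth_on (dset c w W) (in_chart (dchart c w) f).
Proof.
move=> wc oW Rp fp; have [g Sg gE] := evaluation_local ssA hF wc Rp.
have WT : dset c w W `<=` dset c w setT by move=> v [x [_ cx] xE]; exists x.
apply: smooth_ext (smooth_sub WT Sg); first exact: open_dset (weighted_chart_in wc) oW.
move=> v; rewrite -dchart_imageI// => -[h [Wh ch] <-].
by rewrite in_chartE ?fp ?gE//; exact: dchart_is_chart.
Qed.

Lemma rees_z : rees F (monomial (- 1) 1).
Proof. by apply: (rees_monomial ssA hF); exact: (F01 ssA hF). Qed.

Lemma weighted_chart_at x : exists c w, dom c x /\ weighted_chart A r F c w.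
Proof. exact: wt_coordinates wF x. Qed.

(** [wcoord] is not literally an evaluation, since its cutoff moves with the base point. Near [x]
    the cutoff can be frozen at [x], which gives a single Rees element. *)
Lemma wcoord_near c w x a : weighted_chart A r F c w -> dom c x ->
  exists p V, [/\ rees F p, mopen A V, V x, V `<=` dom c &
    forall h, V (base h) -> wcoord c w h a = evaluation p h].
Proof.
move=> wc cx; have Ac := weighted_chart_in wc.
have [V [oV Vx Vc cutV]] := cut_near ssA hF Ac cx.
have FG := global_coord_in ssA hF a wc cx.
exists (monomial (w a)%:Z (global_coord (A := A) (F := F) c x a)), V; split=> //.
  exact: (rees_monomial ssA hF).
move=> h Vh; apply: (wcoordE (V := V)) => //; first exact: Vc.
by move=> y Vy; rewrite /global_coord cutV.
Qed.

Lemma dchart_transition c w c' w' : weighted_chart A r F c w ->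
  weighted_chart A r F c' w' -> transition (dchart c w) (dchart c' w').
Proof.
move=> wc wc'; have Ac := weighted_chart_in wc; have Ac' := weighted_chart_in wc'.
have oc' := mopen_dom atA Ac'.
rewrite /transition setIC (dchart_imageI (dom c') wc).
have oO : open (dset c w (dom c')) := open_dset Ac oc'.
split=> //.
exists (fun v => \row_i in_chart (dchart c w) (fun h => dcoord c' w' h ord0 i) v); split; last first.
  move=> h ch ch'; apply/rowP => i; rewrite mxE in_chartE//.
  exact: dchart_is_chart.
move=> i; under [X in smooth_on _ X]eq_fun do rewrite mxE.
apply: smooth_local => v; rewrite -dchart_imageI// => -[h [c'h ch] <-].
case: (unliftP ord0 i) => [a|] ->; last first.
  exists (dset c w (dom c')); first exact/dset_dcoord.
  apply: (in_dchart_smooth wc oc' rees_z) => h' _ _; exact: dcoord0.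
have [p [V [Rp oV Vh Vc VE]]] := wcoord_near a wc' c'h.
exists (dset c w V); first exact/dset_dcoord.
by apply: (in_dchart_smooth wc oV Rp) => h' _ Vh'; rewrite dcoordS VE.
Qed.

Lemma delta_charts_atlas : atlas delta_charts.
Proof.
split.
- by move=> _ [c [w [wc ->]]]; exact: dchart_is_chart.
- by move=> _ _ [c [w [wc ->]]] [c' [w' [wc' ->]]]; split; exact: dchart_transition.
- move=> h; have [c [w [ch wc]]] := weighted_chart_at (base h).
  by exists (dchart c w) => //; exists c, w.
Qed.

Lemma delta_atlas_atlas : atlas delta_atlas.
Proof. exact: maximal_atlas_atlas delta_charts_atlas. Qed.

Lemma dchart_in_atlas c w : weighted_chart A r F c w -> delta_atlas (dchart c w).
Proof. by move=> wc; apply: (sub_maximal_atlas delta_charts_atlas); exists c, w. Qed.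

Lemma evaluation_smooth p : rees F p -> msmooth delta_atlas setT (evaluation (F := F) p).
Proof.
move=> Rp; apply: (msmooth_super delta_charts_atlas delta_atlas_atlas).
- exact: sub_maximal_atlas delta_charts_atlas.
- exact: mopenT delta_charts_atlas.
move=> _ [c [w [wc ->]]]; have [g Sg gE] := evaluation_local ssA hF wc Rp.
exists g; last by move=> h _ ch; exact: gE.
by rewrite setTI dchart_image.
Qed.

Lemma smooth_into_delta m (Y : Type) (B : set (chart R m Y)) (O : set Y) (phi : Y -> delta F) :
  atlas B -> mopen B O ->
  (forall p, rees F p -> msmooth B O (fun y => evaluation p (phi y))) ->
  smooth_map B delta_atlas O phi.
Proof.
move=> atB oO Sphi; apply: (smooth_mapP atB delta_atlas_atlas) => y0 Oy0.
have [c [w [cx wc]]] := weighted_chart_at (base (phi y0)).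
have Ac := weighted_chart_in wc; have oc := mopen_dom atA Ac.
(* Continuity of the base point along [phi] is not given. It follows from the evaluation on a bump
   function supported in [W]: where this is nonzero, the base point lies in [W]. *)
have inv W : mopen A W -> W (base (phi y0)) -> exists Q, [/\ mopen B Q, Q y0, Q `<=` O &
    forall y, Q y -> W (base (phi y))].
  move=> oW Wy0; have [chi [Schi [V [_ Vx _ chi1]] [Z [_ ZV chi0]]]] := bump_function ssA oW Wy0.
  have Fchi : F 0%N setT chi by exact/(filtration0 ssA hF).
  have Rchi : rees F (monomial 0 chi) by exact: (rees_monomial ssA hF).
  have chiE h : evaluation (monomial 0 chi) h = chi (base h) by exact: (baseE ssA hF h Fchi).
  exists (O `&` (fun y => evaluation (monomial 0 chi) (phi y)) @^-1` [set t | t != 0]); split.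
  - exact: (mopen_preimage atB oO (@open_neq _ _) (Sphi _ Rchi)).
  - by split=> //=; rewrite chiE chi1// oner_eq0.
  - by move=> y [].
  - move=> y [_ /=]; rewrite chiE => chiy.
    have : (Z `|` W) (base (phi y)) by rewrite ZV.
    by case=> // /chi0 E; rewrite E eqxx in chiy.
have near_a a : exists Q, [/\ mopen B Q, Q y0, Q `<=` O &
    msmooth B Q (fun y => wcoord c w (phi y) a)].
  have [p [V [Rp oV Vx Vc VE]]] := wcoord_near a wc cx.
  have [Q [oQ Qy0 QO QV]] := inv V oV Vx; exists Q; split=> //.
  apply: (msmooth_ext (f := fun y => evaluation p (phi y))).
    by move=> y Qy; rewrite VE//; exact: QV.
  by apply: (msmooth_sub QO oQ); exact: Sphi.
have [Qa QaP] := choice near_a.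
have [Q0 [oQ0 Q0y0 Q0O Q0c]] := inv _ oc cx.
pose Q := Q0 `&` [set y | forall a, a \in enum 'I_n -> Qa a y].
have oQ : mopen B Q.
  apply: mopenI => //; elim: (enum 'I_n) => [|a l IH].
    rewrite (_ : mkset _ = setT); first exact: mopenT.
    by apply/seteqP; split.
  rewrite (_ : mkset _ = Qa a `&` [set x | forall i, i \in l -> Qa i x]).
    by apply: mopenI => //; have [] := QaP a.
  apply/seteqP; split=> x /= Hx.
    by split=> [|j js]; apply: Hx; rewrite ?mem_head// in_cons js orbT.
  by case: Hx => Fi Fs j; rewrite in_cons => /orP[/eqP->//|]; exact: Fs.
exists Q, (dchart c w); split=> //.
- by split=> // a _; have [] := QaP a.
- by move=> y [Q0y _]; exact: Q0O.
- exact: dchart_in_atlas.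
split; first by move=> y [Q0y _]; exact: Q0c.
move=> i; case: (unliftP ord0 i) => [a|] ->.
  apply: (msmooth_ext (f := fun y => wcoord c w (phi y) a)).
    by move=> y _; rewrite -[RHS]/(dcoord c w (phi y) ord0 (lift ord0 a)) dcoordS.
  have [_ _ _ Sa] := QaP a; apply: msmooth_sub Sa => // y [_]; apply.
  by rewrite mem_enum.
apply: (msmooth_ext (f := fun y => evaluation (monomial (- 1) 1) (phi y))).
  by move=> y _; rewrite -[RHS]/(dcoord c w (phi y) ord0 ord0) dcoord0.
by apply: (msmooth_sub _ oQ (Sphi _ rees_z)) => y [Q0y _]; exact: Q0O.
Qed.

(** Distinct morphisms differ on some Rees element, and the smooth evaluation on it separates them.
    Countability comes from [lindelof] on [X]: countably many weighted charts cover [X], and their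
    [dchart]s cover the deformation space. *)
Lemma delta_smooth_structure : smooth_structure delta_atlas.
Proof.
have atD := delta_atlas_atlas; have [_ _ cov] := atD; split=> //.
- exact: maximal_atlas_idem delta_charts_atlas.
- move=> h h' hh'.
  have [p [Rp pE]] : exists p, rees F p /\ evaluation p h != evaluation p h'.
    apply: contrapT => H; apply: hh'; apply: delta_ext => p Rp.
    by apply: contrapT => /eqP pE; apply: H; exists p.
  have Sp := evaluation_smooth Rp; have oTD := mopenT atD.
  wlog lt : h h' {hh' pE} / evaluation p h < evaluation p h'.
    move=> H; case: (ltgtP (evaluation p h) (evaluation p h')) pE => // [lt _|lt _].
      exact: H.
    have [Q1 [Q2 [? ? ? ? E]]] := H _ _ lt; exists Q2, Q1; split=> //.
    by rewrite setIC.
  pose m := (evaluation p h + evaluation p h') / 2.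
  exists (setT `&` evaluation p @^-1` [set t | t < m]), (setT `&` evaluation p @^-1` [set t | m < t]); split.
  + exact: (mopen_preimage atD oTD (@open_lt _ _) Sp).
  + exact: (mopen_preimage atD oTD (@open_gt _ _) Sp).
  + by split=> //=; rewrite /m; lra.
  + by split=> //=; rewrite /m; lra.
  + by apply/seteqP; split=> // k [[_ /= k1] [_ /= k2]]; have := lt_trans k1 k2; rewrite ltxx.
have [cw cwP] := choice weighted_chart_at.
have HW x : mopen A (dom (cw x)) /\ dom (cw x) x.
  have [w [cx wc]] := cwP x; split=> //.
  by apply: mopen_dom => //; exact: weighted_chart_in wc.
have [s scov] := lindelof ssA HW.
have [ww wwP] := choice cwP.
apply: (countable_charts_second_countable (s := fun k => omap (fun x => dchart (cw x) (ww x)) (s k)) atD).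
  move=> k c; case: (s k) => //= x [<-]; apply: dchart_in_atlas.
  by have [] := wwP x.
move=> h; have [k [x [sk cx]]] := scov (base h).
by exists k, (dchart (cw x) (ww x)); rewrite sk.
Qed.

Lemma delta_pi_surjective : N !=set0 -> range (delta_pi (F := F)) = setT.
Proof.
move=> [x Nx]; apply/seteqP; split=> // t _.
have [t0|t0] := eqVneq t 0; last first.
  by exists (dpoint ssA hF t0 x) => //; exact: delta_pi_dpoint.
have [c [w [cx wc]]] := weighted_chart_at x.
(* At [t = 0] the entries of positive weight are arbitrary, since both sides of the base point
   relation vanish on [N]. Those of weight 0 must be the coordinates of [x], because
   [0 ^+ 0 = 1]. *)
pose v : 'rV[R]_n.+1 := \row_i if unlift ord0 i is Some a then coord c x ord0 a else 0.
have : dset c w setT v.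
  exists x => //; apply/rowP => a; rewrite !mxE liftK unlift_none.
  have [w0|w0] := posnP (w a); first by rewrite w0 expr0 mul1r.
  by rewrite (proj1 (weighted_chart_N ssA hF wc cx) Nx a w0) mulr0.
rewrite -(dchart_image ssA hF wc) => -[h ch hv]; exists h => //.
by rewrite t0 -(dcoord0 ssA hF c w h) (_ : dcoord c w h = v)// mxE unlift_none.
Qed.

Lemma delta_pi_submersion : submersion delta_atlas (delta_pi (F := F)).
Proof.
have atD := delta_atlas_atlas; have [ccD coD _] := atD.
have Spi := evaluation_smooth rees_z.
split=> // d h g Dd dh gE v.
have [c [w [ch wc]]] := weighted_chart_at (base h); have De := dchart_in_atlas wc.
have [[oO [G [SG GE]]] _] := coD _ _ De Dd; set O := _ @` _ in oO SG.
have [_ od] := ccD d Dd.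
have Sg : smooth_on (coord d @` dom d) g.
  apply: (smooth_ext (f := in_chart d (delta_pi (F := F))) od).
    by move=> _ [y dy <-]; rewrite in_chartE ?gE//; exact: ccD.
  have := msmooth_chart atD (mopenT atD) Dd Spi; rewrite setTI; exact.
pose v0 := dcoord c w h.
have Gv0 : G v0 = coord d h by rewrite -GE.
have E := @diff_comp_coord R _ _ O (coord d @` dom d) G g v0 ord0 (delta_mx ord0 ord0) oO od.
exists (v *: 'd G v0 (delta_mx ord0 ord0)); rewrite linearZ /= -Gv0 E ?mxE ?eqxx ?mulr1//.
- by rewrite [LHS]mulr1.
- by exists h.
- by rewrite Gv0; exists h.
- by move=> _ [y [cy dy] <-]; rewrite -GE// -gE// -[RHS]/(dcoord c w y ord0 ord0) dcoord0.
Qed.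

Lemma base_smooth : smooth_map delta_atlas A setT base.
Proof.
have atD := delta_atlas_atlas.
apply: (smooth_mapP atD atA) => h _.
have [c [w [ch wc]]] := weighted_chart_at (base h); have De := dchart_in_atlas wc.
have Ac := weighted_chart_in wc.
exists (dom (dchart c w)), c; split=> //; first exact: mopen_dom.
split=> // a; apply: (msmooth_ext (f := fun h => dilate w (coord (dchart c w) h) ord0 a)).
  by move=> h' ch'; rewrite [coord _ _]/= dilate_dcoord.
apply: (msmooth_comp (O := setT) (f := fun v => dilate w v ord0 a) (G := coord (dchart c w))) => //.
- exact: mopen_dom.
- exact: openT.
- by apply: smooth_dilate; exact: openT.
- by move=> j; exact: msmooth_chart_coord.
Qed.

Lemma dpoint_base (t : R) (t0 : t != 0) h : delta_pi h = t -> dpoint ssA hF t0 (base h) = h.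
Proof.
move=> ht; have [c [w [ch wc]]] := weighted_chart_at (base h).
have cb : dom c (base (dpoint ssA hF t0 (base h))) by rewrite base_dpoint.
apply: (dcoord_inj wc cb ch).
have E0 : dcoord c w h ord0 ord0 = t by rewrite dcoord0.
have E1 : coord c (base h) = dilate w (dcoord c w h) by rewrite dilate_dcoord.
exact: (dcoord_dpoint ssA hF t0 wc ch E0 E1).
Qed.

Lemma delta_fiber_diffeo (t : R) : t != 0 -> fiber_diffeo A delta_atlas t.
Proof.
move=> t0; exists (dpoint ssA hF t0); split.
  by move=> x p Rp; exact: evaluation_dpoint.
split.
- apply: (smooth_into_delta atA oT) => p Rp.
  have [fp Fp] := Rp; have [s [us _ ps]] := finite_support_enum fp.
  apply: (msmooth_ext (f := fun x => \sum_(i <- s) t ^ (- i) * p i x)).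
    by move=> x _; rewrite evaluation_dpoint// (ev_laurentE _ _ us).
  apply: (msmooth_sum (F := fun i x => t ^ (- i) * p i x) _ oT) => i _.
  apply: (msmoothM oT); first exact: msmooth_cst.
  by apply: (filtration_smooth hF oT (i := posz i)); rewrite -filtE.
- apply/seteqP; split=> [_ [x _ <-]|h /= ht]; first exact: delta_pi_dpoint.
  by exists (base h) => //; exact: dpoint_base.
- move=> x; exists setT, base; split=> //.
  + exact: mopenT delta_atlas_atlas.
  + exact: base_smooth.
  + by move=> y _; exact: base_dpoint.
Qed.

End DeltaManifold.

(** * The zero fiber *)

Section ZeroSlice.
Context {R : realType} {n : nat}.

Definition zero_slice (y : 'rV[R]_n) : 'rV[R]_n.+1 :=
  \row_i if unlift ord0 i is Some a then y ord0 a else 0.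

Definition drop0 (v : 'rV[R]_n.+1) : 'rV[R]_n := \row_a v ord0 (lift ord0 a).

Lemma zero_slice0 y : zero_slice y ord0 ord0 = 0.
Proof. by rewrite mxE unlift_none. Qed.

Lemma zero_sliceS y a : zero_slice y ord0 (lift ord0 a) = y ord0 a.
Proof. by rewrite mxE liftK. Qed.

Lemma zero_sliceK : cancel zero_slice drop0.
Proof. by move=> y; apply/rowP => a; rewrite mxE zero_sliceS. Qed.

Lemma drop0K (v : 'rV[R]_n.+1) : v ord0 ord0 = 0 -> zero_slice (drop0 v) = v.
Proof.
move=> v0; apply/rowP => i; case: (unliftP ord0 i) => [a|] ->.
  by rewrite zero_sliceS mxE.
by rewrite zero_slice0 v0.
Qed.

Lemma smooth_zero_slice (O : set 'rV[R]_n) i :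
  smooth_on O (fun y => zero_slice y ord0 i).
Proof.
case: (unliftP ord0 i) => [a|] ->.
  by under [X in smooth_on _ X]eq_fun do rewrite zero_sliceS; exact: smooth_coord.
by under [X in smooth_on _ X]eq_fun do rewrite zero_slice0; exact: smooth_cst.
Qed.

Lemma smooth_drop0 (O : set 'rV[R]_n.+1) a : smooth_on O (fun v => drop0 v ord0 a).
Proof. by under [X in smooth_on _ X]eq_fun do rewrite mxE; exact: smooth_coord. Qed.

Lemma open_zero_slice_preimage (O : set 'rV[R]_n.+1) : open O -> open (zero_slice @^-1` O).
Proof.
move=> oO; rewrite -[X in open X]setTI.
by apply: open_smooth_preimage => //; [exact: openT|move=> a; exact: smooth_zero_slice].
Qed.

Lemma open_drop0_preimage (O : set 'rV[R]_n) : open O -> open (drop0 @^-1` O).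
Proof.
move=> oO; rewrite -[X in open X]setTI.
by apply: open_smooth_preimage => //; [exact: openT|move=> a; exact: smooth_drop0].
Qed.

End ZeroSlice.

Section GradedPart.
Context {R : realType} {X : Type}.
Implicit Types (p q : laurent R X) (f : X -> R).

Lemma gr_partD p q : gr_part (p + q) = gr_part p + gr_part q.
Proof.
apply/funext => i; rewrite -[RHS]/(gr_part p i + gr_part q i) /gr_part.
by case: ifP => // _; rewrite addr0.
Qed.

Lemma gr_partZ (a : R) p : gr_part (a *: p) = a *: gr_part p.
Proof.
apply/funext => i; rewrite -[RHS]/(a *: gr_part p i) /gr_part.
by case: ifP => // _; rewrite scaler0.
Qed.

Lemma gr_part_monomial (k : nat) f : gr_part (monomial k%:Z f) = monomial k%:Z f.
Proof. by apply/funext => -[i|i]; rewrite /gr_part. Qed.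

Lemma gr_part_monomial_neg (k : nat) f : gr_part (monomial (Negz k) f) = 0.
Proof.
apply/funext => i; rewrite /gr_part /monomial; case: ifP => // i0.
by case: eqP => // E; rewrite E in i0.
Qed.

Lemma gr_part_monomial_lt0 (i : int) f : i < 0 -> gr_part (monomial i f) = 0.
Proof. by case: i => // k _; exact: gr_part_monomial_neg. Qed.

Lemma gr_part_id p : (forall k, p (Negz k) = 0) -> gr_part p = p.
Proof. by move=> H; apply/funext => -[i|i]; rewrite /gr_part//= H. Qed.

End GradedPart.

(** * The weighted normal bundle as the fiber over 0 *)

Section NormalBundle.
Context {R : realType} {n r : nat} {X : Type} {A : set (chart R n X)}.
Context {F : nat -> set X -> set (X -> R)} {N : set X}.
Hypothesis ssA : smooth_structure A.
Hypothesis hF : weighted_pair A r F N.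
Let atA : atlas A := smooth_structure_atlas ssA.
Let wF : weighting A r F := wp_weighting hF.
Let oT := mopenT atA.
Local Notation base := (base ssA hF).
Local Notation wcoord := (wcoord ssA hF).
Local Notation dchart := (dchart ssA hF).
Local Notation dcoord := (dcoord ssA hF).
Local Notation restrict_rees := (restrict_rees (F := F)).

Lemma gr_num_gr_part p : rees F p -> gr_num F (gr_part p).
Proof.
move=> [fp Fp]; split=> [|k]; last by rewrite /gr_part.
have [s [us _ ps]] := finite_support_enum fp; split.
  by apply: (finite_support_seq (s := s)) => i /ps pi; rewrite /gr_part pi; case: ifP.
move=> i; rewrite /gr_part; case: ifP => // _.
by rewrite filtE; exact: wt_ideal0 wF _ _ oT.
Qed.

Lemma rees_additive_eq (h1 h2 : laurent R X -> R) p : h1 0 = 0 -> h2 0 = 0 ->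
  (forall p q, rees F p -> rees F q -> h1 (p + q) = h1 p + h1 q) ->
  (forall p q, rees F p -> rees F q -> h2 (p + q) = h2 p + h2 q) ->
  (forall i, h1 (monomial i (p i)) = h2 (monomial i (p i))) ->
  rees F p -> h1 p = h2 p.
Proof.
move=> h10 h20 h1D h2D E Rp; have [s pE Rs] := rees_decomp ssA hF Rp.
rewrite pE; elim: s {pE} => [|i s IH]; first by rewrite big_nil h10 h20.
have Rsum := rees_sum ssA hF s Rs.
by rewrite big_cons h1D// h2D// E IH.
Qed.

Lemma nu_hom0 (h : nu F) : sval h 0 = 0.
Proof.
have [[_ _ hZ _ _] _] := svalP h.
rewrite -[X in sval h X](scale0r (0 : laurent R X)) hZ ?mul0r//.
by split=> //; exact: (rees0 ssA hF).
Qed.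

(** [gr_part] itself is not multiplicative: if one of the degrees [i], [j] is negative, it kills a
    factor but possibly not the product. In that case [f * g] has filtration degree greater than
    [i + j], so the product lies in [gr_den] and [h] kills it. *)
Lemma nu_rees_hom (h : nu F) :
  alg_hom (rees F) (restrict_rees (fun p => sval h (gr_part p))).
Proof.
have [[h1 hD hZ hM hO] hden] := svalP h; apply: (alg_hom_restrict ssA hF).
- by rewrite (gr_part_monomial 0).
- by move=> p q Rp Rq; rewrite gr_partD hD//; exact: gr_num_gr_part.
- by move=> a p Rp; rewrite gr_partZ hZ//; exact: gr_num_gr_part.
move=> p q [fp Fp] [fq Fq].
apply: (laurent_mul_morph (S := rees F) (h := fun p => sval h (gr_part p))) => //.
- exact: (rees0 ssA hF).
- by rewrite gr_part_id// nu_hom0.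
- by move=> *; exact: (reesD ssA hF).
- by move=> p' q' Rp Rq; rewrite gr_partD hD//; exact: gr_num_gr_part.
- by move=> i; exact: (rees_monomial ssA hF).
- by move=> i; exact: (rees_monomial ssA hF).
- by move=> i j; apply: (rees_monomial ssA hF); exact: (filtM ssA hF).
move=> i j; move: (p i) (q j) (Fp i) (Fq j) => f g Ff Fg.
have Rf := rees_monomial ssA hF Ff; have Rg := rees_monomial ssA hF Fg.
have Ffg := filtM ssA hF Ff Fg; have Rfg := rees_monomial ssA hF Ffg.
have den (k : nat) f' : F k.+1 setT f' -> sval h (monomial k%:Z f') = 0.
  move=> Ff'; apply: hden; split; last first.
    move=> l; rewrite /monomial; case: eqP => [[->]//|_].
    exact: wt_ideal0 wF _ _ oT.
  split; last by move=> l.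
  by apply: (rees_monomial ssA hF); exact: wt_decr wF _ _ oT _ Ff'.
have zero : (i < 0) || (j < 0) -> sval h (gr_part (monomial (i + j) (f * g))) = 0.
  move=> ij; case E : (i + j) => [k|k]; last by rewrite gr_part_monomial_neg nu_hom0.
  rewrite gr_part_monomial; apply: den.
  have := filtrationM ssA hF (i := posz i) (j := posz j) (f := f) (g := g).
  rewrite -!filtE => /(_ Ff Fg); apply: (filtration_mono hF oT).
  by move: E ij; case: (i) => ?; case: (j) => ?; rewrite /=; lia.
have [/[dup] /orP[i0|j0] ij|] := boolP ((i < 0) || (j < 0)).
- by rewrite zero// gr_part_monomial_lt0// nu_hom0 mul0r.
- by rewrite zero// (gr_part_monomial_lt0 _ j0) nu_hom0 mulr0.
move=> {zero den Ffg Rfg}; case: i j Ff Fg Rf Rg => [k|k] [l|l] // Ff Fg Rf Rg _.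
rewrite -PoszD !gr_part_monomial -hM.
- by rewrite monomial_mul.
- by rewrite -(gr_part_monomial k); exact: gr_num_gr_part.
- by rewrite -(gr_part_monomial l); exact: gr_num_gr_part.
Qed.

Definition nu_delta (h : nu F) : delta F := exist _ _ (nu_rees_hom h).

Lemma evaluation_nu_delta h p : rees F p -> evaluation p (nu_delta h) = sval h (gr_part p).
Proof. by move=> Rp; rewrite /evaluation /= restrict_reesE. Qed.

Lemma dval_nu_delta h i f : F i setT f -> dval (nu_delta h) i f = symb i f h.
Proof.
move=> Ff; rewrite /dval evaluation_nu_delta ?gr_part_monomial//.
exact: (rees_monomial ssA hF).
Qed.

Lemma delta_pi_nu_delta h : delta_pi (nu_delta h) = 0.
Proof.
by rewrite /delta_pi evaluation_nu_delta ?(gr_part_monomial_neg 0) ?nu_hom0//; exact: (rees_z ssA hF).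
Qed.

Lemma nu_delta_inj : injective nu_delta.
Proof.
move=> h h' E; have Eh : sval h = sval h'.
  apply/funext => p; have [Gp|nGp] := pselect (gr_num F p).
    have [Rp pN] := Gp; have := evaluation_nu_delta h Rp.
    by rewrite E evaluation_nu_delta// gr_part_id.
  have [[_ _ _ _ hO] _] := svalP h; have [[_ _ _ _ hO'] _] := svalP h'.
  by rewrite hO// hO'.
case: h h' Eh {E} => [h Ph] [h' Ph'] /= Eh; subst h'.
by congr exist; exact: Prop_irrelevance.
Qed.

(** When [h] kills [z], it kills every multiple of [z]. Among these are the elements of negative
    degree and, by [dval_shift] with [m = 1], the homogeneous parts of elements of [gr_den]; so [h]
    comes from its restriction to [gr_num]. *)
Lemma nu_delta_surj (h : delta F) : delta_pi h = 0 -> exists h', nu_delta h' = h.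
Proof.
move=> h0; have [h1 hD hZ hM _] := svalP h.
pose k p := if pselect (gr_num F p) is left _ then sval h p else 0.
have kE p : gr_num F p -> k p = sval h p by rewrite /k; case: pselect.
have gD p q : gr_num F p -> gr_num F q -> gr_num F (p + q).
  move=> [Rp p0] [Rq q0]; split; first exact: (reesD ssA hF).
  by move=> l; rewrite fctE p0 q0 addr0.
have gZ a p : gr_num F p -> gr_num F (a *: p).
  move=> [Rp p0]; split; first exact: (reesZ ssA hF).
  by move=> l; rewrite fctE p0 scaler0.
have gM p q : gr_num F p -> gr_num F q -> gr_num F (laurent_mul p q).
  move=> [Rp p0] [Rq q0]; split; first exact: (reesM ssA hF).
  move=> l; rewrite /laurent_mul fsbig1// => -[i|i] _; last by rewrite p0 mul0r.
  by rewrite (_ : Negz l - i%:Z = Negz (l + i)) ?q0 ?mulr0//; lia.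
have g1 : gr_num F (monomial 0 1).
  by split=> //; apply: (rees_monomial ssA hF); exact: (F01 ssA hF).
have homk : alg_hom (gr_num F) k.
  split.
  - by rewrite kE.
  - by move=> p q gp gq; rewrite !kE ?hD//; [case: gp|case: gq|exact: gD].
  - by move=> a p gp; rewrite !kE ?hZ//; [case: gp|exact: gZ].
  - by move=> p q gp gq; rewrite !kE ?hM//; [case: gp|case: gq|exact: gM].
  - by move=> p np; rewrite /k; case: pselect.
have ev0 : sval h 0 = 0 by rewrite -(monomial0 0); exact: (dval0 ssA hF h 0).
have kden p : gr_den F p -> k p = 0.
  move=> [gp Fp]; rewrite kE//; have [Rp p0] := gp.
  apply: (rees_additive_eq (h2 := fun=> 0)) => //; first by move=> *; rewrite addr0.
  move=> [i|i]; last by rewrite p0 monomial0.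
  rewrite -[LHS]/(dval h i (p i)) (dval_shift ssA hF h (m := 1)) ?h0 ?mul0r//.
  by rewrite addn1.
pose h' : nu F := exist _ k (conj homk kden); exists h'.
apply: delta_ext => p Rp; rewrite evaluation_nu_delta//= kE; last exact: gr_num_gr_part.
apply: (rees_additive_eq (h1 := fun p => sval h (gr_part p))) => //.
- by rewrite gr_part_id.
- move=> p' q' Rp' Rq'; rewrite gr_partD hD//.
    by have [] := gr_num_gr_part Rp'.
  by have [] := gr_num_gr_part Rq'.
move=> [i|i]; first by rewrite gr_part_monomial.
rewrite gr_part_monomial_neg ev0; apply/esym.
have := evaluation_zX ssA hF h i.+1 (f := p (Negz i)).
rewrite -NegzE /evaluation => ->; first by rewrite h0 exprS mul0r mul0r.
by have [_ /(_ (Negz i))] := Rp.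
Qed.

Lemma over_base h x : over h x <-> base (nu_delta h) = x.
Proof.
split=> [H|<- f Ff]; last by rewrite -dval_nu_delta// (baseE ssA hF).
by apply: base_unique => f /(filtration0 ssA hF) Ff; rewrite dval_nu_delta// H.
Qed.

Definition nu_chart c w : chart R n (nu F) :=
  Chart [set h | dom c (base (nu_delta h))] (fun h => drop0 (dcoord c w (nu_delta h))).

Lemma dcoord_nu_delta c w h :
  zero_slice (drop0 (dcoord c w (nu_delta h))) = dcoord c w (nu_delta h).
Proof. by rewrite drop0K// dcoord0 delta_pi_nu_delta. Qed.

(** A member of [nu_charts] is prescribed only on its domain, through germs of global functions. On
    that domain it agrees with the explicit [nu_chart], the slice [t = 0] of a [dchart]. *)
Lemma nu_chartsP e : nu_charts A r F N e -> exists c w, [/\ weighted_chart A r F c w,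
  dom e = dom (nu_chart c w) & forall h, dom e h -> coord e h = coord (nu_chart c w) h].
Proof.
move=> [c [w [wc de ce]]]; exists c, w.
have dE : dom e = dom (nu_chart c w).
  rewrite de; apply/seteqP; split=> h /=.
    by move=> [x [cx _ /over_base ->]].
  move=> ch; exists (base (nu_delta h)); split=> //; last exact/over_base.
  by apply: base_N; exact: delta_pi_nu_delta.
split=> // h; rewrite dE /= => ch; apply/rowP => a; rewrite mxE dcoordS.
have Ac := weighted_chart_in wc.
have [V [oV Vx Vc cutV]] := cut_near ssA hF Ac ch.
have FG := global_coord_in ssA hF a wc ch.
rewrite (ce h (base (nu_delta h)) a _ _ _ _ FG)//.
- by rewrite -dval_nu_delta.
- by apply: base_N; exact: delta_pi_nu_delta.
- exact/over_base.
- by exists V; split=> // y Vy; rewrite /global_coord cutV.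
Qed.

Lemma nu_chart_in c w : weighted_chart A r F c w -> nu_charts A r F N (nu_chart c w).
Proof.
move=> wc; exists c, w; split=> //.
  apply/seteqP; split=> h /=.
    move=> ch; exists (base (nu_delta h)); split=> //; last exact/over_base.
    by apply: base_N; exact: delta_pi_nu_delta.
  by move=> [x [cx _ /over_base ->]].
move=> h x a g cx _ /over_base hx Fg [V [oV Vx Vc gV]].
rewrite -dval_nu_delta//= mxE dcoordS.
by apply: (wcoordE (V := V)) => //; rewrite hx.
Qed.

Lemma nu_chart_imageI c w (W : set X) : weighted_chart A r F c w ->
  coord (nu_chart c w) @` ([set h | W (base (nu_delta h))] `&` dom (nu_chart c w)) =
  zero_slice @^-1` dset c w W.
Proof.
move=> wc; apply/seteqP; split=> [_ [h [Wh ch] <-]|y].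
  by rewrite /= dcoord_nu_delta; exact/dset_dcoord.
rewrite /= -(dchart_imageI ssA hF W wc) => -[h [Wh ch] hy].
have h0 : delta_pi h = 0.
  rewrite -(dcoord0 ssA hF c w h).
  by rewrite (_ : dcoord c w h = zero_slice y)// zero_slice0.
have [h' h'E] := nu_delta_surj h0; exists h'; first by split; rewrite /= h'E.
by rewrite /= h'E (_ : dcoord c w h = zero_slice y)// zero_sliceK.
Qed.

Lemma nu_chart_inj c w h h' : weighted_chart A r F c w ->
  dom (nu_chart c w) h -> dom (nu_chart c w) h' ->
  coord (nu_chart c w) h = coord (nu_chart c w) h' -> h = h'.
Proof.
move=> wc ch ch' E; apply: nu_delta_inj; apply: (dcoord_inj wc ch ch').
by rewrite -dcoord_nu_delta -[in RHS]dcoord_nu_delta; congr zero_slice.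
Qed.

Lemma nu_charts_image e c w (W : set X) : dom e = dom (nu_chart c w) ->
  (forall h, dom e h -> coord e h = coord (nu_chart c w) h) ->
  coord e @` ([set h | W (base (nu_delta h))] `&` dom e) =
  coord (nu_chart c w) @` ([set h | W (base (nu_delta h))] `&` dom (nu_chart c w)).
Proof.
move=> de ce; rewrite -de; apply/seteqP; split=> _ [h [Wh ch] <-];
  by exists h; rewrite ?ce.
Qed.

Lemma nu_charts_atlas : atlas (nu_charts A r F N).
Proof.
split.
- move=> e /nu_chartsP [c [w [wc de ce]]]; split.
    move=> h h' /set_mem eh /set_mem eh'; rewrite ce// ce//; move: eh eh'; rewrite de => eh eh'.
    exact: (nu_chart_inj wc eh eh').
  rewrite -[dom e]setTI.
  rewrite (nu_charts_image setT de ce) nu_chart_imageI//.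
  by apply: open_zero_slice_preimage; exact: open_dset (weighted_chart_in wc) oT.
- suff H e e' : nu_charts A r F N e -> nu_charts A r F N e' -> transition e e'.
    by move=> e e' He He'; split; exact: H.
  move=> /nu_chartsP [c [w [wc de ce]]] /nu_chartsP [c' [w' [wc' de' ce']]].
  have oc' := mopen_dom atA (weighted_chart_in wc').
  rewrite /transition setIC de' (nu_charts_image (dom c') de ce) nu_chart_imageI//.
  have oO := open_zero_slice_preimage (open_dset (w := w) (weighted_chart_in wc) oc').
  split=> //.
  have [oD [G [SG GE]]] := dchart_transition ssA hF wc wc'.
  rewrite setIC (dchart_imageI ssA hF (dom c') wc) in oD SG.
  exists (fun y => drop0 (G (zero_slice y))); split.
    move=> a; apply: (smooth_comp (O' := setT) (f := fun v => drop0 v ord0 a) (G := fun y => G (zero_slice y))) => //.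
    + exact: openT.
    + exact: smooth_drop0.
    move=> j; apply: (smooth_comp (O' := dset c w (dom c')) (f := fun v => G v ord0 j)) => //.
    by move=> i; exact: smooth_zero_slice.
  move=> h eh eh'; rewrite ce' ?de'// ce//= dcoord_nu_delta -(GE (nu_delta h))//.
  by rewrite de in eh.
- move=> h; have [c [w [cx wc]]] := weighted_chart_at hF (base (nu_delta h)).
  by exists (nu_chart c w) => //; exact: nu_chart_in.
Qed.

Lemma nu_atlas_atlas : atlas (nu_atlas A r F N).
Proof. exact: maximal_atlas_atlas nu_charts_atlas. Qed.

Lemma nu_delta_smooth : smooth_map (nu_atlas A r F N) (delta_atlas ssA hF) setT nu_delta.
Proof.
apply: (smooth_into_delta nu_atlas_atlas); first exact: mopenT nu_atlas_atlas.
move=> p Rp; apply: (msmooth_super nu_charts_atlas nu_atlas_atlas).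
- exact: sub_maximal_atlas nu_charts_atlas.
- exact: mopenT nu_charts_atlas.
move=> e /nu_chartsP [c [w [wc de ce]]].
have [g Sg gE] := evaluation_local ssA hF wc Rp.
exists (fun y => g (zero_slice y)); last first.
  move=> h _ eh; rewrite ce// -[coord _ h]/(drop0 (dcoord c w (nu_delta h))) dcoord_nu_delta gE//.
  by rewrite de in eh.
have oD : open (dset c w setT) := open_dset (weighted_chart_in wc) oT.
rewrite (nu_charts_image setT de ce) nu_chart_imageI//.
apply: (smooth_comp (O' := dset c w setT)) => //.
  exact: open_zero_slice_preimage.
by move=> j; exact: smooth_zero_slice.
Qed.

(** In the charts, the local left inverse of [nu_delta] is the projection from [(t, y)] to [y]. *)
Lemma nu_delta_retraction h : exists (O : set (delta F)) (k : delta F -> nu F),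
  [/\ mopen (delta_atlas ssA hF) O, O (nu_delta h),
      smooth_map (delta_atlas ssA hF) (nu_atlas A r F N) O k &
      forall h', O (nu_delta h') -> k (nu_delta h') = h'].
Proof.
have atD := delta_atlas_atlas ssA hF.
have [c [w [ch wc]]] := weighted_chart_at hF (base (nu_delta h)).
have Ac := weighted_chart_in wc; have De := dchart_in_atlas ssA hF wc.
have oD : open (dset c w setT) := open_dset Ac oT.
(* These are the [(t, y)] for which [(0, y)] too belongs to the image of the chart, so that [y] is
   the coordinate of a point of the normal bundle. *)
pose V : set 'rV[R]_n.+1 := drop0 @^-1` (zero_slice @^-1` dset c w setT).
have oV : open V by apply: open_drop0_preimage; exact: open_zero_slice_preimage.
pose O := dom (dchart c w) `&` coord (dchart c w) @^-1` V.
pose P h1 h2 := dom (nu_chart c w) h2 /\ coord (nu_chart c w) h2 = drop0 (dcoord c w h1).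
pose k h1 := if pselect (exists h2, P h1 h2) is left e then projT1 (cid e) else h.
have kP h1 : O h1 -> P h1 (k h1).
  move=> [c1 V1]; rewrite /k; case: pselect => [e|[]]; first by case: cid.
  have : (zero_slice @^-1` dset c w setT) (drop0 (dcoord c w h1)) by [].
  by rewrite -(nu_chart_imageI setT wc) => -[h2 [_ c2] E]; exists h2.
have oO : mopen (delta_atlas ssA hF) O by exact: mopen_chart_preimage.
have On h1 : dom c (base (nu_delta h1)) -> O (nu_delta h1).
  by move=> c1; split=> //; rewrite /V /= dcoord_nu_delta; exact/dset_dcoord.
exists O, k; split=> //; first exact: On.
- apply: (smooth_mapP atD nu_atlas_atlas) => h1 Oh1.
  exists O, (nu_chart c w); split=> //.
    by apply: (sub_maximal_atlas nu_charts_atlas); exact: nu_chart_in.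
  split; first by move=> h2 /kP [].
  move=> a; apply: (msmooth_ext (f := fun h1 => coord (dchart c w) h1 ord0 (lift ord0 a))).
    by move=> h2 /kP [_ ->]; rewrite [RHS]mxE.
  by apply: (msmooth_sub _ oO (msmooth_chart_coord _ atD De)) => h2 [].
- move=> h' Oh'; have [ck Ek] := kP _ Oh'; apply: (nu_chart_inj wc) => //.
  by have [] := Oh'.
Qed.

Lemma delta_fiber0_diffeo : fiber0_diffeo A r N (delta_atlas ssA hF).
Proof.
exists nu_delta; split; first by move=> h p; exact: evaluation_nu_delta.
split; first exact: nu_delta_smooth.
  apply/seteqP; split=> [_ [h _ <-]|h /= h0]; first exact: delta_pi_nu_delta.
  by have [h' <-] := nu_delta_surj h0; exists h'.
exact: nu_delta_retraction.
Qed.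

End NormalBundle.

(** * The inverse function theorem *)

Section InverseFunction.
Context {R : realType}.

Lemma smooth_derive n (O : set 'rV[R]_n) (f : 'rV[R]_n -> R) i :
  smooth_on O f -> smooth_on O (fun v => 'D_(delta_mx ord0 i) f v).
Proof. by move=> Sf k; have /CkS[_ /(_ i) []] := Sf k.+1. Qed.

Lemma smooth_det n (O : set 'rV[R]_n) m (A : 'rV[R]_n -> 'M[R]_m) : open O ->
  (forall i j, smooth_on O (fun v => A v i j)) -> smooth_on O (fun v => \det (A v)).
Proof.
move=> oO SA; rewrite /determinant; apply: (smooth_sum _ oO) => s _.
apply: (smoothM oO); first exact: smooth_cst.
by apply: (smooth_prod _ oO) => i _; exact: SA.
Qed.

(** Entries of the inverse are cofactors divided by the determinant, hence rational in the entries
    of the matrix. *)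
Lemma smooth_invmx n (O : set 'rV[R]_n) m (A : 'rV[R]_n -> 'M[R]_m) : open O ->
  (forall i j, smooth_on O (fun v => A v i j)) -> (forall v, O v -> A v \in unitmx) ->
  forall i j, smooth_on O (fun v => invmx (A v) i j).
Proof.
move=> oO SA uA i j.
apply: (smooth_ext (f := fun v => (\det (A v))^-1 * ((-1) ^+ (j + i) * \det (row' j (col' i (A v))))) oO).
  by move=> v Ov; rewrite /invmx uA// !mxE.
apply: (smoothM oO).
  apply: (smoothV oO); last exact: smooth_det.
  by move=> v /uA; rewrite unitmxE unitfE.
apply: (smoothM oO); first exact: smooth_cst.
apply: (smooth_det oO) => a b.
by under [X in smooth_on _ X]eq_fun do rewrite !mxE; exact: SA.
Qed.

Section Local.
Variables (m : nat) (Phi : 'rV[R]_m -> 'rV[R]_m).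
(** The hypotheses are kept as a predicate of [O], since they pass to smaller open sets and
    [Psi_continuous] uses them there. *)
Let regular (O : set 'rV[R]_m) := [/\ open O,
  forall j, smooth_on O (fun v => Phi v ord0 j),
  forall v v', O v -> O v' -> Phi v = Phi v' -> v = v' &
  forall v u, O v -> 'd Phi v u = 0 -> u = 0].

(** The norm of ['rV[R]_m] is the maximum norm; minimizing by derivatives needs the smooth Euclidean
    square. *)
Let sqdist (x y : 'rV[R]_m) : R := \sum_j (x ord0 j + - y ord0 j) ^+ 2.

Let sqdist_ge0 x y : 0 <= sqdist x y.
Proof. by apply: sumr_ge0 => j _; exact: sqr_ge0. Qed.

Let sqdist_eq0 x y : sqdist x y = 0 -> x = y.
Proof.
move=> E; apply/rowP => j; apply/eqP; rewrite -subr_eq0 -sqrf_eq0.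
have := sqdist_ge0 x y; have := E => /eqP; rewrite psumr_eq0.
  by move=> /allP /(_ j (mem_index_enum _)).
by move=> i _; exact: sqr_ge0.
Qed.

Let sqdist_triangle x y z : sqdist x z <= 2 * sqdist x y + 2 * sqdist y z.
Proof.
rewrite /sqdist !mulr_sumr -big_split; apply: ler_sum => j _ /=.
(* In each coordinate the right side minus the left side is exactly this square. *)
have := sqr_ge0 (x ord0 j - 2 * y ord0 j + z ord0 j); nra.
Qed.

Let smooth_sqdist O y : regular O -> smooth_on O (fun v => sqdist (Phi v) y).
Proof.
move=> [oO SP _ _]; apply: (smooth_sum _ oO) => j _; apply: (smoothX _ oO).
by apply: (smoothD oO); [exact: SP|exact: smooth_cst].
Qed.

Let diff_Phi O v : regular O -> O v -> differentiable Phi v.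
Proof. by move=> [oO SP _ _] Ov; exact: (Ck_rV_differentiable oO Ov (fun j => SP j 1%N)). Qed.

Let jacobian_unit O v : regular O -> O v -> jacobian Phi v \in unitmx.
Proof.
move=> [_ _ _ inj] Ov; rewrite -row_free_unit; apply: inj_row_free => u.
by rewrite mul_rV_lin1; exact: inj.
Qed.

(** At a minimum, the derivative along [u] is twice the scalar product of [Phi c - y] with
    ['d Phi c u], and it vanishes. Since the differential is invertible, [u] can be chosen with
    image [Phi c - y], which is therefore 0. *)
Let critical O c y : regular O -> O c ->
  (exists2 e, 0 < e & forall v, ball c e v -> sqdist (Phi c) y <= sqdist (Phi v) y) ->
  Phi c = y.
Proof.
move=> rO Oc [e e0 minc]; have [oO SP _ _] := rO.
have Sf := smooth_sqdist y rO; pose f v := sqdist (Phi v) y.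
have df v : O v -> differentiable f v by move=> Ov; exact: (Ck_diff oO Ov (Sf 1%N)).
have D0 u : 'D_u f c = 0.
  have [e' e'0 e'O] := open_ball oO Oc.
  (* Adding 1 keeps [M] positive when [u] is 0; for parameters below [b] the line through [c] stays
     in both balls. *)
  pose M := `|u| + 1; have M0 : 0 < M by rewrite ltr_wpDl.
  pose b := Num.min e e' / M; have b0 : 0 < b by rewrite divr_gt0// lt_min e0 e'0.
  have inb s : s \in `](- b), b[ -> ball c e (c + s *: u) /\ O (c + s *: u).
    rewrite in_itv /= -ltr_norml => sb.
    have H i : `|c ord0 i - (c + s *: u) ord0 i| < Num.min e e'.
      rewrite !mxE opprD addNKr normrN normrM.
      apply: (@le_lt_trans _ _ (`|s| * M)); last by rewrite -ltr_pdivlMr.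
      by rewrite ler_wpM2l// (le_trans (rV_norm_le _ _))// lerDl.
    by split; [|apply: e'O]; apply: ball_rV => // i; have := H i; rewrite lt_min => /andP[].
  have dl s : s \in `](- b), b[ -> is_derive s 1 (fun s => f (c + s *: u)) ('D_u f (c + s *: u)).
    by move=> /inb [_ Os]; apply: derivable_line; apply: diff_derivable; exact: df.
  have b0' : (0 : R) \in `](- b), b[ by rewrite in_itv /= oppr_lt0 b0.
  have [|||_ <-] := @derive1_at_min R (fun s => f (c + s *: u)) (- b) b 0 _ _ b0'.
  - by rewrite ltW// gtrN.
  - by move=> s /dl [].
  - by move=> s /inb [sb _]; rewrite scale0r addr0; exact: minc.
  by have [_ ->] := dl 0 b0'; rewrite scale0r addr0.
have DE u : 'D_u f c = \sum_j (2 * (Phi c ord0 j + - y ord0 j)) * 'd Phi c u ord0 j.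
  have dPj j : differentiable (fun v => Phi v ord0 j) c by exact: (Ck_diff oO Oc (SP j 1%N)).
  rewrite /f /sqdist.
  rewrite (_ : (fun v => _) = \sum_(j < m) ((fun v => Phi v ord0 j) + cst (- y ord0 j)) ^+ 2); last first.
    by apply/funext => v; rewrite fct_sumE; apply: eq_bigr => j _; rewrite exprfctE.
  have dj j : derivable ((fun v => Phi v ord0 j) + cst (- y ord0 j)) c u.
    by apply: derivableD; [exact: diff_derivable|exact: derivable_cst].
  rewrite derive_sum; last by move=> j; exact: derivableX.
  apply: eq_bigr => j _; rewrite deriveX// deriveD ?derive_cst ?addr0//; last exact: diff_derivable.
  rewrite expr1 [LHS]/GRing.scale /= -[X in _ = _ * X](_ : 'D_u (fun v => Phi v ord0 j) c = _).
    by rewrite mulr_natl.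
  by rewrite -(deriveE _ (diff_Phi rO Oc)) derive_mx ?mxE//; apply: diff_derivable; exact: diff_Phi Oc.
pose u := (Phi c - y) *m invmx (jacobian Phi c).
have uE : 'd Phi c u = Phi c - y.
  by rewrite -mul_rV_lin1 -/(jacobian Phi c) mulmxKV// (jacobian_unit rO).
apply: sqdist_eq0; have := DE u; rewrite D0 uE => /esym.
rewrite (eq_bigr (fun j => 2 * (Phi c ord0 j + - y ord0 j) ^+ 2)); last first.
  by move=> j _; rewrite !mxE expr2 mulrA.
by rewrite -mulr_sumr => /eqP; rewrite mulf_eq0 pnatr_eq0 /= => /eqP.
Qed.

(* On a small closed cube around [v], the squared distance from [Phi] to a point
   near [Phi v] has an interior minimum, which by [critical] is a zero. *)
Let open_image O : regular O -> open (Phi @` O).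
Proof.
move=> rO; have [oO SP injP _] := rO; apply: open_local => _ [v0 Ov0 <-].
have [e e0 eO] := open_ball oO Ov0.
pose I i := `[v0 ord0 i - e / 2, v0 ord0 i + e / 2]%classic.
pose K := [set v : 'rV[R]_m | forall i, I i (v ord0 i)].
have cK : compact K by apply: (@rV_compact _ _ I) => i; exact: segment_compact.
have KO : K `<=` O.
  move=> v Kv; apply: eO; apply: ball_rV => // i; have := Kv i.
  rewrite /I /= in_itv /= => /andP[v1 v2]; rewrite ltr_norml; apply/andP; split; lra.
pose S := ~` ball v0 (e / 2) `&` K.
have e20 : 0 < e / 2 by rewrite divr_gt0.
have cS : compact S.
  apply: (subclosed_compact _ cK); last by move=> v [].
  apply: closedI; first by apply: open_closedC; exact: ball_open.
  by apply: compact_closed cK; exact: norm_hausdorff.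
have cont y (Q : set 'rV[R]_m) : Q `<=` K -> {within Q, continuous (fun v => sqdist (Phi v) y)}.
  move=> QK; apply: continuous_in_subspaceT => v /set_mem /QK /KO Ov.
  exact: smooth_continuous (smooth_sqdist y rO) Ov.
have Kv0 : K v0 by move=> i; rewrite /I /= in_itv /=; apply/andP; split; lra.
(* The minimum over the compact shell [S] is positive by injectivity of [Phi]. If [S] is empty, as
   in dimension 0, any positive number will do. *)
have [d d0 dS] : exists2 d, 0 < d & forall v, S v -> d <= sqdist (Phi v) (Phi v0).
  have [S0|S0] := pselect (S !=set0); last first.
    by exists 1 => // v Sv; case: S0; exists v.
  have [c /set_mem Sc minc] := EVT_min_rV S0 cS (cont (Phi v0) S (@subIsetr _ _ _)).
  exists (sqdist (Phi c) (Phi v0)); last by move=> v Sv; apply: minc; exact/mem_set.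
  rewrite lt_neqAle sqdist_ge0 andbT eq_sym; apply/eqP => /sqdist_eq0 E.
  have [nb Kc] := Sc; apply: nb; rewrite (injP c v0)//; last exact: KO.
  exact: ballxx.
(* For [y] in [V], a minimizer [c] satisfies [sqdist (Phi c) y <= sqdist (Phi v0) y < d / 4]. By
   [sqdist_triangle], [sqdist (Phi c) (Phi v0) < d], so [c] is not in the shell and the minimum is
   interior. *)
pose V : set 'rV[R]_m := setT `&` (fun y => sqdist y (Phi v0)) @^-1` [set t | t < d / 4].
have Ssq : smooth_on setT (fun y => sqdist y (Phi v0)).
  apply: (smooth_sum _ openT) => j _; apply: (smoothX _ openT).
  by apply: (smoothD openT); [exact: smooth_coord|exact: smooth_cst].
exists V; split.
- by apply: (open_preimage openT _ (@open_lt _ _)) => y Ty; exact: smooth_continuous Ssq Ty.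
- split=> //=; rewrite /sqdist big1 ?divr_gt0// => j _; by rewrite subrr expr0n.
move=> y [_ /= yd].
have [c /set_mem Kc minc] := EVT_min_rV (ex_intro _ v0 Kv0) cK (cont y K (@subset_refl _ _)).
have symd : sqdist (Phi v0) y = sqdist y (Phi v0).
  by apply: eq_bigr => j _; rewrite -sqrrN opprD opprK addrC.
have bc : ball v0 (e / 2) c.
  apply: contrapT => nb; have := dS c (conj nb Kc).
  have := minc v0 (mem_set Kv0); have := sqdist_triangle (Phi c) y (Phi v0).
  rewrite symd; lra.
exists c; first exact: KO.
apply: (critical rO (KO _ Kc)).
have [e' e'0 e'b] := open_ball (ball_open v0 (e / 2)) bc.
exists e' => // v /e'b vb; apply: minc; apply/mem_set => i.
by have := ball_rVP i vb; rewrite /I /= in_itv /= ltr_norml => /andP[? ?]; apply/andP; split; lra.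
Qed.

Let Psi (O : set 'rV[R]_m) (y : 'rV[R]_m) : 'rV[R]_m :=
  if pselect (exists2 v, O v & Phi v = y) is left e then projT1 (cid2 e) else 0.

Let PsiK O v : regular O -> O v -> Psi O (Phi v) = v.
Proof.
move=> [_ _ inj _] Ov; rewrite /Psi; case: pselect => [e|[]]; last by exists v.
by case: cid2 => v' Ov' /= E; exact: inj.
Qed.

(** Continuity of the inverse is openness of the images of the smaller sets [O] intersected with a
    ball, to which [open_image] applies again. *)
Let Psi_continuous O v : regular O -> O v -> {for Phi v, continuous (Psi O)}.
Proof.
move=> rO Ov W; rewrite (PsiK rO Ov) => nW; have [oO SP inj dinj] := rO.
have [e /= e0 eW] := (nbhs_ballP _ _).1 nW.
have rO' : regular (O `&` ball v e).
  have oO' : open (O `&` ball v e) by apply: openI => //; exact: ball_open.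
  split=> //.
  - by move=> j; apply: smooth_sub (SP j) => x [].
  - by move=> a b [Oa _] [Ob _]; exact: inj.
  - by move=> a u [Oa _]; exact: dinj.
have : nbhs (Phi v) (Phi @` (O `&` ball v e)).
  apply: open_nbhs_nbhs; split; first exact: open_image.
  by exists v => //; split=> //; exact: ballxx.
by apply: filterS => _ [v' [Ov' bv'] <-]; rewrite /= (PsiK rO Ov'); exact: eW.
Qed.

Let rV_norm_bound k (x : 'rV[R]_k) c : 0 <= c -> (forall i, `|x ord0 i| <= c) -> `|x| <= c.
Proof.
move=> c0 H; rewrite [leLHS]/Num.Def.normr/= mx_normrE; apply: bigmax_le => // -[i j] _.
by rewrite ord1; exact: H.
Qed.

Let mulmx_bound (B : 'M[R]_m) : exists2 C, 0 < C & forall u : 'rV[R]_m, `|u *m B| <= C * `|u|.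
Proof.
exists (\sum_i \sum_j `|B i j| + 1) => [|u].
  by rewrite ltr_wpDl// sumr_ge0// => i _; exact: sumr_ge0.
have C0 : 0 <= \sum_i \sum_j `|B i j| by apply: sumr_ge0 => i _; exact: sumr_ge0.
apply: rV_norm_bound => [|j]; first by rewrite mulr_ge0// addr_ge0.
rewrite mxE (le_trans (ler_norm_sum _ _ _))//.
apply: (@le_trans _ _ (\sum_i `|B i j| * `|u|)).
  by apply: ler_sum => i _; rewrite normrM mulrC ler_wpM2l// rV_norm_le.
rewrite -mulr_suml ler_wpM2r// (@le_trans _ _ (\sum_i \sum_j `|B i j|))// ?lerDl//.
by apply: ler_sum => i _; rewrite (bigD1 j)//= lerDl sumr_ge0.
Qed.

(** For the increment [k h] of [Psi O] along [h *: e], differentiability of [Phi] gives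
    [h *: e = 'd Phi v (k h) + o(k h)]. Applying the inverse matrix [B] yields
    [h *: z - k h = o(k h)]. *)
Let Psi_derive O v e : regular O -> O v ->
  is_derive (Phi v) e (Psi O) (e *m invmx (jacobian Phi v)).
Proof.
move=> rO Ov; set B := invmx _; set z := e *m B; have [oO SP inj dinj] := rO.
suff H : (fun h : R => h^-1 *: ((Psi O \o shift (Phi v)) (h *: e) - Psi O (Phi v))) @ 0^' --> z.
  by apply: DeriveDef; [apply/cvg_ex; exists z|exact: cvg_lim H].
apply/cvgrPdist_le => eta eta0.
have [C C0 CB] := mulmx_bound B.
(* The bound [d <= 1/2] absorbs the error in [k h] and gives norm at most [2 * |h| * |z|] for it;
   the other bound makes the final error [2 * d * |z|] at most [eta]. The summand 1 allows
   [z = 0]. *)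
pose d := Num.min 2^-1 (eta / (2 * `|z| + 1)).
have z1 : 0 < 2 * `|z| + 1 by rewrite ltr_wpDl// mulr_ge0.
have d0 : 0 < d by rewrite lt_min invr_gt0 ltr0n divr_gt0.
have d2 : d <= 2^-1 by rewrite ge_min lexx.
have dz : 2 * d * `|z| <= eta.
  have : d <= eta / (2 * `|z| + 1) by rewrite ge_min lexx orbT.
  rewrite ler_pdivlMr// => H; lra.
pose k (h : R) := Psi O (h *: e + Phi v) - v.
have line0 : (fun h : R => h *: e + Phi v) @ (0 : R) --> Phi v.
  have cl : {for (0 : R), continuous (fun h : R => h *: e + Phi v)}.
    apply: continuousD; last exact: cst_continuous.
    by apply: continuousZr_tmp.
  by have := cl; rewrite /prop_for /continuous_at scale0r add0r.
have diffo := diff_locally (diff_Phi rO Ov).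
have /eqaddoP /(_ (d / C)) := diffo; rewrite divr_gt0// => /(_ isT) nearo.
have k0 : k @ (0 : R) --> (0 : 'rV[R]_m).
  rewrite -(subrr v); apply: cvgB; last exact: cvg_cst.
  have := Psi_continuous rO Ov; rewrite /prop_for /continuous_at (PsiK rO Ov).
  by apply: cvg_comp.
have nearh : \forall h \near (0 : R), (Phi @` O) (h *: e + Phi v) /\
    `|Phi (k h + v) - Phi v - 'd Phi v (k h)| <= d / C * `|k h|.
  apply: filterI.
    apply: line0; apply: open_nbhs_nbhs; split; first exact: open_image.
    by exists v.
  have nearx : \forall x \near (0 : 'rV[R]_m),
      `|Phi (x + v) - Phi v - 'd Phi v x| <= d / C * `|x|.
    by apply: filterS nearo => x; rewrite -addrA -opprD.
  exact: (k0 _ nearx).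
near=> h; have h0 : h != 0 by near: h; exact: nbhs_dnbhs_neq.
have [[v' Ov' v'E] He] : (Phi @` O) (h *: e + Phi v) /\
    `|Phi (k h + v) - Phi v - 'd Phi v (k h)| <= d / C * `|k h|.
  by near: h; apply: cvg_within; exact: nearh.
have kv : k h + v = v' by rewrite /k subrK -v'E (PsiK rO Ov').
have uJ := jacobian_unit rO Ov.
have E : (h *: e - 'd Phi v (k h)) *m B = h *: z - k h.
  by rewrite mulmxBl -scalemxAl -[in 'd Phi v _]mul_rV_lin1 -/(jacobian Phi v) mulmxK.
rewrite kv v'E addrK in He.
have Hk : `|h *: z - k h| <= d * `|k h|.
  rewrite -E (le_trans (CB _))//.
  by apply: le_trans (ler_wpM2l (ltW C0) He) _; rewrite mulrA mulrCA divff ?mulr1// gt_eqF.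
have kh : `|k h| <= 2 * `|h| * `|z|.
  have : `|k h| <= `|h *: z| + `|h *: z - k h|.
    by rewrite -[in leLHS](subKr (h *: z) (k h)) (le_trans (ler_normB _ _)).
  have hz : `|h *: z| = `|h| * `|z| by rewrite normrZ.
  rewrite hz; have := normr_ge0 (k h); nra.
rewrite (PsiK rO Ov) /= -/(k h).
have -> : z - h^-1 *: k h = h^-1 *: (h *: z - k h).
  by rewrite [RHS]scalerBr scalerA mulVf// scale1r.
rewrite normrZ normfV ler_pdivrMl ?normr_gt0//.
apply: le_trans Hk _; apply: le_trans (ler_wpM2l (ltW d0) kh) _.
have := normr_ge0 h; nra.
Unshelve. all: by end_near. Qed.

(* For an injective map no shrinking of the domain is needed. *)
Lemma inverse_function (O : set 'rV[R]_m) : open O ->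
  (forall j, smooth_on O (fun v => Phi v ord0 j)) ->
  (forall v v', O v -> O v' -> Phi v = Phi v' -> v = v') ->
  (forall v u, O v -> 'd Phi v u = 0 -> u = 0) ->
  open (Phi @` O) /\ exists G : 'rV[R]_m -> 'rV[R]_m,
    (forall j, smooth_on (Phi @` O) (fun y => G y ord0 j)) /\
    forall v, O v -> G (Phi v) = v.
Proof.
move=> oO SP inj dinj; have rO : regular O by [].
have oI := open_image rO; split=> //; exists (Psi O); split; last by move=> v; exact: PsiK.
have SJ a b : smooth_on O (fun v => jacobian Phi v a b).
  apply: smooth_ext (smooth_derive a (SP b)) => // v Ov.
  have dP := diff_Phi rO Ov.
  have := deriveEjacobian (delta_mx ord0 a) dP; rewrite derive_mx; last exact: diff_derivable.
  by move=> /(congr1 (fun M : 'rV[R]_m => M ord0 b)); rewrite mxE -rowE mxE.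
have SB := smooth_invmx oO SJ (fun v Ov => jacobian_unit rO Ov).
have Pd y i j : (Phi @` O) y -> is_derive y (delta_mx ord0 i) (fun y => Psi O y ord0 j)
    (invmx (jacobian Phi (Psi O y)) i j).
  move=> [v Ov <-]; rewrite (PsiK rO Ov).
  have [d1 d2] := Psi_derive (delta_mx ord0 i) rO Ov.
  apply: DeriveDef; first by have /derivable_mxP := d1; exact.
  have := derive_mx d1; rewrite d2 => /(congr1 (fun M : 'rV[R]_m => M ord0 j)).
  by rewrite -rowE !mxE.
(* The derivative of [Psi O] is the smooth matrix function [invmx (jacobian Phi _)] composed with
   [Psi O], so [Psi O] of class [C^k] is of class [C^(k+1)]. *)
move=> j k; elim: k j => [|k IH] j.
  apply/Ck0 => _ [v Ov <-].
  apply: (@continuous_comp _ _ _ (Psi O) (fun y : 'rV[R]_m => y ord0 j)).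
    exact: Psi_continuous.
  exact: coord_continuous.
apply/CkS; split.
  by move=> y Iy; exact: Ck_continuous (IH j) Iy.
move=> i; split=> [y Iy|]; first by have [] := Pd y i j Iy.
apply: (Ck_ext (f := fun y => invmx (jacobian Phi (Psi O y)) i j) oI).
  by move=> y Iy; have [_ ->] := Pd y i j Iy.
apply: (Ck_comp (O' := O) (f := fun v => invmx (jacobian Phi v) i j) oI oO) => //.
  by move=> _ [v Ov <-]; rewrite (PsiK rO Ov).
exact: SB.
Qed.

End Local.
End InverseFunction.

(** * Uniqueness of the manifold structure *)

Section LocalRepresentatives.
Context {R : realType}.

Lemma diff_near_comp p q (W : normedModType R) (V : set 'rV[R]_p) (F : 'rV[R]_p -> 'rV[R]_q)
    (G : 'rV[R]_q -> W) (H : 'rV[R]_p -> W) v u :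
  open V -> V v -> differentiable F v -> differentiable G (F v) -> differentiable H v ->
  (forall z, V z -> G (F z) = H z) -> 'd G (F v) ('d F v u) = 'd H v u.
Proof.
move=> oV Vv dF dG dH E.
have dGF := differentiable_comp dF dG.
rewrite -[LHS]/(('d G (F v) \o 'd F v) u) -(diff_comp dF dG) -(deriveE u dH) -(deriveE u dGF).
apply: near_eq_derive.
by apply: filterS (open_nbhs_nbhs (conj oV Vv)) => z /E.
Qed.

Section Rep.
Context {n m : nat} {X Y : Type}.

Definition rep (c : chart R n X) (d : chart R m Y) (f : X -> Y) (v : 'rV[R]_n) : 'rV[R]_m :=
  \row_j in_chart c (fun x => coord d (f x) ord0 j) v.

Definition rep_dom (c : chart R n X) (d : chart R m Y) (O : set X) (f : X -> Y) :=
  coord c @` ((O `&` f @^-1` dom d) `&` dom c).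

Lemma repE c d f x : is_chart c -> dom c x -> rep c d f (coord c x) = coord d (f x).
Proof. by move=> cc cx; apply/rowP => j; rewrite mxE in_chartE. Qed.

Lemma rep_smooth (A : set (chart R n X)) (B : set (chart R m Y)) O f c d :
  atlas A -> smooth_map A B O f -> A c -> B d ->
  open (rep_dom c d O f) /\ forall j, smooth_on (rep_dom c d O f) (fun v => rep c d f v ord0 j).
Proof.
move=> atA Sf Ac Bd; have [oO SO] := Sf d Bd; split; first exact: oO.
move=> j; under [X in smooth_on _ X]eq_fun do rewrite mxE.
exact: msmooth_chart (SO j).
Qed.

Lemma rep_differentiable (A : set (chart R n X)) (B : set (chart R m Y)) O f c d x :
  atlas A -> smooth_map A B O f -> A c -> B d -> dom c x -> O x -> dom d (f x) ->
  differentiable (rep c d f) (coord c x).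
Proof.
move=> atA Sf Ac Bd cx Ox dx; have [oO SO] := rep_smooth atA Sf Ac Bd.
by apply: (Ck_rV_differentiable oO _ (fun j => SO j 1%N)); exists x.
Qed.

End Rep.

Lemma rep_comp n m l X Y Z (A : set (chart R n X)) (B : set (chart R m Y))
    (c : chart R n X) (d : chart R m Y) (e : chart R l Z) O Q f g x :
  atlas A -> atlas B -> smooth_map A B O f -> A c -> B d ->
  open (rep_dom d e Q g) -> dom c x -> O x -> dom d (f x) -> Q (f x) -> dom e (g (f x)) ->
  exists V, [/\ open V, V (coord c x) & forall v, V v ->
    exists x', [/\ O x', dom c x', Q (f x'), v = coord c x' &
      rep d e g (rep c d f v) = coord e (g (f x'))]].
Proof.
move=> atA atB Sf Ac Bd oQ cx Ox dx Qx ex.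
have [ccA _ _] := atA; have [ccB _ _] := atB.
have [oO SO] := rep_smooth atA Sf Ac Bd.
exists (rep_dom c d O f `&` rep c d f @^-1` rep_dom d e Q g); split.
- exact: open_smooth_preimage.
- split; first by exists x.
  by rewrite /= repE//; [exists (f x)|exact: ccA].
move=> _ [[x' [[Ox' dx'] cx'] <-]]; have cc := ccA c Ac; have dd := ccB d Bd.
rewrite /= repE// => -[y [[Qy ey] dy] yE].
have <- : y = f x' by exact: (chart_inj dd dy dx').
exists x'; split=> //; last by rewrite repE//; rewrite -(chart_inj dd dy dx' yE).
by rewrite -(chart_inj dd dy dx' yE).
Qed.

(* Since [kap] and [l] together with [a] and a complement of its image are
   inverse to each other, the kernel of [l] is the image of [a]. *)
Lemma kernel_image n (a : {linear 'rV[R]_n -> 'rV[R]_n.+1})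
    (kap : {linear 'rV[R]_n.+1 -> 'rV[R]_n}) (l : {linear 'rV[R]_n.+1 -> R}) w u :
  (forall x, kap (a x) = x) -> (forall x, l (a x) = 0) -> l w = 1 ->
  l u = 0 -> u = a (kap u).
Proof.
move=> ka la lw lu.
pose w' := w - a (kap w).
have kw' : kap w' = 0 by rewrite /w' linearB /= ka subrr.
have lw' : l w' = 1 by rewrite /w' linearB /= la subr0.
pose T : 'M[R]_(n + 1, n.+1) := col_mx (lin1_mx a) w'.
have TE (x : 'rV[R]_n) (s : 'rV[R]_1) : row_mx x s *m T = a x + s ord0 ord0 *: w'.
  by rewrite mul_row_col mul_rV_lin1 [s in s *m _]mx11_scalar mul_scalar_mx.
have Tfree : row_free T.
  apply: inj_row_free => z; rewrite -[z]hsubmxK TE => E.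
  have s0 : (rsubmx z) ord0 ord0 = 0.
    have := congr1 l E; rewrite linearD linearZ /= la lw' linear0 add0r.
    by rewrite [_ *: _]mulr1.
  have x0 : lsubmx z = 0.
    by have := congr1 kap E; rewrite s0 scale0r addr0 ka linear0.
  have r0 : rsubmx z = 0 by apply/rowP => i; rewrite ord1 s0 mxE.
  by rewrite x0 r0 row_mx0.
have Tfull : row_full T by move: Tfree; rewrite /row_free /row_full => /eqP ->; rewrite addn1.
have /submxP [z zE] := submx_full u Tfull.
rewrite -[z]hsubmxK TE in zE.
have s0 : (rsubmx z) ord0 ord0 = 0.
  have := lu; rewrite zE linearD linearZ /= la lw' add0r.
  by rewrite [_ *: _]mulr1.
by move: zE; rewrite s0 scale0r addr0 => ->; rewrite ka.
Qed.

(** From [i u = 0] follows [l u = 0], so [u = a x] by [kernel_image]. Then [a' x = i (a x) = 0], and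
    the left inverse of [a'] gives [x = 0]. *)
Lemma extension_injective n (a a' : {linear 'rV[R]_n -> 'rV[R]_n.+1})
    (kap kap' : {linear 'rV[R]_n.+1 -> 'rV[R]_n})
    (i : {linear 'rV[R]_n.+1 -> 'rV[R]_n.+1}) (l l' : {linear 'rV[R]_n.+1 -> R}) w u :
  (forall x, kap (a x) = x) -> (forall x, kap' (a' x) = x) -> (forall x, i (a x) = a' x) ->
  (forall x, l (a x) = 0) -> (forall x, l' (i x) = l x) -> l w = 1 ->
  i u = 0 -> u = 0.
Proof.
move=> ka ka' ia la li lw iu.
have lu : l u = 0 by rewrite -li iu linear0.
have uE := kernel_image ka la lw lu.
have x0 : kap u = 0 by rewrite -(ka' (kap u)) -ia -uE iu linear0.
by rewrite uE x0 linear0.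
Qed.

End LocalRepresentatives.

(** * Two structures with the same fiber *)

Section Comparison.
Context {R : realType} {n : nat} {Y Z : Type} {B : set (chart R n Y)}.
Context {D D' : set (chart R n.+1 Z)} {j : Y -> Z} {pr : Z -> R} {t : R}.
Hypotheses (atB : atlas B) (atD : atlas D) (atD' : atlas D').
Hypothesis idS : smooth_map D' D setT id.
Hypothesis jD : diffeo_onto D B j [set z | pr z = t].
Hypothesis jD' : diffeo_onto D' B j [set z | pr z = t].
Hypothesis prD : msmooth D setT pr.
Hypothesis prD' : submersion D' pr.

(** An instance of [extension_injective]: [a] and [a'] are the differentials of [j] into [D'] and
    [D], [kap] and [kap'] those of the local retractions, [i] that of the identity, [l] and [l']
    those of [pr]. Submersivity for [D'] provides the vector [w]. *)
Lemma identity_immersion d e z u : D' d -> D e -> dom d z -> dom e z -> pr z = t ->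
  'd (rep d e id) (coord d z) u = 0 -> u = 0.
Proof.
move=> Dd De dz ez zt.
have [jS jR jk] := jD; have [jS' _ jk'] := jD'; have [prS' prsub] := prD'.
have [y _ jy] : range j z by rewrite jR.
have [b Bb by_] : exists2 b, B b & dom b y by have [_ _ cov] := atB; exact: cov.
have [Q1 [k1 [oQ1 Q1y kS1 kK1]]] := jk' y.
have [Q2 [k2 [oQ2 Q2y kS2 kK2]]] := jk y.
have [ccB _ _] := atB; have [ccD _ _] := atD; have [ccD' _ _] := atD'.
have bb := ccB b Bb; have dd := ccD' d Dd; have ee := ccD e De.
subst z.
have dj : differentiable (rep b d j) (coord b y) by exact: (rep_differentiable atB jS' Bb Dd).
have ej : differentiable (rep b e j) (coord b y) by exact: (rep_differentiable atB jS Bb De).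
have bk1 : dom b (k1 (j y)) by rewrite kK1.
have bk2 : dom b (k2 (j y)) by rewrite kK2.
have dk1 : differentiable (rep d b k1) (coord d (j y)).
  exact: (rep_differentiable atD' kS1 Dd Bb).
have dk2 : differentiable (rep e b k2) (coord e (j y)).
  exact: (rep_differentiable atD kS2 De Bb).
have did : differentiable (rep d e id) (coord d (j y)).
  exact: (rep_differentiable atD' idS Dd De).
have Ejd : rep b d j (coord b y) = coord d (j y) by rewrite repE.
have Eje : rep b e j (coord b y) = coord e (j y) by rewrite repE.
have Eid : rep d e id (coord d (j y)) = coord e (j y) by rewrite repE.
have [oT' oT] := (mopenT atD', mopenT atD).
have dpr' : differentiable (in_chart d pr) (coord d (j y)).
  apply: (Ck_diff (oT' d Dd) _ (msmooth_chart atD' oT' Dd prS' 1%N)).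
  by exists (j y).
have dpr : differentiable (in_chart e pr) (coord e (j y)).
  apply: (Ck_diff (oT e De) _ (msmooth_chart atD oT De prD 1%N)).
  by exists (j y).
have R1 := (rep_smooth atD' kS1 Dd Bb).1.
have R2 := (rep_smooth atD kS2 De Bb).1.
have R3 := (rep_smooth atD' idS Dd De).1.
have ka x : 'd (rep d b k1) (coord d (j y)) ('d (rep b d j) (coord b y) x) = x.
  have [V [oV Vy VE]] := rep_comp atB atD' jS' Bb Dd R1 by_ I dz Q1y bk1.
  rewrite -Ejd (diff_near_comp (V := V) (H := id)) ?Ejd//.
  - by rewrite (@diff_lin _ _ _ idfun)//; move=> ?; exact: cvg_id.
  - by move=> v /VE [y' [_ by' Q1y' -> ->]]; rewrite kK1.
have ka' x : 'd (rep e b k2) (coord e (j y)) ('d (rep b e j) (coord b y) x) = x.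
  have [V [oV Vy VE]] := rep_comp atB atD jS Bb De R2 by_ I ez Q2y bk2.
  rewrite -Eje (diff_near_comp (V := V) (H := id)) ?Eje//.
  - by rewrite (@diff_lin _ _ _ idfun)//; move=> ?; exact: cvg_id.
  - by move=> v /VE [y' [_ by' Q2y' -> ->]]; rewrite kK2.
have aE x : 'd (rep d e id) (coord d (j y)) ('d (rep b d j) (coord b y) x) =
    'd (rep b e j) (coord b y) x.
  have [V [oV Vy VE]] := rep_comp atB atD' jS' Bb Dd R3 by_ I dz I ez.
  rewrite -Ejd (diff_near_comp (V := V) (H := rep b e j)) ?Ejd//.
  by move=> v /VE [y' [_ by' _ -> ->]]; rewrite repE.
have la x : 'd (in_chart d pr) (coord d (j y)) ('d (rep b d j) (coord b y) x) = 0.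
  have [oV SV] := rep_smooth atB jS' Bb Dd.
  rewrite -Ejd (diff_near_comp (V := rep_dom b d setT j) (H := cst t)) ?Ejd//.
  - by rewrite diff_cst.
  - by exists y.
  - move=> _ [y' [[_ dy'] by'] <-]; rewrite repE// in_chartE//.
    by have : range j (j y') by []; rewrite jR.
have lE x : 'd (in_chart e pr) (coord e (j y)) ('d (rep d e id) (coord d (j y)) x) =
    'd (in_chart d pr) (coord d (j y)) x.
  have dpr2 : differentiable (in_chart e pr) (rep d e id (coord d (j y))) by rewrite Eid.
  have R3y : rep_dom d e setT id (coord d (j y)) by exists (j y).
  have E v : rep_dom d e setT id v -> in_chart e pr (rep d e id v) = in_chart d pr v.
    by move=> [z [[_ ez'] dz'] <-]; rewrite repE// !in_chartE.
  have := diff_near_comp x R3 R3y did dpr2 dpr' E.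
  by rewrite Eid.
have [w lw] := prsub d (j y) (in_chart d pr) Dd dz (fun z dz => esym (in_chartE pr dd dz)) 1.
exact: (extension_injective ka ka' aE la lE lw).
Qed.

End Comparison.

Lemma smooth_structure_eq (R : realType) n (X : Type) (A B : set (chart R n X)) :
  smooth_structure A -> smooth_structure B ->
  (forall a b, A a -> B b -> compatible a b) -> A = B.
Proof.
move=> ssA ssB co; have [chA _ _] := smooth_structure_atlas ssA.
have [chB _ _] := smooth_structure_atlas ssB.
apply/seteqP; split=> c Cc.
  rewrite (ss_maximal ssB); split; first exact: chA.
  by move=> b Bb; exact: co.
rewrite (ss_maximal ssA); split; first exact: chB.
by move=> a Aa; have [? ?] := co a c Aa Cc.
Qed.

Section Uniqueness.
Context {R : realType} {n r : nat} {X : Type} {A : set (chart R n X)}.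
Context {F : nat -> set X -> set (X -> R)} {N : set X}.
Hypothesis ssA : smooth_structure A.
Hypothesis hF : weighted_pair A r F N.
Let D := delta_atlas ssA hF.
Context {D' : set (chart R n.+1 (delta F))}.
Hypothesis ssD' : smooth_structure D'.
Hypothesis evD' : forall p, rees F p -> msmooth D' setT (evaluation (F := F) p).

Lemma delta_id_smooth : smooth_map D' D setT id.
Proof.
have atD' := smooth_structure_atlas ssD'.
by apply: (smooth_into_delta (phi := id) atD' (mopenT atD')) => p Rp; exact: evD'.
Qed.

Hypothesis subD' : submersion D' (delta_pi (F := F)).
Hypothesis fib0 : fiber0_diffeo A r N D'.
Hypothesis fib : forall t : R, t != 0 -> fiber_diffeo A D' t.

(* [D'] and [D] restrict to the same structure on the fiber through [h], and
   [delta_pi] is a submersion for [D'] that is smooth for [D]. *)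
Lemma delta_id_immersion d e h u : D' d -> D e -> dom d h -> dom e h ->
  'd (rep d e id) (coord d h) u = 0 -> u = 0.
Proof.
move=> Dd De dh eh.
have atA := smooth_structure_atlas ssA.
have atD' := smooth_structure_atlas ssD'; have atD := delta_atlas_atlas ssA hF.
have piD : msmooth D setT (delta_pi (F := F)) := evaluation_smooth (rees_z ssA hF).
have [t0|t0] := eqVneq (delta_pi h) 0.
  have [j [jE jD]] := delta_fiber0_diffeo ssA hF; have [j' [jE' jD']] := fib0.
  (* Both inclusions have the same evaluations on Rees elements, so they are one map; only the
     structures on the target can differ. *)
  have E : j' = j.
    by apply/funext => y; apply: delta_ext => p Rp; rewrite jE ?jE'.
  rewrite E in jD'.
  exact: (identity_immersion (nu_atlas_atlas ssA hF) atD atD' delta_id_smooth jD jD' piD subD').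
have [j [jE jD]] := delta_fiber_diffeo ssA hF t0; have [j' [jE' jD']] := fib t0.
have E : j' = j.
  by apply/funext => y; apply: delta_ext => p Rp; rewrite jE ?jE'.
rewrite E in jD'.
exact: (identity_immersion atA atD atD' delta_id_smooth jD jD' piD subD').
Qed.

(** The transition from a chart of [D'] to one of [D] is the identity read in these charts. It is
    injective with injective differential, so [inverse_function] supplies the opposite transition on
    the whole overlap, and maximality of the atlases gives equality. *)
Lemma delta_structure_unique : D' = D.
Proof.
have atD' := smooth_structure_atlas ssD'; have atD := delta_atlas_atlas ssA hF.
have [ccD _ _] := atD; have [ccD' _ _] := atD'.
apply: smooth_structure_eq => //; first exact: delta_smooth_structure.
move=> d e Dd De; have dd := ccD' d Dd; have ee := ccD e De.
have [oO SO] := rep_smooth atD' delta_id_smooth Dd De.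
have OE : rep_dom d e setT id = coord d @` (dom d `&` dom e).
  by rewrite /rep_dom setTI setIC.
rewrite OE in oO SO.
have [oI [G [SG GK]]] : open (rep d e id @` (coord d @` (dom d `&` dom e))) /\
    exists G : 'rV[R]_n.+1 -> 'rV[R]_n.+1,
    (forall j, smooth_on (rep d e id @` (coord d @` (dom d `&` dom e))) (fun y => G y ord0 j)) /\
    forall v, (coord d @` (dom d `&` dom e)) v -> G (rep d e id v) = v.
  apply: inverse_function => //.
    move=> _ _ [h [dh eh] <-] [h' [dh' eh'] <-]; rewrite !repE// => /(chart_inj ee eh eh') ->.
    by [].
  move=> _ u [h [dh eh] <-]; exact: (delta_id_immersion Dd De dh eh).
have IE : rep d e id @` (coord d @` (dom d `&` dom e)) = coord e @` (dom e `&` dom d).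
  apply/seteqP; split=> [_ [_ [h [dh eh] <-] <-]|_ [h [eh dh] <-]].
    by rewrite repE//; exists h.
  by exists (coord d h); [exists h|rewrite repE].
rewrite IE in oI SG.
split; split=> //.
  exists (rep d e id); split=> // h dh eh; by rewrite repE.
exists G; split=> // h eh dh.
by have := GK (coord d h); rewrite repE// => ->//; exists h.
Qed.

End Uniqueness.

Theorem theorem5p1 (R : realType) (n r : nat) (M : Type)
    (A : set (chart R n M)) (F : nat -> set M -> set (M -> R)) (N : set M)
    (hM : smooth_structure A) (hF : weighted_pair A r F N) :
  exists D : set (chart R n.+1 (delta F)),
    [/\ smooth_structure D,
        (forall p, rees F p -> msmooth D setT (evaluation (F := F) p)),
        (N !=set0 -> range (delta_pi (F := F)) = setT)
          /\ submersion D (delta_pi (F := F)),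
        fiber0_diffeo A r N D
          /\ (forall t : R, t != 0 -> fiber_diffeo A D t) &
        forall D' : set (chart R n.+1 (delta F)),
          smooth_structure D' ->
          (forall p, rees F p -> msmooth D' setT (evaluation (F := F) p)) ->
          smooth_map D' D setT id /\
          (submersion D' (delta_pi (F := F)) ->
           fiber0_diffeo A r N D' ->
           (forall t : R, t != 0 -> fiber_diffeo A D' t) ->
           D' = D)].
Proof.
exists (delta_atlas hM hF); split.
- exact: delta_smooth_structure.
- exact: evaluation_smooth.
- by split; [exact: (delta_pi_surjective hM hF)|exact: delta_pi_submersion].
- by split; [exact: delta_fiber0_diffeo|exact: delta_fiber_diffeo].
- move=> D' ssD' evD'; split; first exact: delta_id_smooth.
  exact: delta_structure_unique.
Qed.
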